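(* Let $m\ge 2$, let $Q=Q^m$ be the complex quadric, and let $\mathfrak m$ (identified with $T_pQ$, $p\in Q$ fixed) be equipped with its unitary structure $\langle\cdot,\cdot\rangle_{\mathbb C}$, its complex structure $J$ and its $\mathbb CQ$-structure $\mathfrak A=\mathfrak A(Q,p)$, as described in the context. A real linear subspace $\mathfrak m'$ with $\{0\}\neq\mathfrak m'\subsetneq\mathfrak m$ is a Lie triple system if and only if it is of one of the following types: \begin{itemize} \item $(\mathrm{Geo})$: $\mathfrak m'=\mathbb R v$ for some unit vector $v\in\mathfrak m$. \item $(\mathrm{G1},k)$: $\mathfrak m'$ is a $\mathbb CQ$-subspace of $\mathfrak m$ of complex dimension $k$; here $2\le k\le m-1$. \item $(\mathrm{G2},k_1,k_2)$: there exist $A\in\mathfrak A$ and real linear subspaces $W_1,W_2\subset V(A)$ of real dimension $k_1$ resp. $k_2$ such that $W_1\perp W_2$ and $\mathfrak m'=W_1\oplus JW_2$; here $k_1,k_2\ge 1$ and $k_1+k_2\le m$. \item $(\mathrm{G3})$: there exist $A\in\mathfrak A$ and an orthonormal system $(x,y)$ in $V(A)$ such that $\mathfrak m'=\mathbb C(x-Jy)\oplus\mathbb R(x+Jy)$. \item $(\mathrm{P1},k)$: there exists $A\in\mathfrak A$ such that $\mathfrak m'$ is a $k$-dimensional $\mathbb R$-linear subspace of $V(A)$; here $1\le k\le m$. \item $(\mathrm{P2})$: there exist $A\in\mathfrak A$ and a unit vector $x\in V(A)$ such that $\mathfrak m'=\mathbb C x$. \item $(\mathrm{A})$: there exist $A\in\mathfrak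 A$ and an orthonormal system $(x,y,z)$ in $V(A)$ such that $\mathfrak m'=\mathbb R(2x+Jy)\oplus\mathbb R(y+Jx+\sqrt3\,Jz)$; this type exists only for $m\ge 3$. \item $(\mathrm{I1},k)$: $\mathfrak m'$ is a complex linear isotropic subspace of $\mathfrak m$ of complex dimension $k$; here $1\le k\le \frac m2$. \item $(\mathrm{I2},k)$: $\mathfrak m'$ is a totally real isotropic subspace of $\mathfrak m$ of real dimension $k$; here $1\le k\le\frac m2$. \end{itemize} Moreover, these types have the following properties (real dimension; complex / totally real / neither complex nor totally real; rank; maximality): \begin{itemize} \item $(\mathrm{Geo})$: dimension $1$; totally real; rank $1$; not maximal. \item $(\mathrm{G1},k)$: dimension $2k$; complex; rank $2$; maximal exactly for $k=m-1\ge 2$. \item $(\mathrm{G2},k_1,k_2)$: dimension $k_1+k_2$; totally real; rank $2$; maximal exactly for $k_1+k_2=m\ge 3$. \item $(\mathrm{G3})$: dimension $3$; neither; rank $2$; maximal only for $m=2$. \item $(\mathrm{P1},k)$: dimension $k$; totally real; rank $1$; maximal exactly for $k=m$. \item $(\mathrm{P2})$: dimension $2$; complex; rank $1$; maximal only for $m=2$. \item $(\mathrm{A})$: dimension $2$; neither; rank $1$; maximal only for $m=3$. \item $(\mathrm{I1},k)$: dimension $2k$; complex; rank $1$; maximal exactly for $2k=m\ge 4$. \item $(\mathrm{I2},k)$: dimension $k$; totally real; rank $1$; not maximal. \end{itemize} (Here ''maximal only for $m=m_0$'' means: maximal if $m=m_0$, and not maximal otherwise.)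
   Context: Complex quadric: $Q=Q^m=\{[z_0,\dots,z_{m+1}]\in\mathbb{CP}^{m+1}\mid\sum_k z_k^2=0\}$, $m\ge 2$, with the Riemannian metric $\langle\cdot,\cdot\rangle$ and complex structure $J$ induced from the Fubini-Study metric on $\mathbb{CP}^{m+1}$ for which the Hopf fibration $\pi:S^{2m+3}\to\mathbb{CP}^{m+1}$ from the unit sphere of $\mathbb C^{m+2}$ is a Hermitian submersion (constant holomorphic sectional curvature $4$). On tangent spaces put $\langle v,w\rangle_{\mathbb C}=\langle v,w\rangle+i\langle v,Jw\rangle$. The group $G=\mathrm{SO}(m+2)$ acts (via complexification) transitively and by holomorphic isometries on $Q$; $Q\cong\mathrm{SO}(m+2)/(\mathrm{SO}(2)\times\mathrm{SO}(m))$ is a Hermitian symmetric space of compact type of rank $2$. Fix $p=\pi(z)\in Q$ and let $W=\mathbb C z\oplus\mathbb C\bar z\subset\mathbb C^{m+2}$. With $\mathfrak g=\mathfrak o(m+2)$ the canonical decomposition is $\mathfrak g=\mathfrak k\oplus\mathfrak m$, $\mathfrak k=\{X\in\mathfrak g\mid X(W)\subset W,\ X(W^\perp)\subset W^\perp\}$, $\mathfrak m=\{X\in\mathfrak g\mid X(W)\subset W^\perp,\ X(W^\perp)\subset W\}$. $\mathfrak m$ is identified with $T_pQ$ via $X\mapsto\frac{d}{dt}|_{t=0}\exp(tX)\cdot p$; thereby $\mathfrak m$ carries $\langle\cdot,\cdot\rangle$, $\langle\cdot,\cdot\rangle_{\mathbb C}$, $J$, and the curvature tensor of $Q$ at $p$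 is $R(X,Y)Z=-[[X,Y],Z]$. $\mathbb CQ$-structure: a conjugation on a unitary space $\mathbb V$ is an anti-linear involution, orthogonal with respect to $\langle\cdot,\cdot\rangle=\mathrm{Re}\langle\cdot,\cdot\rangle_{\mathbb C}$. A $\mathbb CQ$-structure on $\mathbb V$ is a circle of conjugations $\mathfrak A=\{\lambda A\mid\lambda\in\mathbb C,|\lambda|=1\}$ with $A$ a conjugation. On $T_pQ$ one uses $\mathfrak A(Q,p)=\{A_\eta\mid\eta\text{ unit normal vector of }Q\subset\mathbb{CP}^{m+1}\text{ at }p\}$, where $A_\eta$ is the shape operator with respect to $\eta$; this is a $\mathbb CQ$-structure. (Concretely, it is the circle generated by the conjugation on $T_pQ$ corresponding under $\pi_*$ to $v\mapsto\bar v$ on the horizontal lift $(\mathbb C z\oplus\mathbb C\bar z)^\perp$ of $T_pQ$ at $z\in\pi^{-1}(\{p\})$.) For a conjugation $A$, $V(A)$ denotes the eigenspace $\mathrm{Eig}(A,1)$. A $\mathbb CQ$-subspace is a complex linear subspace invariant under some (then every) $A\in\mathfrak A$. A vector $v$ is isotropic if $\langle v,Av\rangle_{\mathbb C}=0$ for some (then every) $A\in\mathfrak A$; a real or complex linear subspace is isotropic if all of its vectors are isotropic. A real subspace $U$ is complex if $JU=U$ and totally real if $JU\perp U$ with respect to $\langle\cdot,\cdot\rangle$. A linear subspace $\mathfrak m'\subset\mathfrak m$ is a Lie triple system if $[[\mathfrak m',\mathfrak m'],\mathfrak m']\subset\mathfrak m'$. Its rank $\mathrm{rk}(\mathfrak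 m')$ is the maximal dimension of a linear subspace $\mathfrak a'\subset\mathfrak m'$ with $[\mathfrak a',\mathfrak a']=\{0\}$. A Lie triple system $\mathfrak m'\subsetneq\mathfrak m$ is maximal if there is no Lie triple system $\widehat{\mathfrak m}'$ with $\mathfrak m'\subsetneq\widehat{\mathfrak m}'\subsetneq\mathfrak m$. *)

(* Defs.v *)
From HB Require Import structures.
From mathcomp Require Import all_boot all_order all_algebra.
From mathcomp Require Import complex ring lra.
From mathcomp Require Import all_classical all_reals all_analysis.

Set Implicit Arguments.
Unset Strict Implicit.
Unset Printing Implicit Defensive.

Import Order.TTheory GRing.Theory Num.Theory.
Import numFieldNormedType.Exports.

Local Open Scope ring_scope.
Local Open Scope classical_set_scope.

(* Points and tangent vectors of CP^(n-1) are represented through the Hopf    *)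
(* fibration pi : S^(2n-1) -> CP^(n-1): a point by a unit vector z of C^n, a  *)
(* tangent vector at pi(z) by its horizontal lift at z. Since pi is a         *)
(* Hermitian submersion, the Fubini-Study metric is the real part of the      *)
(* Hermitian product of horizontal lifts.                                     *)

Section ComplexDerivative.
Context {R : realType}.

Definition is_cderive (f : R -> R[i]) (t : R) (d : R[i]) :=
  is_derive t 1 (fun s => complex.Re (f s)) (complex.Re d) /\
  is_derive t 1 (fun s => complex.Im (f s)) (complex.Im d).

Definition is_vderive {n : nat} (f : R -> 'cV[R[i]]_n) (t : R)
    (d : 'cV[R[i]]_n) :=
  forall k, is_cderive (fun s => f s k 0) t (d k 0).

Lemma is_cderive_eq (f g : R -> R[i]) (t : R) (d e : R[i]) :
  is_cderive f t d -> f =1 g -> d = e -> is_cderive g t e.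
Proof. by move=> fd /funext <- <-. Qed.

Lemma is_cderive_unique (f : R -> R[i]) (t : R) (d e : R[i]) :
  is_cderive f t d -> is_cderive f t e -> d = e.
Proof.
case: d e => [a b] [a' b'] [/= h1 h2] [/= h3 h4].
have e1 : a = a' by rewrite -(@derive_val _ _ _ _ _ _ _ h1) (@derive_val _ _ _ _ _ _ _ h3).
have e2 : b = b' by rewrite -(@derive_val _ _ _ _ _ _ _ h2) (@derive_val _ _ _ _ _ _ _ h4).
by rewrite e1 e2.
Qed.

Lemma is_cderive_cst (a : R[i]) (t : R) : is_cderive (fun=> a) t 0.
Proof. by split; exact: is_derive_cst. Qed.

Lemma is_cderive_conj (f : R -> R[i]) (t : R) (d : R[i]) :
  is_cderive f t d -> is_cderive (fun s => conjc (f s)) t (conjc d).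
Proof.
case: d => a b [/= h1 h2]; split => /=.
  apply: (is_derive_eq (f' := a)) => //.
  by rewrite (_ : (fun s => _) = (fun s => complex.Re (f s))) //;
    apply/funext => s; case: (f s).
rewrite (_ : (fun s => _) = - (fun s => complex.Im (f s))); last first.
  by apply/funext => s; rewrite /= fctE; case: (f s).
exact: is_deriveN.
Qed.

Lemma is_cderiveD (f g : R -> R[i]) (t : R) (d e : R[i]) :
  is_cderive f t d -> is_cderive g t e ->
  is_cderive (fun s => f s + g s) t (d + e).
Proof.
move=> [h1 h2] [h3 h4]; split; rewrite raddfD.
  rewrite (_ : (fun s => _) = (fun s => complex.Re (f s)) + (fun s => complex.Re (g s))).
    exact: is_deriveD.
  by apply/funext => s; rewrite /= raddfD.
rewrite (_ : (fun s => _) = (fun s => complex.Im (f s)) + (fun s => complex.Im (g s))).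
  exact: is_deriveD.
by apply/funext => s; rewrite /= raddfD.
Qed.

Lemma is_cderiveM (f g : R -> R[i]) (t : R) (d e : R[i]) :
  is_cderive f t d -> is_cderive g t e ->
  is_cderive (fun s => f s * g s) t (d * g t + f t * e).
Proof.
move=> [h1 h2] [h3 h4]; split.
  rewrite (_ : (fun s => _) =
    (fun s => complex.Re (f s)) * (fun s => complex.Re (g s)) -
    (fun s => complex.Im (f s)) * (fun s => complex.Im (g s))).
    apply: is_derive_eq (is_deriveB (is_deriveM h1 h3) (is_deriveM h2 h4)) _.
    rewrite /GRing.scale /=.
    by case: (f t) (g t) d e {h1 h2 h3 h4} => [? ?] [? ?] [? ?] [? ?] /=; ring.
  by apply/funext => s; rewrite /= !fctE; case: (f s) (g s) => [? ?] [? ?].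
rewrite (_ : (fun s => _) =
  (fun s => complex.Re (f s)) * (fun s => complex.Im (g s)) +
  (fun s => complex.Im (f s)) * (fun s => complex.Re (g s))).
  apply: is_derive_eq (is_deriveD (is_deriveM h1 h4) (is_deriveM h2 h3)) _.
  rewrite /GRing.scale /=.
  by case: (f t) (g t) d e {h1 h2 h3 h4} => [? ?] [? ?] [? ?] [? ?] /=; ring.
by apply/funext => s; rewrite /= !fctE; case: (f s) (g s) => [? ?] [? ?].
Qed.

Lemma is_cderive_real (f : R -> R) (t d : R) :
  is_derive t 1 f d -> is_cderive (fun s => (f s)%:C%C) t d%:C%C.
Proof. by move=> h; split => //; exact: is_derive_cst. Qed.

End ComplexDerivative.

Section Hermitian.
Context {R : realType} {n : nat}.
Local Notation Cn := ('cV[R[i]]_n).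

(* linear in the first argument, antilinear in the second one *)
Definition hdot (v w : Cn) : R[i] := \sum_k v k 0 * conjc (w k 0).

Definition rdot (v w : Cn) : R := complex.Re (hdot v w).

Definition conjv (v : Cn) : Cn := map_mx conjc v.

(* pi^-1(Q), where Q is the complex quadric *)
Definition quadric_lift : set Cn :=
  [set z | hdot z z = 1 /\ \sum_k (z k 0) ^+ 2 = 0].

(* W = C z + C conj(z), and its orthogonal complement; the latter is the set  *)
(* of the horizontal lifts at z of the vectors tangent to Q at pi(z).         *)
Definition Wspace (z : Cn) : set Cn :=
  [set w | exists a b : R[i], w = a *: z + b *: conjv z].

Definition Wperp (z : Cn) : set Cn :=
  [set w | forall u, Wspace z u -> hdot w u = 0].

(* horizontal lifts at z of the vectors tangent to CP^(n-1) at pi(z) and      *)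
(* normal to Q                                                                *)
Definition normal_vector (z : Cn) : set Cn :=
  [set v | hdot v z = 0 /\ forall w, Wperp z w -> rdot v w = 0].

Lemma hdotDl (u v w : Cn) : hdot (u + v) w = hdot u w + hdot v w.
Proof.
by rewrite /hdot -big_split; apply: eq_bigr => k _; rewrite mxE mulrDl.
Qed.

Lemma hdotZl (a : R[i]) (v w : Cn) : hdot (a *: v) w = a * hdot v w.
Proof.
by rewrite /hdot mulr_sumr; apply: eq_bigr => k _; rewrite mxE mulrA.
Qed.

Lemma hdotC (v w : Cn) : hdot w v = conjc (hdot v w).
Proof.
rewrite /hdot rmorph_sum; apply: eq_bigr => k _.
by rewrite rmorphM /= conjcK mulrC.
Qed.

Lemma hdotNl (v w : Cn) : hdot (- v) w = - hdot v w.
Proof. by rewrite -scaleN1r hdotZl mulN1r. Qed.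

Lemma hdotBl (u v w : Cn) : hdot (u - v) w = hdot u w - hdot v w.
Proof. by rewrite hdotDl hdotNl. Qed.

Lemma hdotDr (u v w : Cn) : hdot u (v + w) = hdot u v + hdot u w.
Proof. by rewrite hdotC hdotDl rmorphD /= -!hdotC. Qed.

Lemma hdotZr (a : R[i]) (v w : Cn) : hdot v (a *: w) = conjc a * hdot v w.
Proof. by rewrite hdotC hdotZl rmorphM /= -!hdotC. Qed.

Lemma hdotJ (v w : Cn) : hdot (conjv v) (conjv w) = conjc (hdot v w).
Proof.
by rewrite /hdot rmorph_sum; apply: eq_bigr => k _; rewrite !mxE rmorphM.
Qed.

Lemma conjvK (v : Cn) : conjv (conjv v) = v.
Proof. by apply/colP => k; rewrite !mxE conjcK. Qed.

Lemma hdot_conjvr (v : Cn) : hdot v (conjv v) = \sum_k (v k 0) ^+ 2.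
Proof. by apply: eq_bigr => k _; rewrite mxE conjcK expr2. Qed.

Lemma hdot_ge0 (v : Cn) : 0 <= hdot v v.
Proof. by apply: sumr_ge0 => k _; exact: mulcJ_ge0. Qed.

Lemma hdot_eq0 (v : Cn) : hdot v v = 0 -> v = 0.
Proof.
move=> /eqP; rewrite psumr_eq0; last by move=> k _; exact: mulcJ_ge0.
move=> /allP h; apply/colP => k; rewrite mxE.
have := h k (mem_index_enum k); rewrite implyTb mulf_eq0 conjc_eq0 orbb.
by move=> /eqP.
Qed.

Lemma quadric_lift_perp (z : Cn) : quadric_lift z ->
  [/\ hdot z z = 1, hdot z (conjv z) = 0, hdot (conjv z) z = 0 &
      hdot (conjv z) (conjv z) = 1].
Proof.
move=> [h1 h2]; have h3 : hdot z (conjv z) = 0 by rewrite hdot_conjvr.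
by split; rewrite ?hdotJ ?h1 ?rmorph1 // hdotC h3 rmorph0.
Qed.

Lemma WperpP (z w : Cn) :
  Wperp z w <-> hdot w z = 0 /\ hdot w (conjv z) = 0.
Proof.
split=> [h|[h1 h2] u [a [b ->]]].
  by split; apply: h; [exists 1, 0|exists 0, 1];
    rewrite scale1r scale0r ?addr0 ?add0r.
by rewrite hdotDr !hdotZr h1 h2 !mulr0 addr0.
Qed.

Lemma WperpN (z w : Cn) : Wperp z w -> Wperp z (- w).
Proof. by move=> /WperpP[h1 h2]; apply/WperpP; rewrite !hdotNl h1 h2 oppr0. Qed.

Lemma WperpD (z u w : Cn) : Wperp z u -> Wperp z w -> Wperp z (u + w).
Proof.
by move=> /WperpP[h1 h2] /WperpP[h3 h4]; apply/WperpP;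
  rewrite !hdotDl h1 h2 h3 h4 addr0.
Qed.

Lemma WperpZ (a : R[i]) (z w : Cn) : Wperp z w -> Wperp z (a *: w).
Proof. by move=> /WperpP[h1 h2]; apply/WperpP; rewrite !hdotZl h1 h2 mulr0. Qed.

Lemma Wperp_conjv (z w : Cn) : Wperp z w -> Wperp z (conjv w).
Proof.
move=> /WperpP[h1 h2]; apply/WperpP; split.
  by rewrite -[z]conjvK hdotJ h2 rmorph0.
by rewrite hdotJ h1 rmorph0.
Qed.

Lemma Wspace_perp (z w : Cn) : Wspace z w -> Wperp z w -> w = 0.
Proof. by move=> h1 h2; apply: hdot_eq0; exact: h2. Qed.

Lemma Wperp_proj (z w : Cn) : quadric_lift z ->
  Wperp z (w - (hdot w z *: z + hdot w (conjv z) *: conjv z)).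
Proof.
move=> /quadric_lift_perp[h1 h2 h3 h4]; apply/WperpP; split.
  by rewrite hdotBl hdotDl !hdotZl h1 h3 mulr1 mulr0 addr0 subrr.
by rewrite hdotBl hdotDl !hdotZl h2 h4 mulr1 mulr0 add0r subrr.
Qed.

Lemma normal_vectorP (z v : Cn) : quadric_lift z ->
  normal_vector z v <-> exists l, v = l *: conjv z.
Proof.
move=> hz; have [h1 h2 h3 h4] := quadric_lift_perp hz; split=> [[hv hn]|[l ->]].
  exists (hdot v (conjv z)); have := Wperp_proj v hz.
  rewrite hv scale0r add0r; set u := v - _ => hu.
  have hzu : hdot (conjv z) u = 0.
    by have /WperpP[_ e] := hu; rewrite hdotC e rmorph0.
  have e : hdot v u = hdot u u.
    by rewrite {2}/u hdotBl hdotZl hzu mulr0 subr0.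
  apply/eqP; rewrite -subr_eq0; apply/eqP/hdot_eq0; rewrite -/u.
  have := hn _ hu; rewrite /rdot e => hr.
  by have /ger0_Im := hdot_ge0 u; case: (hdot u u) hr => a b /= -> ->.
split; first by rewrite hdotZl h3 mulr0.
move=> w /WperpP[_ e]; rewrite /rdot hdotZl.
by rewrite [hdot (conjv z) w]hdotC e rmorph0 mulr0.
Qed.

(* normalizes the curve t |-> z + t v - (t^2 / 2) (\sum_k v_k^2) conj(z) of    *)
(* null vectors of the bilinear form                                          *)
Lemma quadric_curve (z v : Cn) : quadric_lift z -> Wperp z v ->
  exists c : R -> Cn, [/\ forall t, quadric_lift (c t), c 0 = z & is_vderive c 0 v].
Proof.
move=> hz hv; have [h1 h2 h3 h4] := quadric_lift_perp hz.
have [v1 v2] := (WperpP z v).1 hv.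
have v1' : hdot z v = 0 by rewrite hdotC v1 rmorph0.
have v2' : hdot (conjv z) v = 0 by rewrite hdotC v2 rmorph0.
have [b hb] : exists b : R[i], \sum_k (v k 0) ^+ 2 = b *+ 2.
  exists ((\sum_k (v k 0) ^+ 2) / 2).
  by rewrite -[RHS]mulr_natr divfK // pnatr_eq0.
pose s (t : R) : R[i] := - ((t ^+ 2)%:C%C * b).
pose c0 (t : R) : Cn := z + ((t%:C)%C *: v + s t *: conjv z).
have [av hav av0] : exists2 av : R, hdot v v = (av%:C)%C & 0 <= av.
  have := hdot_ge0 v; case: (hdot v v) => x y; rewrite lecE /= => /andP[/eqP -> hx].
  by exists x.
have [ab hab ab0] : exists2 ab : R, b * conjc b = (ab%:C)%C & 0 <= ab.
  have := mulcJ_ge0 b; case: (b * _) => x y; rewrite lecE /= => /andP[/eqP -> hx].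
  by exists x.
pose q (t : R) : R := 1 + (t ^+ 2 * av + t ^+ 4 * ab).
have q0 t : 0 < q t.
  by rewrite /q ltr_pwDl // addr_ge0 // mulr_ge0 //; exact: exprn_even_ge0.
have hs t : conjc (s t) = - ((t ^+ 2)%:C%C * conjc b).
  by rewrite /s rmorphN rmorphM /= oppr0.
have hq t : hdot (c0 t) (c0 t) = (q t)%:C%C.
  rewrite /c0 !hdotDl !hdotDr !hdotZl !hdotZr h1 h2 h3 h4 v1 v2 v1' v2' hav.
  rewrite conjc_real hs /s /q.
  rewrite !rmorphD rmorph1 (rmorphM _ (t ^+ 2)) (rmorphM _ (t ^+ 4)) /= -hab.
  by ring.
have hnull t : \sum_k (c0 t k 0) ^+ 2 = 0.
  rewrite -hdot_conjvr.
  have -> : conjv (c0 t) = conjv z + ((t%:C)%C *: conjv v + conjc (s t) *: z).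
    by apply/colP => k; rewrite !mxE !rmorphD !rmorphM /= conjcK oppr0.
  have hvc : hdot v (conjv v) = b *+ 2.
    by rewrite hdot_conjvr.
  have w1 : hdot z (conjv v) = 0.
    by rewrite -[z]conjvK hdotJ v2' rmorph0.
  have w2 : hdot (conjv z) (conjv v) = 0 by rewrite hdotJ v1' rmorph0.
  rewrite /c0 !hdotDl !hdotDr !hdotZl !hdotZr h1 h2 h3 h4 v1 v2 hvc w1 w2.
  rewrite conjcK conjc_real /s rmorphXn /=.
  by ring.
pose r (t : R) : R := (Num.sqrt (q t))^-1.
exists (fun t => (r t)%:C%C *: c0 t); split.
- move=> t; split.
    rewrite hdotZl hdotZr conjc_real hq -!rmorphM /= /r.
    rewrite mulrA -invfM -expr2 sqr_sqrtr ?(ltW (q0 _)) // mulVf ?gt_eqF //.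
  under eq_bigr => k _ do rewrite mxE exprMn.
  by rewrite -mulr_sumr hnull mulr0.
- rewrite /r /c0 /s /q !expr0n /= !mul0r oppr0 !addr0 sqrtr1 invr1.
  by rewrite !scale0r !addr0 scale1r.
have dq : is_derive (0 : R) 1 q 0.
  rewrite (_ : q = cst 1 + ((av \*: ((@id R) ^+ 2)) + (ab \*: ((@id R) ^+ 4)))).
    have h := is_deriveD (is_derive_cst (1 : R) (0 : R) 1)
      (is_deriveD (is_deriveZ av (is_deriveX 2 (is_derive_id (0 : R) 1)))
                  (is_deriveZ ab (is_deriveX 4 (is_derive_id (0 : R) 1)))).
    by move: h; rewrite !expr0n /= !mulr0 !scale0r !scaler0 !addr0.
  apply/funext => t; rewrite /q !fctE /= -![_ *: _]/(_ * _); ring.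
have q1 : q 0 = 1 by rewrite /q !expr0n /= !mul0r !addr0.
have dr : is_derive (0 : R) 1 r 0.
  have ds : is_derive (q 0) 1 (@Num.sqrt R) (2 * Num.sqrt (q 0))^-1.
    exact: is_derive1_sqrt.
  have dsq : is_derive (0 : R) 1 (@Num.sqrt R \o q) 0.
    by have := is_derive1_comp ds dq; rewrite mulr0.
  have nz : (@Num.sqrt R \o q) 0 != 0 by rewrite /= q1 sqrtr1 oner_neq0.
  by have := is_deriveV nz dsq; rewrite scaler0.
have dt : is_cderive (fun t : R => (t%:C)%C) 0 1.
  by apply: is_cderive_real; exact: is_derive_id.
have dt2 : is_cderive (fun t : R => ((t ^+ 2)%:C)%C) 0 0.
  apply: is_cderive_eq (is_cderiveM dt dt) _ _.
    by move=> t; rewrite rmorphXn expr2.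
  by rewrite mulr0 mul0r addr0.
move=> k.
have dc0 : is_cderive (fun t => c0 t k 0) 0 (v k 0).
  apply: is_cderive_eq (is_cderiveD (is_cderive_cst (z k 0) 0)
    (is_cderiveD (is_cderiveM dt (is_cderive_cst (v k 0) 0))
       (is_cderiveM dt2 (is_cderive_cst (- (b * conjv z k 0)) 0)))) _ _.
    by move=> t; rewrite /c0 /s !mxE; ring.
  by rewrite !mulr0 !mul0r !addr0 add0r mul1r.
apply: is_cderive_eq (is_cderiveM (is_cderive_real dr) dc0) _ _.
  by move=> t; rewrite [RHS]mxE.
by rewrite mul0r add0r /r q1 sqrtr1 invr1 mul1r.
Qed.

End Hermitian.

Section Quadric.
Context {R : realType} {n : nat}.
Local Notation Cn := ('cV[R[i]]_n).
Local Notation M := ('M[R]_n).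

Definition act (X : M) (v : Cn) : Cn := map_mx (real_complex R) X *m v.

Definition lie (X Y : M) : M := X *m Y - Y *m X.

(* the space m of the canonical decomposition of o(n) = k + m *)
Definition mspace (z : Cn) : set M :=
  [set X | [/\ X^T = - X,
               forall w, Wspace z w -> Wperp z (act X w) &
               forall w, Wperp z w -> Wspace z (act X w)]].

(* The tangent vector d/dt exp(tX).pi(z) at t = 0: the curve exp(tX) z has    *)
(* velocity X z, which is horizontal for X in m.                              *)
Definition to_tangent (z : Cn) (X : M) : Cn := act X z.

(* The inverse isomorphism (see to_tangentK and of_tangentK below): this is   *)
(* the real matrix v z^* - z v^* + conj (v z^* - z v^* ).                     *)
Definition of_tangent (z v : Cn) : M :=
  \matrix_(i, j) (complex.Re (v i 0 * conjc (z j 0) - z i 0 * conjc (v j 0)) *+ 2).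

Lemma act_of_tangent (z v w : Cn) : act (of_tangent z v) w =
  (hdot w z *: v - hdot w v *: z) +
  (hdot w (conjv z) *: conjv v - hdot w (conjv v) *: conjv z).
Proof.
apply/colP => k; rewrite !mxE /hdot !mulr_suml -!sumrB -big_split /=.
apply: eq_bigr => j _; rewrite !mxE rmorphMn /= -mulr_natl.
rewrite -(addcJ (_ - _)) rmorphB !rmorphM /= !conjcK.
by ring.
Qed.

Lemma actDl (X Y : M) (w : Cn) : act (X + Y) w = act X w + act Y w.
Proof. by rewrite /act map_mxD mulmxDl. Qed.

Lemma actNl (X : M) (w : Cn) : act (- X) w = - act X w.
Proof. by rewrite /act map_mxN mulNmx. Qed.

Lemma act_conjv (X : M) (w : Cn) : act X (conjv w) = conjv (act X w).
Proof.
apply/colP => k; rewrite !mxE rmorph_sum; apply: eq_bigr => j _.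
by rewrite !mxE rmorphM /= oppr0.
Qed.

Lemma hdot_act (X : M) (v w : Cn) : X^T = - X ->
  hdot (act X v) w = - hdot v (act X w).
Proof.
move=> hX; rewrite /hdot.
under eq_bigr => k _ do rewrite mxE mulr_suml.
under [in RHS]eq_bigr => k _ do rewrite mxE rmorph_sum mulr_sumr.
rewrite exchange_big -sumrN; apply: eq_bigr => j _ /=.
rewrite -sumrN; apply: eq_bigr => k _; rewrite !mxE rmorphM /= oppr0.
have -> : X k j = - X j k by move: hX => /matrixP/(_ j k); rewrite !mxE.
have -> : (- X j k)%:C%C = - (X j k)%:C%C by rewrite rmorphN.
by rewrite -[(_ +i* 0)%C]/((X j k)%:C)%C; ring.
Qed.

Lemma mspace_of_tangent (z v : Cn) : quadric_lift z -> Wperp z v ->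
  mspace z (of_tangent z v).
Proof.
move=> hz hv; have [h1 h2 h3 h4] := quadric_lift_perp hz.
have hv' := Wperp_conjv hv; have [/WperpP[v1 v2] /WperpP[v3 v4]] := (hv, hv').
split.
- apply/matrixP => i j; rewrite !mxE -mulNrn; congr (_ *+ 2).
  rewrite -raddfN /= opprB.
  by case: (v i 0) (v j 0) (z i 0) (z j 0) => [a1 b1] [a2 b2] [a3 b3] [a4 b4] /=; ring.
- move=> w [a [b ->]]; rewrite act_of_tangent.
  have e1 : hdot (a *: z + b *: conjv z) v = 0.
    by rewrite hdotC (hv _ _) ?rmorph0 //; exists a, b.
  have e2 : hdot (a *: z + b *: conjv z) (conjv v) = 0.
    by rewrite hdotC (hv' _ _) ?rmorph0 //; exists a, b.
  by rewrite e1 e2 !scale0r !subr0; apply: WperpD; exact: WperpZ.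
- move=> w /WperpP[w1 w2]; rewrite act_of_tangent w1 w2 !scale0r !add0r.
  by exists (- hdot w v), (- hdot w (conjv v)); rewrite !scaleNr.
Qed.

Lemma of_tangentK (z v : Cn) : quadric_lift z -> Wperp z v ->
  to_tangent z (of_tangent z v) = v.
Proof.
move=> hz hv; have [h1 h2 h3 h4] := quadric_lift_perp hz.
have hv' := Wperp_conjv hv; have [/WperpP[v1 v2] /WperpP[v3 v4]] := (hv, hv').
rewrite /to_tangent act_of_tangent h1 h2 (hdotC v z) v1 (hdotC (conjv v) z) v3.
by rewrite rmorph0 !scale0r scale1r !subr0 addr0.
Qed.

Lemma Wperp_to_tangent (z : Cn) (X : M) : mspace z X ->
  Wperp z (to_tangent z X).
Proof. by case=> _ h _; apply: h; exists 1, 0; rewrite scale1r scale0r addr0. Qed.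

Lemma to_tangentK (z : Cn) (X : M) : quadric_lift z -> mspace z X ->
  of_tangent z (to_tangent z X) = X.
Proof.
move=> hz hX; have hv := Wperp_to_tangent hX; set v := to_tangent z X in hv *.
have [sY Y1 Y2] := mspace_of_tangent hz hv; case: (hX) => sX X1 X2.
have hzD : act (of_tangent z v) z = act X z by exact: of_tangentK.
set Y := of_tangent z v in sY Y1 Y2 hzD *.
apply/eqP; rewrite -subr_eq0; apply/eqP; set D := Y - X.
have sD : D^T = - D by rewrite /D linearB /= sY sX opprB opprK addrC.
have D0 u : Wspace z u -> act D u = 0.
  move=> [a [b ->]].
  have Dz : act D z = 0 by rewrite actDl actNl hzD subrr.
  rewrite /act mulmxDr -!scalemxAr -!/(act D _) act_conjv Dz.
  have -> : conjv (0 : Cn) = 0 by apply/colP => k; rewrite !mxE rmorph0.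
  by rewrite !scaler0 addr0.
have D1 w : Wperp z w -> act D w = 0.
  move=> hw; apply: hdot_eq0; rewrite hdot_act // D0.
    by rewrite hdotC -(scale0r (0 : Cn)) hdotZl mul0r rmorph0 oppr0.
  have [a [b e1]] := Y2 _ hw; have [a' [b' e2]] := X2 _ hw.
  exists (a - a'), (b - b'); rewrite actDl actNl e1 e2 !scalerBl.
  by rewrite opprD addrACA.
have Dw w : act D w = 0.
  have -> : w = (w - (hdot w z *: z + hdot w (conjv z) *: conjv z)) +
                (hdot w z *: z + hdot w (conjv z) *: conjv z) by rewrite subrK.
  rewrite {1}/act mulmxDr -!/(act D _) D1; last exact: Wperp_proj.
  by rewrite D0 ?addr0 //; exists (hdot w z), (hdot w (conjv z)).
apply/matrixP => i j; have /colP/(_ i) := Dw (delta_mx j 0).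
rewrite mxE (bigD1 j) //= big1 ?addr0; last first.
  by move=> k kj; rewrite !mxE (negbTE kj) mulr0.
by rewrite !mxE !eqxx mulr1 => /(congr1 (@complex.Re R)) /= ->.
Qed.

Definition inner (z : Cn) (X Y : M) : R :=
  rdot (to_tangent z X) (to_tangent z Y).

(* On matrices outside of m the value of this operator is irrelevant. *)
Definition Jfun (z : Cn) (X : M) : M := of_tangent z ('i%C *: to_tangent z X).
Definition J (z : Cn) : 'End(M) := linfun (Jfun z).

Lemma Jfun_is_linear (z : Cn) : linear (Jfun z).
Proof.
move=> a X Y; rewrite /Jfun /to_tangent actDl scalerDr.
have -> : act (a *: X) z = a%:C%C *: act X z.
  by rewrite /act map_mxZ scalemxAl.
move: (act X z) (act Y z) => u v; apply/matrixP => i j; rewrite !mxE.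
move: (u i 0) (u j 0) (v i 0) (v j 0) (z i 0) (z j 0).
by move=> [? ?] [? ?] [? ?] [? ?] [? ?] [? ?] /=; ring.
Qed.
HB.instance Definition _ (z : Cn) :=
  GRing.isLinear.Build R M M *:%R (Jfun z) (Jfun_is_linear z).

Lemma JE (z : Cn) (X : M) : J z X = of_tangent z ('i%C *: to_tangent z X).
Proof. exact: lfunE. Qed.

Lemma to_tangent_J (z : Cn) (X : M) : quadric_lift z -> mspace z X ->
  to_tangent z (J z X) = 'i%C *: to_tangent z X.
Proof.
move=> hz hX; rewrite JE of_tangentK //; apply: WperpZ.
exact: Wperp_to_tangent.
Qed.

Definition cinner (z : Cn) (X Y : M) : R[i] :=
  (inner z X Y +i* inner z X (J z Y))%C.

(* A is the shape operator of Q at pi(z) with respect to the normal vector    *)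
(* eta: A v is minus the component tangent to Q of the covariant derivative   *)
(* of a normal field nu extending eta along a curve c of Q with velocity v.   *)
(* As the projection pi is a Riemannian submersion, the covariant derivative  *)
(* lifts to the horizontal part of the ordinary derivative of nu.             *)
(* Operators on m are represented by functions on all matrices, whose values  *)
(* outside of m are unconstrained.                                            *)
Definition is_shape_operator (z eta : Cn) (A : M -> M) :=
  forall X, mspace z X -> mspace z (A X) /\
  forall (c nu : R -> Cn) (d : Cn),
    (forall t, quadric_lift (c t)) -> (forall t, normal_vector (c t) (nu t)) ->
    c 0 = z -> is_vderive c 0 (to_tangent z X) ->
    nu 0 = eta -> is_vderive nu 0 d ->
    forall w, Wperp z w -> rdot (to_tangent z (A X) + d) w = 0.

(* the CQ-structure A(Q, p), p = pi(z) *)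
Definition CQ_structure (z : Cn) : set (M -> M) :=
  [set A | exists eta, [/\ normal_vector z eta, hdot eta eta = 1 &
                           is_shape_operator z eta A]].

(* In terms of horizontal lifts, A(Q, p) is the circle through conjv. *)
Lemma CQ_structureP (z : Cn) (A : M -> M) : quadric_lift z ->
  CQ_structure z A <-> exists2 l : R[i], `|l| = 1 &
    forall X, mspace z X -> A X = of_tangent z (l *: conjv (to_tangent z X)).
Proof.
move=> hz; have [h1 h2 h3 h4] := quadric_lift_perp hz.
have norm1 (l : R[i]) : hdot (l *: conjv z) (l *: conjv z) = 1 <-> `|l| = 1.
  rewrite hdotZl hdotZr h4 mulr1 -sqr_normc; split=> [/eqP|->]; last first.
    by rewrite expr1n.
  by rewrite sqrf_eq1 => /orP[/eqP//|/eqP e]; have := normr_ge0 l;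
    rewrite e oppr_ge0 ler10.
split=> [[eta [/(normal_vectorP _ hz)[l ->] /norm1 hl hA]]|[l hl hA]].
  exists (- l) => [|X hX]; first by rewrite normrN.
  have hv := Wperp_to_tangent hX; have [hAX hAc] := hA X hX.
  have [c [c1 c2 c3]] := quadric_curve hz hv.
  have hAv := Wperp_to_tangent hAX.
  have hd : is_vderive (fun t => l *: conjv (c t)) 0
      (l *: conjv (to_tangent z X)).
    move=> k; apply: is_cderive_eq (is_cderiveM (is_cderive_cst l 0)
      (is_cderive_conj (c3 k))) _ _.
      by move=> t; rewrite !mxE.
    by rewrite mul0r add0r !mxE.
  have hn t : normal_vector (c t) (l *: conjv (c t)).
    by apply/normal_vectorP => //; exists l.
  have hw : Wperp z (to_tangent z (A X) + l *: conjv (to_tangent z X)).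
    by apply: WperpD => //; apply: WperpZ; exact: Wperp_conjv.
  have := hAc c _ _ c1 hn c2 c3 _ hd _ hw; rewrite c2 => /(_ erefl) hr.
  rewrite -[LHS](to_tangentK hz hAX) scaleNr; congr of_tangent.
  apply/eqP; rewrite -addr_eq0; apply/eqP/hdot_eq0.
  move: hr (hdot_ge0 (to_tangent z (A X) + l *: conjv (to_tangent z X))).
  by rewrite /rdot => hr /ger0_Im; case: (hdot _ _) hr => a b /= -> ->.
exists (- l *: conjv z); split.
- by apply/normal_vectorP => //; exists (- l).
- by apply/norm1; rewrite normrN.
move=> X hX; rewrite (hA _ hX); set v := to_tangent z X.
have hv : Wperp z v by exact: Wperp_to_tangent.
have hlv : Wperp z (l *: conjv v) by apply: WperpZ; exact: Wperp_conjv.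
split=> [|c nu d c1 n1 c2 c3 n2 n3 w hw]; first exact: mspace_of_tangent.
rewrite of_tangentK //.
have key j k : (l *: conjv v + d) k 0 * conjc (z j 0) =
               (l *: conjv v + d) j 0 * conjc (z k 0).
  have L := is_cderiveM (n3 k) (is_cderive_conj (c3 j)).
  have L' := is_cderiveM (n3 j) (is_cderive_conj (c3 k)).
  have e t : nu t k 0 * conjc (c t j 0) = nu t j 0 * conjc (c t k 0).
    have [mu ->] := (normal_vectorP _ (c1 t)).1 (n1 t).
    by rewrite !mxE; ring.
  have := is_cderive_unique (is_cderive_eq L e erefl) L'.
  rewrite n2 c2 -/v !mxE => E.
  apply/eqP; rewrite -subr_eq0; move/eqP: E; rewrite -subr_eq0.
  by congr (_ == _); ring.
set e := l *: conjv v + d in key *.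
have -> : e = hdot e (conjv z) *: conjv z.
  apply/colP => k; rewrite [RHS]mxE [conjv z k 0]mxE -[LHS]mulr1 -h1 /hdot.
  rewrite mulr_sumr mulr_suml; apply: eq_bigr => j _.
  by rewrite [conjv z j 0]mxE conjcK mulrCA mulrC key mulrAC.
have [_ e2] := (WperpP z w).1 hw.
by rewrite /rdot hdotZl [hdot (conjv z) w]hdotC e2 rmorph0 mulr0.
Qed.

(* V(A) = Eig(A, 1) *)
Definition Vspace (z : Cn) (A : M -> M) : set M :=
  [set X | mspace z X /\ A X = X].

Definition orthonormal (z : Cn) (s : seq M) :=
  forall i j, (i < size s)%N -> (j < size s)%N ->
    inner z s`_i s`_j = (i == j)%:R.

Definition isotropic_vector (z : Cn) (X : M) :=
  exists2 A, CQ_structure z A & cinner z X (A X) = 0.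

Definition isotropic (z : Cn) (U : {vspace M}) :=
  forall X, X \in U -> isotropic_vector z X.

Definition complex_subspace (z : Cn) (U : {vspace M}) := (J z @: U)%VS = U.

Definition totally_real (z : Cn) (U : {vspace M}) :=
  forall X Y, X \in U -> Y \in U -> inner z (J z X) Y = 0.

Definition cscale (z : Cn) (a : R[i]) (X : M) : M :=
  complex.Re a *: X + complex.Im a *: J z X.

(* U is the complex subspace with complex basis b *)
Definition complex_basis (z : Cn) (U : {vspace M}) (k : nat) (b : 'I_k -> M) :=
  (forall X, X \in U <-> exists a : 'I_k -> R[i], X = \sum_j cscale z (a j) (b j)) /\
  (forall a : 'I_k -> R[i], \sum_j cscale z (a j) (b j) = 0 -> forall j, a j = 0).

Definition has_cdim (z : Cn) (U : {vspace M}) (k : nat) :=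
  exists b : 'I_k -> M, complex_basis z U b.

Definition CQ_subspace (z : Cn) (U : {vspace M}) :=
  [/\ [set` U] `<=` mspace z, complex_subspace z U &
      exists2 A, CQ_structure z A & forall X, X \in U -> A X \in U].

Definition Lie_triple_system (z : Cn) (U : {vspace M}) :=
  [set` U] `<=` mspace z /\
  forall X Y Z, X \in U -> Y \in U -> Z \in U -> lie (lie X Y) Z \in U.

Definition has_rank (U : {vspace M}) (r : nat) :=
  let flat (a : {vspace M}) :=
    (a <= U)%VS /\ forall X Y, X \in a -> Y \in a -> lie X Y = 0 in
  (exists2 a, flat a & \dim a = r) /\ (forall a, flat a -> (\dim a <= r)%N).

Definition maximal_LTS (z : Cn) (U : {vspace M}) :=
  [/\ Lie_triple_system z U, [set` U] `<` mspace z &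
      ~ exists V, [/\ Lie_triple_system z V, [set` U] `<` [set` V] &
                      [set` V] `<` mspace z]].

Definition direct_sum (U V V' : {vspace M}) :=
  U = (V + V')%VS /\ (V :&: V' = 0)%VS.

(* C v *)
Definition cline (z : Cn) (v : M) : {vspace M} := (<[v]> + <[J z v]>)%VS.

End Quadric.

(* m is the complex dimension of Q *)
Section Types.
Context {R : realType} {m : nat} (z : 'cV[R[i]]_m.+2).
Local Notation M := ('M[R]_m.+2).

Definition type_Geo (U : {vspace M}) :=
  exists v, [/\ mspace z v, inner z v v = 1 & U = <[v]>%VS].

Definition type_G1 (k : nat) (U : {vspace M}) :=
  [/\ (2 <= k <= m - 1)%N, CQ_subspace z U & has_cdim z U k].

Definition type_G2 (k1 k2 : nat) (U : {vspace M}) :=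
  [/\ (1 <= k1)%N, (1 <= k2)%N, (k1 + k2 <= m)%N &
  exists (A : M -> M) (W1 W2 : {vspace M}),
    [/\ CQ_structure z A,
        [set` W1] `<=` Vspace z A /\ [set` W2] `<=` Vspace z A,
        \dim W1 = k1 /\ \dim W2 = k2,
        forall X Y, X \in W1 -> Y \in W2 -> inner z X Y = 0 &
        direct_sum U W1 (J z @: W2)%VS]].

Definition type_G3 (U : {vspace M}) :=
  exists (A : M -> M) (x y : M),
    [/\ CQ_structure z A, Vspace z A x, Vspace z A y,
        orthonormal z [:: x; y] &
        direct_sum U (cline z (x - J z y)) <[x + J z y]>%VS].

Definition type_P1 (k : nat) (U : {vspace M}) :=
  (1 <= k <= m)%N /\
  exists A, [/\ CQ_structure z A, [set` U] `<=` Vspace z A & \dim U = k].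

Definition type_P2 (U : {vspace M}) :=
  exists (A : M -> M) (x : M),
    [/\ CQ_structure z A, Vspace z A x, inner z x x = 1 & U = cline z x].

(* (x, y, t) is the orthonormal system, z being the base point *)
Definition type_A (U : {vspace M}) :=
  exists (A : M -> M) (x y t : M),
    [/\ CQ_structure z A,
        [/\ Vspace z A x, Vspace z A y & Vspace z A t],
        orthonormal z [:: x; y; t] &
        direct_sum U <[2 *: x + J z y]>%VS
                     <[y + J z x + Num.sqrt 3 *: J z t]>%VS].

Definition type_I1 (k : nat) (U : {vspace M}) :=
  [/\ (1 <= k)%N, (2 * k <= m)%N, [set` U] `<=` mspace z &
      [/\ complex_subspace z U, isotropic z U & has_cdim z U k]].

Definition type_I2 (k : nat) (U : {vspace M}) :=
  [/\ (1 <= k)%N, (2 * k <= m)%N, [set` U] `<=` mspace z &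
      [/\ totally_real z U, isotropic z U & \dim U = k]].

End Types.

(* Main.v *)
Require Import Defs.
From HB Require Import structures.
From mathcomp Require Import all_boot all_order all_algebra.
From mathcomp Require Import complex ring lra zify.
From mathcomp Require Import all_classical all_reals all_analysis.

(** The horizontal lift at z identifies the space m with the complement of
    C z + C conj(z), hence, after the choice of a real orthonormal basis, with
    C^m and its standard conjugation. A tangent vector becomes a pair
    u = (a, b) of real vectors that stands for a + i b, and [[X, Y], Z]
    becomes twice the explicit trilinear [bracket]. A member of the CQ-structure
    corresponds to a phase, and choosing the phase well turns V(A) into the set
    of the pairs (a, 0). The statement is thus about real subspaces U of
    R^m x R^m that are closed under the bracket, taken up to phases.

    If all vectors of U are isotropic, the bracket reduces to its Hermitian part
    and a single pair u, v with omega u v <> 0 forces J U = U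
    ([isotropic_lts_dichotomy]); these are the types I1 and I2. Otherwise a phase
    takes some vector of U to v = (a x, b y) with x, y orthonormal and
    a > b >= 0 ([rotate_axes]). The operator w |-> bracket v w v preserves U; it
    vanishes on the flat spanned by (x, 0) and (0, y) and has the eigenvectors
    (y, -x), (y, x), (c, 0), (0, d), where c and d are orthogonal to x and y,
    with the eigenvalues (a + b)^2, (a - b)^2, a^2, b^2.

    If U contains a flat, the operators of (x, 0) and (0, y) project U to its
    joint eigenspaces. The types G2, G3 and G1 occur according to whether U
    contains none, one or both of the vectors (y, x) and (y, -x)
    ([classify_rank2]).

    If U contains no flat and w in U is an eigenvector, then bracket v w w lies
    in the plane of (x, 0) and (0, y), in the direction dual to the root of w,
    and it must be a multiple of v. For b > 0 this excludes every pure root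
    vector, so that U is the line of v, unless two eigenvalues coincide. They do
    so exactly for a = 2 b, where (a - b)^2 = b^2; then U may contain a mixture
    of (y, x) and (0, d), and the same condition fixes |d|^2 = 3. This is type A
    ([classify_generic_vector]). For b = 0 only P1 and P2 remain
    ([classify_real_vector]).

    A commuting family has dimension at most two ([flat_le2]), and at most one
    when it is isotropic or contained in a type P1, P2 or A ([flat_iso], [flat_real],
    [flat_P2], [flat_A]); this gives the ranks.
    A type that is not maximal is enlarged by an explicit bracket-closed
    subspace. The maximal ones are handled by [coarse_classification]: apart
    from type G3 in dimension m = 2, a proper bracket-closed subspace lies in
    some W x W with W a proper subspace of R^m, or is totally real or isotropic
    and so of dimension at most m, or has dimension at most two. *)

Set Implicit Arguments.
Unset Strict Implicit.
Unset Printing Implicit Defensive.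

Import Order.TTheory GRing.Theory Num.Theory.

Local Open Scope ring_scope.

Ltac vring := apply/rowP => ?; rewrite !mxE; ring.

(** * Pairs of real vectors *)

Section Model.
Context {R : rcfType} {m : nat}.
Local Notation E := ('rV[R]_m).
Local Notation V := (E * E)%type.
Implicit Types (a b c d e f p q x y t : E) (u v w : V).

Definition dot a b : R := \sum_i a 0 i * b 0 i.

Lemma dotC a b : dot a b = dot b a.
Proof. by apply: eq_bigr => i _; rewrite mulrC. Qed.
Lemma dotDl a b c : dot (a + b) c = dot a c + dot b c.
Proof. by rewrite -big_split; apply: eq_bigr => i _; rewrite mxE mulrDl. Qed.
Lemma dotZl k a c : dot (k *: a) c = k * dot a c.
Proof. by rewrite mulr_sumr; apply: eq_bigr => i _; rewrite mxE mulrA. Qed.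
Lemma dotDr a b c : dot a (b + c) = dot a b + dot a c.
Proof. by rewrite dotC dotDl !(dotC a). Qed.
Lemma dotZr k a c : dot a (k *: c) = k * dot a c.
Proof. by rewrite dotC dotZl (dotC a). Qed.
Lemma dotNl a c : dot (- a) c = - dot a c.
Proof. by rewrite -scaleN1r dotZl mulN1r. Qed.
Lemma dotNr a c : dot a (- c) = - dot a c.
Proof. by rewrite dotC dotNl dotC. Qed.
Lemma dot0l c : dot 0 c = 0.
Proof. by rewrite -(scale0r 0) dotZl mul0r. Qed.
Lemma dot0r c : dot c 0 = 0.
Proof. by rewrite dotC dot0l. Qed.
Definition dotE := (dotDl, dotDr, dotZl, dotZr, dotNl, dotNr, dot0l, dot0r).

Lemma dot_ge0 a : 0 <= dot a a.
Proof. by apply: sumr_ge0 => i _; rewrite -expr2 sqr_ge0. Qed.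
Lemma dot_eq0 a : (dot a a == 0) = (a == 0).
Proof.
apply/eqP/eqP => [/eqP|->]; last by rewrite dot0l.
rewrite psumr_eq0 => [/allP h|i _]; last by rewrite -expr2 sqr_ge0.
apply/rowP => i; rewrite mxE.
by have := h i (mem_index_enum i); rewrite implyTb mulf_eq0 orbb => /eqP.
Qed.
Lemma dot_gt0 a : a != 0 -> 0 < dot a a.
Proof. by move=> a0; rewrite lt_def dot_eq0 a0 dot_ge0. Qed.

Lemma normalize_vector a : a != 0 ->
  exists k x, [/\ 0 < k, dot x x = 1 & a = k *: x].
Proof.
move=> a0; pose k := Num.sqrt (dot a a).
have k0 : 0 < k by rewrite sqrtr_gt0 dot_gt0.
exists k, (k^-1 *: a); split=> //; last by rewrite scalerA mulfV ?scale1r ?gt_eqF.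
rewrite !dotE mulrA -invfM -expr2 sqr_sqrtr ?dot_ge0 // mulVf //.
by rewrite dot_eq0.
Qed.

(** Multiplication of a + i b by i. *)
Definition Jpair u : V := (- u.2, u.1).
(** The Kaehler form: U is totally real when it vanishes on U. *)
Definition omega u v : R := dot u.1 v.2 - dot u.2 v.1.
Definition ip u v : R := dot u.1 v.1 + dot u.2 v.2.
(** The complex bilinear square of a + i b vanishes. *)
Definition isotropic_pair u := dot u.1 u.1 = dot u.2 u.2 /\ dot u.1 u.2 = 0.

(** Half of the triple bracket [[X, Y], Z] in the coordinates (a, b) of the
    tangent vectors ([lie_triple_Phi]). As m x 2 matrices u, v, w with columns
    a, b it is (v u^T - u v^T) w - w (v^T u - u^T v); the second summand
    contributes the terms with omega. *)
Definition bracket u v w : V :=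
  (dot u.1 w.1 *: v.1 + dot u.2 w.1 *: v.2 - dot v.1 w.1 *: u.1 -
     dot v.2 w.1 *: u.2 - omega u v *: w.2,
   dot u.1 w.2 *: v.1 + dot u.2 w.2 *: v.2 - dot v.1 w.2 *: u.1 -
     dot v.2 w.2 *: u.2 + omega u v *: w.1).

(** Multiplication by c + i s. *)
Definition rot (c s : R) u : V := (c *: u.1 - s *: u.2, s *: u.1 + c *: u.2).

Lemma pairP (u v : V) : u.1 = v.1 -> u.2 = v.2 -> u = v.
Proof. by case: u v => ? ? [? ?] /= -> ->. Qed.

Lemma jm_is_linear : linear Jpair.
Proof. by move=> k u v; apply: pairP => /=; vring. Qed.
HB.instance Definition _ := GRing.isLinear.Build R V V *:%R Jpair jm_is_linear.
Lemma rot_is_linear (c s : R) : linear (rot c s).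
Proof. by move=> k u v; apply: pairP => /=; vring. Qed.
HB.instance Definition _ (c s : R) :=
  GRing.isLinear.Build R V V *:%R (rot c s) (rot_is_linear c s).

Lemma JpairK u : Jpair (Jpair u) = - u.
Proof. by apply: pairP. Qed.

Lemma rotK (c s : R) u : c ^+ 2 + s ^+ 2 = 1 -> rot c s (rot c (- s) u) = u.
Proof.
by move=> h; apply: pairP => /=; apply/rowP => i; rewrite !mxE -[RHS]mul1r -h; ring.
Qed.

Lemma rot_Jpair (c s : R) u : rot c s (Jpair u) = Jpair (rot c s u).
Proof. by apply: pairP => /=; vring. Qed.

(** The phases c + i s with c^2 + s^2 = 1 form a circle of unitary maps; they
    preserve all the structure except the choice of the conjugation. *)
Lemma omega_rot (c s : R) u v : c ^+ 2 + s ^+ 2 = 1 -> omega (rot c s u) (rot c s v) = omega u v.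
Proof.
move=> h; rewrite /omega /= !dotE.
rewrite -[RHS]mul1r -h; ring.
Qed.

Lemma ip_rot (c s : R) u v : c ^+ 2 + s ^+ 2 = 1 -> ip (rot c s u) (rot c s v) = ip u v.
Proof.
move=> h; rewrite /ip /= !dotE.
rewrite -[RHS]mul1r -h; ring.
Qed.

Lemma bracket_rot (c s : R) u v w : c ^+ 2 + s ^+ 2 = 1 ->
  bracket (rot c s u) (rot c s v) (rot c s w) = rot c s (bracket u v w).
Proof.
move=> h; apply: pairP => /=; rewrite /omega /= !dotE; apply/rowP => i;
  by rewrite !mxE -[RHS]mul1r -h; ring.
Qed.

Lemma isotropic_pair_rot (c s : R) u : c ^+ 2 + s ^+ 2 = 1 -> isotropic_pair u -> isotropic_pair (rot c s u).
Proof.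
move=> h [h1 h2]; split; rewrite /= !dotE h1 (dotC u.2 u.1) h2; ring.
Qed.

End Model.

(** * Subspaces of the space of pairs *)

Section Lines.
Context {R : fieldType} {vT : vectType R}.
Implicit Types (u v w : vT) (U : {vspace vT}).

Lemma mem2P u v w :
  reflect (exists k l, u = k *: v + l *: w) (u \in <[v]> + <[w]>)%VS.
Proof.
apply: (iffP memv_addP) => [[_ /vlineP[k ->] [_ /vlineP[l ->] ->]]|[k [l ->]]].
  by exists k, l.
by exists (k *: v); [|exists (l *: w)]; rewrite // memvZ // memv_line.
Qed.

Lemma mem3P u v w t :
  reflect (exists k l n, u = k *: v + l *: w + n *: t)
          (u \in <[v]> + <[w]> + <[t]>)%VS.
Proof.
apply: (iffP memv_addP) => [[_ /mem2P[k [l ->]] [_ /vlineP[n ->] ->]]|].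
  by exists k, l, n.
move=> [k [l [n ->]]]; exists (k *: v + l *: w); first by apply/mem2P; exists k, l.
by exists (n *: t); rewrite // memvZ // memv_line.
Qed.

Lemma dim_add_line U v : v \notin U -> \dim (U + <[v]>) = (\dim U).+1.
Proof.
move=> vU; rewrite dimv_disjoint_sum; last first.
  apply/eqP; rewrite -subv0; apply/subvP => w /memv_capP[wU /vlineP[k kw]].
  rewrite memv0 kw; apply: contraR vU; rewrite scaler_eq0 negb_or => /andP[k0 v0].
  by rewrite -(scale1r v) -(mulVf k0) -scalerA -kw memvZ.
rewrite dim_vline; case: eqP vU => [->|_ _]; first by rewrite mem0v.
by rewrite addn1.
Qed.

Lemma dim_le1 U : (forall u v, u \in U -> v \in U -> u != 0 -> v \in <[u]>%VS) ->
  (\dim U <= 1)%N.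
Proof.
move=> h; have [->|U0] := eqVneq U 0%VS; first by rewrite dimv0.
have /dimvS : (U <= <[vpick U]>)%VS.
  by apply/subvP => v vU; apply: h; rewrite ?memv_pick ?vpick0.
by rewrite dim_vline vpick0 U0.
Qed.

Lemma dim_le2 U v w : (U <= <[v]> + <[w]>)%VS -> (\dim U <= 2)%N.
Proof.
move=> /dimvS h; apply: leq_trans h _; apply: leq_trans (dimv_add_leqif _ _) _.
by rewrite !dim_vline; do 2 case: (_ != 0).
Qed.

End Lines.

Section Subspaces.
Context {R : rcfType} {m : nat}.
Local Notation E := ('rV[R]_m).
Local Notation V := (E * E)%type.
Implicit Types (a b c d e f p q x y t : E) (u v w : V).
Implicit Types (U F : {vspace V}) (W : {vspace E}).

Lemma dimE : \dim {:E} = m.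
Proof. by rewrite dimvf dim_matrix; exact: mul1n. Qed.

(** The subspace W1 + i W2. With W1 = W2 it is a CQ-subspace, and with W2 = 0 a
    subspace of V(A). *)
Definition prodv W1 W2 : {vspace V} :=
  (linfun (@fst E E) @^-1: W1 :&: linfun (@snd E E) @^-1: W2)%VS.

Lemma mem_prodv W1 W2 u : (u \in prodv W1 W2) = (u.1 \in W1) && (u.2 \in W2).
Proof. by rewrite memv_cap -!memv_preim !lfunE. Qed.

Definition real_part_inj a : V := (a, 0).
Definition imag_part_inj a : V := (0, a).
Lemma inj1_is_linear : linear real_part_inj.
Proof. by move=> k u v; apply: pairP => /=; vring. Qed.
HB.instance Definition _ := GRing.isLinear.Build R E V *:%R real_part_inj inj1_is_linear.
Lemma inj2_is_linear : linear imag_part_inj.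
Proof. by move=> k u v; apply: pairP => /=; vring. Qed.
HB.instance Definition _ := GRing.isLinear.Build R E V *:%R imag_part_inj inj2_is_linear.

Lemma prodvE W1 W2 : prodv W1 W2 = (linfun real_part_inj @: W1 + linfun imag_part_inj @: W2)%VS.
Proof.
apply/vspaceP => u; rewrite mem_prodv; apply/andP/memv_addP => [[h1 h2]|].
  exists (linfun real_part_inj u.1); first exact: memv_img.
  exists (linfun imag_part_inj u.2); first exact: memv_img.
  by rewrite !lfunE; apply: pairP; rewrite /= ?addr0 ?add0r.
move=> [_ /memv_imgP[a ha ->] [_ /memv_imgP[b hb ->] ->]].
by rewrite !lfunE /= addr0 add0r.
Qed.

Lemma dim_prodv W1 W2 : \dim (prodv W1 W2) = (\dim W1 + \dim W2)%N.
Proof.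
rewrite prodvE dimv_disjoint_sum; last first.
  apply/eqP; rewrite -subv0; apply/subvP => w /memv_capP.
  move=> [/memv_imgP[a _ ->] /memv_imgP[b _]]; rewrite !lfunE => -[-> _].
  by rewrite memv0.
congr addn; apply: limg_dim_eq; apply/eqP; rewrite -subv0; apply/subvP => w.
  by rewrite memv_cap memv_ker lfunE memv0 => /andP[_ /eqP[->]].
by rewrite memv_cap memv_ker lfunE memv0 => /andP[_ /eqP[->]].
Qed.

Lemma prodv_full : prodv fullv fullv = fullv.
Proof. by apply/vspaceP => u; rewrite mem_prodv !memvf. Qed.

Lemma dimV : \dim {:V} = (m + m)%N.
Proof. by rewrite -prodv_full dim_prodv dimE. Qed.

Lemma prodvS W1 W2 W1' W2' : (W1 <= W1')%VS -> (W2 <= W2')%VS ->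
  (prodv W1 W2 <= prodv W1' W2')%VS.
Proof.
move=> /subvP h1 /subvP h2; apply/subvP => u.
by rewrite !mem_prodv => /andP[/h1 -> /h2 ->].
Qed.

(** The preimage under a phase, so that membership can be rewritten; as a set it
    is U multiplied by the inverse phase. *)
Definition rotate_space (r s : R) U : {vspace V} := (linfun (rot r s) @^-1: U)%VS.

Lemma mem_rotate_space (r s : R) U u : (u \in rotate_space r s U) = (rot r s u \in U).
Proof. by rewrite -memv_preim lfunE. Qed.

Lemma rotate_spaceK (r s : R) U : r ^+ 2 + s ^+ 2 = 1 -> rotate_space r (- s) (rotate_space r s U) = U.
Proof. by move=> h; apply/vspaceP => u; rewrite !mem_rotate_space rotK. Qed.

Lemma rotNK (r s : R) u : r ^+ 2 + s ^+ 2 = 1 -> rot r (- s) (rot r s u) = u.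
Proof. by have := @rotK _ _ r (- s) u; rewrite opprK sqrrN. Qed.

Lemma dim_rotate_space (r s : R) U : r ^+ 2 + s ^+ 2 = 1 -> \dim (rotate_space r s U) = \dim U.
Proof.
move=> h; have le (s' : R) U' : r ^+ 2 + s' ^+ 2 = 1 ->
    (\dim (rotate_space r s' U') <= \dim U')%N.
  move=> h'; rewrite -(limg_dim_eq (f := linfun (rot r s'))); last first.
    apply/eqP; rewrite -subv0; apply/subvP => w.
    rewrite memv_cap memv_ker lfunE memv0 => /andP[_ /eqP e].
    by rewrite -(rotNK w h') e linear0.
  apply/dimvS/subvP => w /memv_imgP[u]; rewrite lfunE mem_rotate_space => hu ->.
  exact: hu.
apply/eqP; rewrite eqn_leq le //= -{1}(rotate_spaceK U h) le //.
by rewrite sqrrN.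
Qed.

Lemma rotate_space_full (r s : R) : rotate_space r s fullv = fullv.
Proof. by apply/vspaceP => u; rewrite mem_rotate_space !memvf. Qed.

Definition model_lts U := forall u v w, u \in U -> v \in U -> w \in U -> bracket u v w \in U.
Definition model_complex U := forall u, u \in U -> Jpair u \in U.
Definition model_treal U := forall u v, u \in U -> v \in U -> omega u v = 0.
Definition model_isotropic U := forall u, u \in U -> isotropic_pair u.
(** These are the commuting subspaces: [X, Y] kills the fibre over the base
    point, C z, when omega u v = 0, and it kills the tangent space when the
    bracket of u and v vanishes ([lie_Phi]). *)
Definition model_flat F := forall u v, u \in F -> v \in F ->
  (forall w, bracket u v w = 0) /\ omega u v = 0.
Definition model_rank U r :=
  (exists F, [/\ (F <= U)%VS, model_flat F & \dim F = r]) /\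
  (forall F, (F <= U)%VS -> model_flat F -> (\dim F <= r)%N).
Definition model_maximal U := [/\ model_lts U, U != fullv &
  forall V', model_lts V' -> (U <= V')%VS -> V' = U \/ V' = fullv].

Lemma model_lts_rotate (r s : R) U : r ^+ 2 + s ^+ 2 = 1 -> model_lts U -> model_lts (rotate_space r s U).
Proof. by move=> h hU u v w; rewrite !mem_rotate_space -bracket_rot //; exact: hU. Qed.
Lemma model_treal_rotate (r s : R) U : r ^+ 2 + s ^+ 2 = 1 -> model_treal U -> model_treal (rotate_space r s U).
Proof. by move=> h hU u v; rewrite !mem_rotate_space -(omega_rot _ _ h); exact: hU. Qed.
Lemma model_isotropic_rotate (r s : R) U : r ^+ 2 + s ^+ 2 = 1 -> model_isotropic U -> model_isotropic (rotate_space r s U).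
Proof.
move=> h hU u; rewrite !mem_rotate_space => /hU hu; rewrite -(rotNK u h).
by apply: isotropic_pair_rot => //; rewrite sqrrN.
Qed.
Lemma model_flat_rotate (r s : R) U : r ^+ 2 + s ^+ 2 = 1 -> model_flat U -> model_flat (rotate_space r s U).
Proof.
move=> h hU u v; rewrite !mem_rotate_space => hu hv.
have [e1 e2] := hU _ _ hu hv; split; last by rewrite -(omega_rot _ _ h).
by move=> w; rewrite -(rotNK (bracket u v w) h) -bracket_rot // e1 linear0.
Qed.

(** The span of x - J y, y + J x and x + J y. *)
Definition space_G3 x y : {vspace V} := (<[(x, 0%R)]> + <[(0%R, y)]> + <[(y, x)]>)%VS.
Definition space_A x y t : {vspace V} :=
  (<[((2 *: x)%R, y)]> + <[(y, (x + Num.sqrt 3 *: t)%R)]>)%VS.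
Definition orthv W1 W2 : Prop := forall x y, (x \in W1)%VS -> (y \in W2)%VS -> dot x y = 0.

Lemma model_lts_line v : model_lts <[v]>.
Proof.
move=> _ _ _ /vlineP[k ->] /vlineP[l ->] /vlineP[n ->].
apply/vlineP; exists 0; rewrite scale0r.
by apply: pairP; rewrite /= /omega /= !dotE (dotC v.2 v.1); vring.
Qed.

Lemma model_lts_prodv W : model_lts (prodv W W).
Proof.
move=> [a b] [c d] [e f]; rewrite !mem_prodv /=.
move=> /andP[ha hb] /andP[hc hd] /andP[he hf].
by rewrite !(rpredD, rpredB, rpredN, rpredZ).
Qed.

Lemma model_lts_prodv_orth W1 W2 : orthv W1 W2 -> model_lts (prodv W1 W2).
Proof.
move=> o [a b] [c d] [e f]; rewrite !mem_prodv /bracket /omega /=.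
move=> /andP[ha hb] /andP[hc hd] /andP[he hf].
rewrite (o a d) // (o c f) // (o a f) // (dotC b c) (o c b) //.
rewrite (dotC b e) (o e b) // (dotC d e) (o e d) // subrr !scale0r.
by rewrite !(addr0, subr0, sub0r, add0r) !(rpredB, rpredD, rpredN, rpredZ).
Qed.

Lemma orthv0 W : orthv W 0.
Proof. by move=> x y _; rewrite memv0 => /eqP ->; rewrite dot0r. Qed.

(** The vector (x, y) is central, and D is an area form on the quotient by it: the
    subspace is tangent to a product of a 2-sphere and a circle. *)
Lemma model_lts_space_G3 x y : dot x x = 1 -> dot y y = 1 -> dot x y = 0 -> model_lts (space_G3 x y).
Proof.
move=> xx yy xy; have yx : dot y x = 0 by rewrite dotC.
move=> u v w /mem3P[a1 [a2 [a3 ->]]] /mem3P[b1 [b2 [b3 ->]]] /mem3P[c1 [c2 [c3 ->]]].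
apply/mem3P; rewrite /bracket /omega /= !dotE xx yy xy yx.
pose D := a1 * b3 + a3 * b2 - a2 * b3 - a3 * b1.
exists (-2 * D * c3), (2 * D * c3), (D * (c1 - c2)).
by apply: pairP; rewrite /= /D; vring.
Qed.

(** The two generators are orthogonal and of the same length, and the bracket is
    that of a 2-sphere with the area form D. *)
Lemma model_lts_space_A x y t : dot x x = 1 -> dot y y = 1 -> dot t t = 1 ->
  dot x y = 0 -> dot x t = 0 -> dot y t = 0 -> model_lts (space_A x y t).
Proof.
move=> xx yy tt xy xt yt; have yx : dot y x = 0 by rewrite dotC.
have tx : dot t x = 0 by rewrite dotC.
have ty : dot t y = 0 by rewrite dotC.
move=> u v w /mem2P[a1 [a2 ->]] /mem2P[b1 [b2 ->]] /mem2P[c1 [c2 ->]].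
have r3 : Num.sqrt 3 ^+ 2 = 3 :> R by rewrite sqr_sqrtr.
apply/mem2P; rewrite /bracket /omega /= !dotE xx yy xy yx xt tx yt ty tt.
set r := Num.sqrt 3 in r3 *; pose D := a1 * b2 - a2 * b1.
exists (- D * c2), (D * c1).
have r3' : r * (r * 1) = 3 by rewrite mulr1 -expr2.
apply: pairP; rewrite /= /D; apply/rowP => i; rewrite !mxE.
  ring: r3'.
ring: r3'.
Qed.

End Subspaces.

(** * Isotropic subspaces *)

Section Iso.
Context {R : rcfType} {m : nat}.
Local Notation E := ('rV[R]_m).
Local Notation V := (E * E)%type.
Implicit Types (a b c d e f p q x y t : E) (u v w : V).
Implicit Types (U F : {vspace V}) (W : {vspace E}).

(** Being isotropic is the vanishing of a quadratic map, so on a subspace its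
    polarization vanishes as well. *)
Lemma isotropic_polarization U u v : model_isotropic U -> u \in U -> v \in U ->
  dot u.1 v.1 = dot u.2 v.2 /\ dot u.1 v.2 = - dot u.2 v.1.
Proof.
move=> h hu hv; have [h1 h2] := h _ (memvD hu hv).
have [[h3 h4] [h5 h6]] := (h _ hu, h _ hv).
move: h1 h2; rewrite /= !dotE h3 h4 h5 h6 (dotC v.1 u.1) (dotC v.2 u.2) (dotC v.1 u.2).
by lra.
Qed.

(** The terms of the bracket that involve the conjugation vanish. *)
Lemma bracket_isotropic U u v w : model_isotropic U -> u \in U -> v \in U -> w \in U ->
  bracket u v w = dot u.1 w.1 *: v - dot u.2 w.1 *: Jpair v - dot v.1 w.1 *: u +
            dot v.2 w.1 *: Jpair u + omega u v *: Jpair w.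
Proof.
move=> h hu hv hw; have [h1 h2] := isotropic_polarization h hu hw.
have [h3 h4] := isotropic_polarization h hv hw.
by apply: pairP; rewrite /bracket /= -?h1 -?h3 ?h2 ?h4; vring.
Qed.

Lemma isotropic_complex_lts U : model_isotropic U -> model_complex U -> model_lts U.
Proof.
move=> h1 h2 u v w hu hv hw; rewrite (bracket_isotropic h1 hu hv hw).
by rewrite !(rpredD, rpredB, rpredN, rpredZ) ?h2.
Qed.

Lemma isotropic_treal_lts U : model_isotropic U -> model_treal U -> model_lts U.
Proof.
move=> h1 h2 u v w hu hv hw; rewrite (bracket_isotropic h1 hu hv hw).
have e u' : u' \in U -> dot u'.2 w.1 = 0.
  move=> hu'; have [_] := isotropic_polarization h1 hu' hw.
  by have := h2 _ _ hu' hw; rewrite /omega; lra.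
rewrite h2 // !e // !scale0r !addr0 subr0.
by rewrite !(rpredD, rpredB, rpredN, rpredZ).
Qed.

(** When omega u v is not zero, bracket u v u exhibits J u as a combination of
    elements of U. With J u and J v in U, the bracket of u, v and any w does the
    same for J w. *)
Lemma isotropic_lts_dichotomy U : model_isotropic U -> model_lts U -> model_treal U \/ model_complex U.
Proof.
move=> hi hU; have [?|ncx] := pselect (model_treal U); first by left.
right; have [u [v [hu hv nz]]] : exists u v, [/\ u \in U, v \in U & omega u v != 0].
  apply: contrapT => h; apply: ncx => u v hu hv; apply/eqP.
  by apply: contrapT => /negP h'; apply: h; exists u, v.
have key u' v' : u' \in U -> v' \in U -> omega u' v' != 0 -> Jpair u' \in U.
  move=> hu' hv' nz'.
  have := hU _ _ _ hu' hv' hu'; rewrite (bracket_isotropic hi hu' hv' hu').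
  have [_ h2] := hi _ hu'; have [_ h4] := isotropic_polarization hi hu' hv'.
  rewrite (dotC u'.2) h2 scale0r subr0.
  (* By isotropy both terms of the Kaehler form are equal. *)
  have -> : dot v'.2 u'.1 = omega u' v' / 2.
    by rewrite dotC /omega h4; field.
  have k0 : omega u' v' / 2 + omega u' v' != 0.
    rewrite (_ : _ + _ = (3 / 2) * omega u' v'); last by field.
    by rewrite mulf_neq0 // mulf_neq0 // ?invr_eq0 pnatr_eq0.
  rewrite -addrA -scalerDl rpredDl; last by rewrite memvB ?memvZ.
  move=> h.
  by rewrite -[Jpair u'](scalerK k0) memvZ.
have ju := key _ _ hu hv nz.
have Jimage : Jpair v \in U.
  apply: (key v u) => //; move: nz; rewrite /omega -oppr_eq0.
  by rewrite opprB (dotC v.1) (dotC v.2).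
move=> w hw; have := hU _ _ _ hu hv hw; rewrite (bracket_isotropic hi hu hv hw) rpredDl.
  by move=> h; rewrite -[Jpair w](scalerK nz) memvZ.
by rewrite !(rpredD, rpredB, rpredN, rpredZ).
Qed.

End Iso.

(** * Subspaces that contain a flat *)

Section Eig.
Context {R : fieldType} {vT : vectType R}.

(** Apply L - l for the first eigenvalue l: this removes one summand and
    multiplies each other one by a nonzero scalar, so that induction applies. *)
Lemma eigencomponents (L : {linear vT -> vT}) (U : {vspace vT}) (s : seq (R * vT)) :
  (forall u, u \in U -> L u \in U) -> uniq (map fst s) ->
  (forall i, i \in s -> L i.2 = i.1 *: i.2) ->
  \sum_(i <- s) i.2 \in U -> forall i, i \in s -> i.2 \in U.
Proof.
move=> LU us es sU.
have gen (k : R * vT -> R) : \sum_(i <- s) k i *: i.2 \in U ->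
    forall i, i \in s -> k i *: i.2 \in U.
  elim: s us es k {sU} => [|[l w] s IH] //= /andP[ls us] es k.
  rewrite big_cons => h.
  have es' i : i \in s -> L i.2 = i.1 *: i.2 by move=> hi; apply: es; rewrite inE hi orbT.
  have h2 : \sum_(i <- s) (k i * (i.1 - l)) *: i.2 \in U.
    have := LU _ h; rewrite linearD linearZ (es (l, w)) ?mem_head //= linear_sum.
    have := memvZ l h; rewrite scalerDr scaler_sumr => h1 h2.
    have := memvB h2 h1; rewrite opprD addrACA !scalerA (mulrC l) subrr add0r -sumrB.
    congr (_ \in U); rewrite !big_seq; apply: eq_bigr => i si.
    by rewrite linearZ es' //= !scalerA -scalerBl; congr (_ *: _); rewrite mulrBr (mulrC l).
  have h3 i : i \in s -> k i *: i.2 \in U.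
    move=> si; have := IH us es' _ h2 i si.
    have nz : i.1 - l != 0.
      by rewrite subr_eq0; apply: contraNneq ls => <-; exact: map_f.
    by move=> /(memvZ (i.1 - l)^-1); rewrite scalerA mulrCA mulVf // mulr1.
  move=> i; rewrite inE => /orP[/eqP->|]; last exact: h3.
  move: h; rewrite rpredDr //= big_seq; apply: memv_suml => j; exact: h3.
move=> i si; rewrite -(scale1r i.2); apply: (gen (fun=> 1)) => //.
by under eq_bigr do rewrite scale1r.
Qed.

End Eig.

Section Class.
Context {R : rcfType} {m : nat}.
Local Notation E := ('rV[R]_m).
Local Notation V := (E * E)%type.
Implicit Types (a b c d e f p q x y t : E) (u v w : V).
Implicit Types (U F : {vspace V}) (W : {vspace E}).

Definition real_slice U : {vspace E} := (linfun (@real_part_inj R m) @^-1: U)%VS.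
Definition imag_slice U : {vspace E} := (linfun (@imag_part_inj R m) @^-1: U)%VS.
Lemma mem_real_slice U a : (a \in real_slice U) = ((a, 0) \in U).
Proof. by rewrite -memv_preim lfunE. Qed.
Lemma mem_imag_slice U a : (a \in imag_slice U) = ((0, a) \in U).
Proof. by rewrite -memv_preim lfunE. Qed.

Lemma mem_slices U a b : (a, 0) \in U -> (0, b) \in U -> (a, b) \in U.
Proof.
move=> h1 h2; have := memvD h1 h2.
by rewrite (_ : _ + _ = (a, b)) //; apply: pairP; rewrite /= ?addr0 ?add0r.
Qed.

Section Flat.
Variables (U : {vspace V}) (hU : model_lts U) (x y : E).
Hypotheses (xx : dot x x = 1) (yy : dot y y = 1) (xy : dot x y = 0).
Hypotheses (hx : (x, 0) \in U) (hy : (0, y) \in U).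
Let yx : dot y x = 0. Proof. by rewrite dotC. Qed.

(** The root vectors of the roots a + b and a - b are (y, -x) and (y, x). The
    Jacobi operators of (x, 0) and (0, y) commute and their product is the
    projection to the sum of these root spaces; the polarized operator
    w |-> bracket (x, 0) w (0, y) exchanges the two coordinates there, up to sign. *)
Lemma flat_mixed c d : (c, d) \in U ->
  (dot c y *: y, dot d x *: x) \in U /\ (dot d x *: y, dot c y *: x) \in U.
Proof.
move=> hw; have h1 := hU hx hw hx; have h2 := hU hy h1 hy.
have e2 : (dot c y *: y, dot d x *: x) \in U.
  move: h2; congr (_ \in U).
  apply: pairP; rewrite /bracket /omega /= !dotE ?xx ?yy ?xy ?yx ?(dotC x c) ?(dotC x d) ?(dotC y c) ?(dotC y d); vring.
split=> //; have := hU hx e2 hy; rewrite -memvN; congr (_ \in U).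
by apply: pairP; rewrite /bracket /omega /= !dotE ?xx ?yy ?xy ?yx; vring.
Qed.

(** What the Jacobi operators of (x, 0) and (0, y) leave after the mixed part of
    [flat_mixed] and the flat itself are subtracted. *)
Lemma flat_slices c d : (c, d) \in U ->
  (c - dot c y *: y, 0) \in U /\ (0, d - dot d x *: x) \in U.
Proof.
move=> hw; have [h0 _] := flat_mixed hw; split.
  have := memvD (memvB (hU hx hw hx) h0) (memvZ (dot c x) hx); congr (_ \in U).
  by apply: pairP; rewrite /bracket /omega /= !dotE ?xx ?(dotC x c) ?(dotC x d); vring.
have := memvD (memvB (hU hy hw hy) h0) (memvZ (dot d y) hy); congr (_ \in U).
by apply: pairP; rewrite /bracket /omega /= !dotE ?yy ?(dotC y c) ?(dotC y d); vring.
Qed.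

(** Without mixed part U is the sum of its slices. They are orthogonal because
    the bracket of (p, 0), (x, 0), (0, q) is (0, (p.q) x) up to terms that
    vanish, and this has a mixed part unless p.q = 0. *)
Lemma flat_G2 : (forall c d, (c, d) \in U -> dot c y = 0 /\ dot d x = 0) ->
  exists W1 W2, [/\ x \in W1, y \in W2, orthv W1 W2 & U = prodv W1 W2].
Proof.
move=> h0; exists (real_slice U), (imag_slice U); rewrite mem_real_slice mem_imag_slice; split=> //.
  move=> p q; rewrite mem_real_slice mem_imag_slice => hp hq.
  have [_ qx] := h0 _ _ hq.
  have [_] := h0 _ _ (hU hp hx hq).
  by rewrite /omega /= !dotE (dotC x q) qx xx; lra.
apply/vspaceP => -[c d]; rewrite mem_prodv mem_real_slice mem_imag_slice /=.
apply/idP/andP => [hw|[h1 h2]]; last exact: mem_slices.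
have [e1 e2] := h0 _ _ hw; have := flat_slices hw.
by rewrite e1 e2 !scale0r !subr0.
Qed.

(** With both root vectors U contains (y, 0) and (0, x), and brackets with them exchange the slices. *)
Lemma flat_G1 : (y, 0) \in U -> (0, x) \in U ->
  exists W, [/\ x \in W, y \in W & U = prodv W W].
Proof.
move=> hy' hx'; exists (real_slice U); rewrite !mem_real_slice; split=> //.
have s12 p : (p, 0) \in U -> (0, p) \in U.
  move=> hp; have := memvB (memvZ (dot p x) hx') (hU hp hx hx'); congr (_ \in U).
  by apply: pairP; rewrite /bracket /omega /= !dotE ?xx; vring.
have s21 p : (0, p) \in U -> (p, 0) \in U.
  move=> hp; have := memvB (memvZ (dot p y) hy') (hU hp hy hy'); congr (_ \in U).
  by apply: pairP; rewrite /bracket /omega /= !dotE ?yy; vring.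
apply/vspaceP => -[c d]; rewrite mem_prodv !mem_real_slice /=.
apply/idP/andP => [hw|[h1 /s12 h2]]; last exact: mem_slices.
have [h1 h2] := flat_slices hw; split.
  have := memvD h1 (memvZ (dot c y) hy'); congr (_ \in U).
  by apply: pairP; rewrite /=; vring.
apply: s21; have := memvD h2 (memvZ (dot d x) hx'); congr (_ \in U).
by apply: pairP; rewrite /=; vring.
Qed.

(** With (y, x) alone both slices are lines: a further (p, 0) in U would give
    (0, p), and then the bracket of (x, 0), (p, 0), (0, p) is a multiple of
    (0, x), which would split (y, x). *)
Lemma flat_G3 : (y, x) \in U -> (y, 0) \notin U -> U = space_G3 x y.
Proof.
move=> hyx hny.
have key c d : (c, d) \in U -> dot c y = dot d x.
  move=> hw; have [h _] := flat_mixed hw.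
  apply/eqP; rewrite -subr_eq0; apply: contraNT hny => nz.
  have := memvZ (dot c y - dot d x)^-1 (memvB h (memvZ (dot d x) hyx)).
  rewrite (_ : _ *: _ = (y, 0)) //.
  apply: (can_inj (scalerK nz)); rewrite scalerKV ?unitfE //.
  by apply: pairP; rewrite /=; vring.
have p0 p : (p, 0) \in U -> dot p x = 0 -> p = 0.
  move=> hp px; have [py _] : dot p y = 0 /\ True by rewrite (key _ _ hp) dot0l.
  have h2 : (0, p) \in U.
    have := hU hx hp hyx; congr (_ \in U).
    by apply: pairP; rewrite /bracket /omega /= !dotE ?xx ?xy ?px ?py; vring.
  have := key _ _ (hU hx hp h2); rewrite /bracket /omega /= !dotE xx xy (dotC x p) px py.
  by move=> e; apply/eqP; rewrite -dot_eq0; apply/eqP; lra.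
have q0 q : (0, q) \in U -> dot q y = 0 -> q = 0.
  move=> hq qy; have qx : dot q x = 0 by rewrite -(key _ _ hq) dot0l.
  apply: p0 => //; have := hU hy hq hyx; congr (_ \in U).
  by apply: pairP; rewrite /bracket /omega /= !dotE ?yy ?yx ?qx ?qy; vring.
apply/vspaceP => -[c d]; apply/idP/mem3P => [hw|[k [l [n ->]]]]; last first.
  by rewrite !memvD ?memvZ.
have [h1 h2] := flat_slices hw; exists (dot c x), (dot d y), (dot c y).
have e1 : c - dot c y *: y - dot c x *: x = 0.
  apply: p0; last by rewrite !dotE xx yx; ring.
  have := memvB h1 (memvZ (dot c x) hx); congr (_ \in U).
  by apply: pairP; rewrite /=; vring.
have e2 : d - dot d x *: x - dot d y *: y = 0.
  apply: q0; last by rewrite !dotE xy yy; ring.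
  have := memvB h2 (memvZ (dot d y) hy); congr (_ \in U).
  by apply: pairP; rewrite /=; vring.
move: e1 e2 => /eqP; rewrite subr_eq0 subr_eq => /eqP e1.
move=> /eqP; rewrite subr_eq0 subr_eq => /eqP e2.
by apply: pairP => /=; [rewrite {1}e1|rewrite {1}e2 (key _ _ hw)]; vring.
Qed.

End Flat.

End Class.

(** * Normal forms *)

Section NormalForms.
Context {R : rcfType} {m : nat}.
Local Notation E := ('rV[R]_m).
Local Notation V := (E * E)%type.
Implicit Types (a b : R) (c d e f p q x y t : E) (u v w : V).
Implicit Types (U F : {vspace V}) (W : {vspace E}).

Definition model_Geo U := exists2 v, v != 0 & U = <[v]>%VS.
Definition model_G1 k U := exists2 W, \dim W = k & U = prodv W W.
Definition model_G2 k1 k2 U := exists W1 W2,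
  [/\ \dim W1 = k1, \dim W2 = k2, orthv W1 W2 & U = prodv W1 W2].
Definition model_G3 U := exists x y,
  [/\ dot x x = 1, dot y y = 1, dot x y = 0 & U = space_G3 x y].
Definition model_P1 k U := exists2 W, \dim W = k & U = prodv W 0.
Definition model_P2 U := exists2 x, dot x x = 1 & U = prodv <[x]> <[x]>.
Definition model_A U := exists x y t,
  [/\ [/\ dot x x = 1, dot y y = 1 & dot t t = 1],
      [/\ dot x y = 0, dot x t = 0 & dot y t = 0] & U = space_A x y t].
Definition model_I1 k U := [/\ model_complex U, model_isotropic U & \dim U = (2 * k)%N].
Definition model_I2 k U := [/\ model_treal U, model_isotropic U & \dim U = k].

(** The nine types, for the conjugation (a, b) |-> (a, - b). *)
Definition normal_form U : Prop :=
  model_Geo U \/ (exists2 k, (2 <= k)%N & model_G1 k U) \/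
  (exists k1 k2, [/\ (1 <= k1)%N, (1 <= k2)%N & model_G2 k1 k2 U]) \/
  model_G3 U \/ (exists2 k, (1 <= k)%N & model_P1 k U) \/ model_P2 U \/ model_A U \/
  (exists2 k, (1 <= k)%N & model_I1 k U) \/ (exists2 k, (1 <= k)%N & model_I2 k U).

Lemma dim_gt0 (W : {vspace E}) x : x \in W -> dot x x = 1 -> (1 <= \dim W)%N.
Proof.
move=> xW xx; rewrite lt0n dimv_eq0; apply: contra_eq_neq xx => W0.
by move: xW; rewrite W0 memv0 => /eqP ->; rewrite dot0l eq_sym oner_eq0.
Qed.

Lemma dim_gt1 (W : {vspace E}) x y : x \in W -> y \in W ->
  dot x x = 1 -> dot y y = 1 -> dot x y = 0 -> (2 <= \dim W)%N.
Proof.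
move=> xW yW xx yy xy.
have yx : y \notin <[x]>%VS.
  apply/negP => /vlineP[k e]; move: xy; rewrite e dotZr xx mulr1 => k0.
  by move: yy; rewrite e k0 scale0r dot0l => /eqP; rewrite eq_sym oner_eq0.
have x0 : x != 0 by apply: contra_eq_neq xx => ->; rewrite dot0l eq_sym oner_eq0.
have := dim_add_line yx; rewrite dim_vline x0 => <-.
by apply: dimvS; rewrite subv_add -!memvE xW yW.
Qed.

(** The mixed parts of the elements of U form a subspace of R^2 that is invariant
    under the exchange of coordinates; it is 0, all of R^2, or one of the two
    diagonals. Replacing y by - y exchanges the diagonals. *)
Lemma classify_rank2 U x y : model_lts U -> dot x x = 1 -> dot y y = 1 -> dot x y = 0 ->
  (x, 0) \in U -> (0, y) \in U -> normal_form U.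
Proof.
move=> hU xx yy xy hx hy.
have yx : dot y x = 0 by rewrite dotC.
have [h|/existsNP[c /existsNP[d /not_implyP[hw hn]]]] :=
    pselect (forall c d, (c, d) \in U -> dot c y = 0 /\ dot d x = 0).
  have [W1 [W2 [h1 h2 h3 h4]]] := flat_G2 hU xx yy xy hx hy h.
  do 2 right; left; exists (\dim W1), (\dim W2); split.
  - exact: dim_gt0 h1 xx.
  - exact: dim_gt0 h2 yy.
  - by exists W1, W2.
have [e1 e2] := flat_mixed hU xx yy xy hx hy hw.
set k := dot c y in hn e1 e2; set l := dot d x in hn e1 e2.
have pl : (k + l) *: ((y, x) : V) \in U.
  have := memvD e1 e2; congr (_ \in U).
  by apply: pairP; rewrite /=; vring.
have mi : (k - l) *: ((- y, x) : V) \in U.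
  have := memvB e2 e1; congr (_ \in U).
  by apply: pairP; rewrite /=; vring.
have fin y' : dot y' y' = 1 -> dot x y' = 0 -> (0, y') \in U -> (y', x) \in U -> normal_form U.
  move=> yy' xy' hy' hyx; case: (boolP ((y', 0) \in U)) => h.
    have hx' : (0, x) \in U.
      have := memvB hyx h; congr (_ \in U).
      by apply: pairP; rewrite /=; vring.
    have [W [h1 h2 h3]] := flat_G1 hU xx yy' xy' hx hy' h hx'.
    right; left; exists (\dim W); last by exists W.
    by apply: (dim_gt1 h1 h2).
  do 3 right; left; exists x, y'; split=> //.
  exact: flat_G3.
have [kl|kl] := eqVneq (k + l) 0; last first.
  by apply: (fin y) => //; rewrite -[(y, x)](scalerK kl) memvZ.
apply: (fin (- y)); rewrite ?dotNl ?dotNr ?yy ?opprK ?xy ?oppr0 //.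
  by rewrite -memvN; congr (_ \in U): hy; apply: pairP; rewrite /=; vring.
have kl' : k - l != 0.
  apply: contra_not_neq hn => /eqP; rewrite subr_eq0 => /eqP e.
  by move: kl; rewrite e; split; lra.
by rewrite -[(- y, x)](scalerK kl') memvZ.
Qed.

(** If U contains no flat through (x, 0), the Jacobi operator of (x, 0) shows
    that each element of U is of the form (c, g x), modulo (x, 0) with c
    orthogonal to x. The bracket of (x, 0), (c, g x), (c, g x) has the component
    (0, 2 g c), which again would span a flat with (x, 0). So c = 0 or g = 0,
    and a subspace cannot contain both kinds. *)
Lemma classify_real_vector U x : model_lts U -> dot x x = 1 -> (x, 0) \in U -> normal_form U.
Proof.
move=> hU xx hx.
have [[d [hd dx d0]]|hn] :=
    pselect (exists d, [/\ (0, d) \in U, dot d x = 0 & d != 0]).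
  have [k [y [k0 yy e]]] := normalize_vector d0; apply: (classify_rank2 hU xx yy _ hx).
    by move: dx; rewrite e dotZl dotC => /eqP; rewrite mulf_eq0 gt_eqF //= => /eqP.
  have := memvZ k^-1 hd; rewrite e; congr (_ \in U).
  by apply: pairP; rewrite /= ?scaler0 ?scalerK ?gt_eqF.
have nd d : (0, d) \in U -> dot d x = 0 -> d = 0.
  move=> h1 h2; apply/eqP; apply: contra_notT hn => h3.
  by exists d.
have key c d : (c, d) \in U -> d = dot d x *: x /\
    (dot d x != 0 -> c = dot c x *: x).
  move=> hw; have h1 := hU _ _ _ hx hw hx.
  have e1 : d - dot d x *: x = 0.
    apply: nd; last by rewrite !dotE xx; ring.
    have := memvB (memvB hw h1) (memvZ (dot c x) hx); congr (_ \in U).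
    by apply: pairP; rewrite /bracket /omega /= !dotE ?xx ?(dotC x c) ?(dotC x d); vring.
  have e1' : d = dot d x *: x by apply/eqP; rewrite -subr_eq0 e1.
  split=> // g0; set g := dot d x in e1' g0.
  have [c' Ec] : exists c', c' = c - dot c x *: x by exists (c - dot c x *: x).
  have c'x : dot c' x = 0 by rewrite Ec !dotE xx; ring.
  have hw' : (c', g *: x) \in U.
    have := memvB hw (memvZ (dot c x) hx); congr (_ \in U).
    by apply: pairP; rewrite /= ?Ec -?e1'; vring.
  have h2 := hU _ _ _ hx hw' hw'.
  have e2 : (2 * g) *: c' = 0.
    apply: nd; last by rewrite dotZl c'x mulr0.
    have := memvD h2 (memvZ (dot c' c' + g ^+ 2) hx); congr (_ \in U).
    apply: pairP; rewrite /bracket /omega /= !dotE ?xx ?(dotC x c') ?c'x;  vring.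
  apply/eqP; rewrite -subr_eq0 -Ec; move/eqP: e2; rewrite scaler_eq0 mulf_eq0.
  by rewrite pnatr_eq0 (negbTE g0).
have [h|/existsNP[c0 /existsNP[d0 /not_implyP[hw /eqP hn']]]] :=
    pselect (forall c d, (c, d) \in U -> d = 0).
  do 4 right; left; exists (\dim (real_slice U)); last exists (real_slice U) => //.
    by apply: (dim_gt0 (x := x)) => //; rewrite mem_real_slice.
  apply/vspaceP => -[c d]; rewrite mem_prodv mem_real_slice memv0 /=.
  by apply/idP/andP => [hw|[hw /eqP->//]]; rewrite -(h _ _ hw) hw.
have [e1 e2] := key _ _ hw; set g := dot d0 x in e1 e2.
have g0 : g != 0 by apply: contraNneq hn' => g0; rewrite e1 g0 scale0r.
have hx' : (0, x) \in U.
  have := memvZ g^-1 (memvB hw (memvZ (dot c0 x) hx)); congr (_ \in U).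
  by apply: pairP => /=; [rewrite {1}(e2 g0) subrr scaler0|rewrite {1}e1 scaler0 subr0 scalerK].
do 5 right; left; exists x => //.
apply/vspaceP => -[c d]; rewrite mem_prodv /=; apply/idP/andP => [h|]; last first.
  move=> [/vlineP[k ->] /vlineP[l ->]].
  have := memvD (memvZ k hx) (memvZ l hx'); congr (_ \in U).
  by apply: pairP; rewrite /=; vring.
have [e3 e4] := key _ _ h; split; last by apply/vlineP; exists (dot d x).
apply/vlineP; exists (dot c x).
have [dx|dx] := eqVneq (dot d x) 0; last exact: e4.
have := key _ _ (memvD h hx') => /= -[_]; rewrite !dotE xx dx add0r !addr0.
by apply; rewrite oner_eq0.
Qed.

(** If U contains (x, 0), then [classify_real_vector] applies. Otherwise the plane
    of (x, 0) and (0, y) meets U in the line of v = (a x, b y) only, and no root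
    vector of v lies in U by itself. *)
Lemma classify_generic_vector U x y a b : model_lts U -> dot x x = 1 -> dot y y = 1 -> dot x y = 0 ->
  0 < b -> b < a -> (a *: x, b *: y) \in U -> normal_form U.
Proof.
move=> hU xx yy xy b0 ba hv; have yx : dot y x = 0 by rewrite dotC.
have a0 : 0 < a by apply: lt_trans ba.
case: (boolP ((x, 0) \in U)) => [|nx]; first exact: classify_real_vector.
(* The plane of (x, 0) and (0, y) meets U in the line of v. *)
have line (s t : R) : (s *: x, t *: y) \in U -> s * b = t * a.
  move=> h; apply/eqP; rewrite -subr_eq0; apply: contraNT nx => nz.
  have := memvZ (s * b - t * a)^-1 (memvB (memvZ b h) (memvZ t hv)).
  rewrite (_ : _ *: _ = (x, 0)) //; apply: (can_inj (scalerK nz)).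
  by rewrite scalerKV ?unitfE //; apply: pairP; rewrite /=; vring.
(* For a root vector w, bracket v w w lies in this plane, along the direction
   dual to the root, hence cannot be a multiple of v. *)
have k3 c : (c, 0) \in U -> dot c x = 0 -> dot c y = 0 -> c = 0.
  move=> h cx cy; have h1 : ((- dot c c * a) *: x, 0 *: y) \in U.
    have := hU _ _ _ hv h h; congr (_ \in U).
    by apply: pairP; rewrite /bracket /omega /= !dotE ?(dotC x c) ?(dotC y c) ?cx ?cy; vring.
  move/line/eqP: h1; rewrite mul0r !mulf_eq0 oppr_eq0 dot_eq0 !gt_eqF // !orbF.
  by move/eqP.
have k4 d : (0, d) \in U -> dot d x = 0 -> dot d y = 0 -> d = 0.
  move=> h cx cy; have h1 : (0 *: x, (- dot d d * b) *: y) \in U.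
    have := hU _ _ _ hv h h; congr (_ \in U).
    by apply: pairP; rewrite /bracket /omega /= !dotE ?(dotC x d) ?(dotC y d) ?cx ?cy; vring.
  move/line/esym/eqP: h1; rewrite mul0r !mulf_eq0 oppr_eq0 dot_eq0 !gt_eqF // !orbF.
  by move/eqP.
have k1 k : (k *: y, - k *: x) \in U -> k = 0.
  move=> h; have h1 : ((-2 * k ^+ 2 * (a + b)) *: x, (-2 * k ^+ 2 * (a + b)) *: y) \in U.
    have := hU _ _ _ hv h h; congr (_ \in U).
    by apply: pairP; rewrite /bracket /omega /= !dotE ?xx ?yy ?xy ?yx; vring.
  move/line: h1 => /eqP; rewrite -subr_eq0 (_ : _ - _ = k ^+ 2 * (2 * (a + b) * (a - b))); last by ring.
  rewrite !mulf_eq0 subr_eq0 (gt_eqF ba) (gt_eqF (addr_gt0 a0 b0)) pnatr_eq0 /= !orbF.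
  by rewrite orbb => /eqP.
have k2 k : (k *: y, k *: x) \in U -> k = 0.
  move=> h; have h1 : ((-2 * k ^+ 2 * (a - b)) *: x, (2 * k ^+ 2 * (a - b)) *: y) \in U.
    have := hU _ _ _ hv h h; congr (_ \in U).
    by apply: pairP; rewrite /bracket /omega /= !dotE ?xx ?yy ?xy ?yx; vring.
  move/line: h1 => /eqP; rewrite -subr_eq0 (_ : _ - _ = k ^+ 2 * (-2 * (a + b) * (a - b))); last by ring.
  rewrite !mulf_eq0 subr_eq0 (gt_eqF ba) (gt_eqF (addr_gt0 a0 b0)) oppr_eq0 pnatr_eq0 /= !orbF.
  by rewrite orbb => /eqP.
pose v : V := (a *: x, b *: y).
have Llin : linear (fun w => bracket v w v).
  by move=> k u w; apply: pairP; rewrite /bracket /omega /= !dotE; vring.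
(* L is known by its values only, which keeps its unfolding out of the goals. *)
have [L LE] : exists L : {linear V -> V}, forall w, L w = bracket v w v.
  pose Lm := GRing.isLinear.Build R V V *:%R (fun w => bracket v w v) Llin.
  pose L : {linear V -> V} := HB.pack (fun w : V => bracket v w v) Lm.
  by exists L.
have LU w : w \in U -> L w \in U by move=> hw; rewrite LE; apply: hU.
have L0 (l n : R) : L (l *: x, n *: y) = 0 *: (l *: x, n *: y).
  by rewrite LE; apply: pairP; rewrite /= /omega /= !dotE ?xx ?yy ?xy ?yx; vring.
have L1 (k : R) : L (k *: y, - k *: x) = (a + b) ^+ 2 *: (k *: y, - k *: x).
  by rewrite LE; apply: pairP; rewrite /= /omega /= !dotE ?xx ?yy ?xy ?yx; vring.
have L2 (k : R) : L (k *: y, k *: x) = (a - b) ^+ 2 *: (k *: y, k *: x).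
  by rewrite LE; apply: pairP; rewrite /= /omega /= !dotE ?xx ?yy ?xy ?yx; vring.
have L3 c : dot c x = 0 -> dot c y = 0 -> L (c, 0) = a ^+ 2 *: (c, 0).
  move=> cx cy; rewrite LE; apply: pairP; rewrite /= /omega /= !dotE ?(dotC x c) ?(dotC y c) ?cx ?cy ?xx ?yy ?xy ?yx; vring.
have L4 d : dot d x = 0 -> dot d y = 0 -> L (0, d) = b ^+ 2 *: (0, d).
  move=> cx cy; rewrite LE; apply: pairP; rewrite /= /omega /= !dotE ?(dotC x d) ?(dotC y d) ?cx ?cy ?xx ?yy ?xy ?yx; vring.
have sq (p q : R) : 0 <= p -> p < q -> (p ^+ 2 == q ^+ 2) = false.
  by move=> p0 pq; rewrite lt_eqF // ltrXn2r // (le_trans p0 (ltW pq)).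
have ne1 : (0 == (a + b) ^+ 2) = false by rewrite -(sq 0 (a + b)) ?expr0n // addr_gt0.
have ne2 : (0 == a ^+ 2) = false by rewrite -(sq 0 a) ?expr0n.
have ne3 : (0 == b ^+ 2) = false by rewrite -(sq 0 b) ?expr0n.
have ne4 : (0 == (a - b) ^+ 2) = false by rewrite -(sq 0 (a - b)) ?expr0n ?subr_gt0.
have ne5 : ((a + b) ^+ 2 == a ^+ 2) = false by rewrite eq_sym sq ?ltW //; lra.
have ne6 : ((a + b) ^+ 2 == b ^+ 2) = false by rewrite eq_sym sq ?ltW //; lra.
have ne7 : ((a + b) ^+ 2 == (a - b) ^+ 2) = false by rewrite eq_sym sq ?ltW //; lra.
have ne8 : (a ^+ 2 == b ^+ 2) = false by rewrite eq_sym sq ?ltW //; lra.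
have ne9 : (a ^+ 2 == (a - b) ^+ 2) = false by rewrite eq_sym sq ?ltW //; lra.
(* The eigenvalues 0, (a + b)^2, a^2 are simple; (a - b)^2 and b^2 coincide
   when a = 2 b, and then only the sum of the last two components, determined
   by k and r, is known to lie in U. *)
have ab2 : a = 2 * b \/ a != 2 * b by case: (eqVneq a (2 * b)); [left|right].
have dec c d : (c, d) \in U -> exists (l n k : R) r,
    [/\ c = l *: x + k *: y, d = n *: y + (k *: x + r), (k *: y, k *: x + r) \in U,
        (l *: x, n *: y) \in U & [/\ dot r x = 0, dot r y = 0 &
         a != 2 * b -> k = 0 /\ r = 0]].
  move=> hw; pose k := (dot c y + dot d x) / 2; pose j := (dot c y - dot d x) / 2.
  have [r Er] : exists r, r = d - dot d x *: x - dot d y *: y by eexists.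
  have [p Ep] : exists p, p = c - dot c x *: x - dot c y *: y by eexists.
  have rx : dot r x = 0 by rewrite Er !dotE xx yx; ring.
  have ry : dot r y = 0 by rewrite Er !dotE xy yy; ring.
  have px : dot p x = 0 by rewrite Ep !dotE xx yx; ring.
  have py : dot p y = 0 by rewrite Ep !dotE xy yy; ring.
  pose w0 : V := (dot c x *: x, dot d y *: y).
  pose w1 : V := (j *: y, - j *: x).
  pose w2 : V := (k *: y, k *: x).
  have fin : w0 \in U -> w1 \in U -> (p, 0) \in U -> (k *: y, k *: x + r) \in U ->
      (a != 2 * b -> k = 0 /\ r = 0) -> exists (l n k : R) r,
    [/\ c = l *: x + k *: y, d = n *: y + (k *: x + r), (k *: y, k *: x + r) \in U,
        (l *: x, n *: y) \in U & [/\ dot r x = 0, dot r y = 0 &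
         a != 2 * b -> k = 0 /\ r = 0]].
    move=> h0 h1 h3 h24 hab; exists (dot c x), (dot d y), k, r.
    have p0 := k3 _ h3 px py; have j0 := k1 _ h1.
    have kE : k = dot c y by move: j0; rewrite /k /j => /eqP; rewrite mulf_eq0 invr_eq0 pnatr_eq0 orbF subr_eq0 => /eqP ->; field.
    have kE' : k = dot d x by move: j0; rewrite /k /j => /eqP; rewrite mulf_eq0 invr_eq0 pnatr_eq0 orbF subr_eq0 => /eqP ->; field.
    split=> //.
      by rewrite kE; apply/eqP; rewrite -subr_eq0 opprD addrA -Ep p0.
    by rewrite kE' Er; vring.
  have [ab|ab] := ab2.
    pose s := [:: (0, w0); ((a + b) ^+ 2, w1); (a ^+ 2, (p, 0)); (b ^+ 2, (k *: y, k *: x + r))].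
    have hs : forall i, i \in s -> i.2 \in U.
      apply: (@eigencomponents _ _ L) => //.
      - by rewrite /= !inE ne1 ne2 ne3 ne5 ne6 ne8.
      - move=> i; rewrite !inE => /or4P[] /eqP -> /=; rewrite ?L0 ?L1 ?L3 //.
        have -> : (k *: y, k *: x + r) = w2 + (0, r) by apply: pairP; rewrite /=; vring.
        have -> : b ^+ 2 = (a - b) ^+ 2 by rewrite ab; ring.
        rewrite linearD L2 L4 // (_ : b ^+ 2 = (a - b) ^+ 2) ?scalerDr //.
        by rewrite ab; ring.
      - move: hw; rewrite !big_cons big_nil; congr (_ \in U).
        by apply: pairP; rewrite /= ?Ep ?Er /j /k; apply/rowP => i; rewrite !mxE; field.
    apply: fin.
    - by apply: (hs (0, w0)); rewrite !inE eqxx.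
    - by apply: (hs ((a + b) ^+ 2, w1)); rewrite !inE eqxx ?orbT.
    - by apply: (hs (a ^+ 2, (p, 0))); rewrite !inE eqxx ?orbT.
    - by apply: (hs (b ^+ 2, (k *: y, k *: x + r))); rewrite !inE eqxx ?orbT.
    - by rewrite ab eqxx.
  pose s := [:: (0, w0); ((a + b) ^+ 2, w1); (a ^+ 2, (p, 0)); ((a - b) ^+ 2, w2); (b ^+ 2, (0, r))].
  have hs : forall i, i \in s -> i.2 \in U.
    apply: (@eigencomponents _ _ L) => //.
    - rewrite /= !inE ne1 ne2 ne3 ne4 ne5 ne6 ne7 ne8 ne9 /= andbT.
      rewrite -subr_eq0 subr_sqr (_ : _ * _ = (a - 2 * b) * a); last by ring.
      by rewrite mulf_eq0 subr_eq0 (negbTE ab) gt_eqF.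
    - move=> i; rewrite !inE => /orP[|/or4P[]] /eqP -> /=; rewrite ?L0 ?L1 ?L3 ?L2 ?L4 //.
    - move: hw; rewrite !big_cons big_nil; congr (_ \in U).
      by apply: pairP; rewrite /= ?Ep ?Er /j /k; apply/rowP => i; rewrite !mxE; field.
  have h4 : (0, r) \in U by apply: (hs (b ^+ 2, (0, r))); rewrite !inE eqxx ?orbT.
  have h2 : w2 \in U by apply: (hs ((a - b) ^+ 2, w2)); rewrite !inE eqxx ?orbT.
  have r0 := k4 _ h4 rx ry; have k0 := k2 _ h2.
  apply: fin => //.
  - by apply: (hs (0, w0)); rewrite !inE eqxx.
  - by apply: (hs ((a + b) ^+ 2, w1)); rewrite !inE eqxx ?orbT.
  - by apply: (hs (a ^+ 2, (p, 0))); rewrite !inE eqxx ?orbT.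
  - by rewrite r0 addr0.
have v0 : v != 0.
  apply: contraTneq isT => /(congr1 (fun u : V => dot u.1 u.1)) /=.
  by rewrite !dotE xx mulr1 => /eqP; rewrite mulf_eq0 orbb gt_eqF.
have onv (l n : R) : (l *: x, n *: y) \in U -> (l *: x, n *: y) = (l / a) *: v.
  move=> /line e; apply: pairP; rewrite /= scalerA; congr (_ *: _).
    by rewrite divfK ?gt_eqF.
  by rewrite mulrAC e mulfK ?gt_eqF.
have [[k [r [kr [rx ry] k0]]]|hn] := pselect (exists (k : R) r,
    [/\ (k *: y, k *: x + r) \in U, dot r x = 0 /\ dot r y = 0 & k != 0]); last first.
  left; exists v => //; apply/vspaceP => -[c d]; apply/idP/vlineP => [hw|[n ->]]; last exact: memvZ.
  have [l [n [k [r [Ec Ed h1 h2 [h3 h4 h5]]]]]] := dec _ _ hw.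
  have k0 : k = 0.
    by apply/eqP; apply: contra_notT hn => k0; exists k, r.
  have r0 : r = 0.
    by apply: k4 => //; move: h1; rewrite k0 !scale0r add0r.
  exists (l / a); rewrite -(onv l n) // Ec Ed k0 r0 !scale0r.
  by rewrite !addr0.
have [ab|ab] := ab2; last first.
  have [l [n [k' [r' [Ec Ed h1 h2 [h3 h4 /(_ ab)[k'0 r'0]]]]]]] := dec _ _ kr.
  have /eqP : dot (k *: y) y = dot (l *: x + k' *: y) y by rewrite -Ec.
  by rewrite k'0 !dotE xy yy mulr1 mulr0 mul0r addr0 (negbTE k0).
have hv' : (2 *: x, y) \in U.
  have := memvZ b^-1 hv; congr (_ \in U); apply: pairP; rewrite /= scalerA.
    by rewrite ab mulrCA mulVf ?mulr1 ?gt_eqF.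
  by rewrite mulVf ?scale1r ?gt_eqF.
have [t0 Et] : exists t0, t0 = k^-1 *: r by eexists.
have tx : dot t0 x = 0 by rewrite Et dotZl rx mulr0.
have ty : dot t0 y = 0 by rewrite Et dotZl ry mulr0.
have hw : (y, x + t0) \in U.
  have := memvZ k^-1 kr; congr (_ \in U); apply: pairP; rewrite /=.
    by rewrite scalerA mulVf ?scale1r.
  by rewrite scalerDr scalerA mulVf ?scale1r ?Et.
(* bracket v w w = (-2 x, (2 - |t0|^2) y) must be a multiple of (2 x, y). *)
have D3 : dot t0 t0 = 3.
  have h : (-2 *: x, (2 - dot t0 t0) *: y) \in U.
    have := hU _ _ _ hv' hw hw; congr (_ \in U).
    apply: pairP; rewrite /bracket /omega /= !dotE ?(dotC x t0) ?(dotC y t0) ?tx ?ty ?xx ?yy ?xy ?yx; vring.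
  move/line: h; rewrite ab => e.
  have : b * (dot t0 t0 - 3) = (-2 * b - (2 - dot t0 t0) * (2 * b)) / 2 by field.
  by rewrite e subrr mul0r => /eqP; rewrite mulf_eq0 gt_eqF //= subr_eq0 => /eqP.
have s3 : 0 < Num.sqrt 3 :> R by rewrite sqrtr_gt0 ltr0n.
have s33 : Num.sqrt 3 ^+ 2 = 3 :> R by rewrite sqr_sqrtr // ler0n.
have [t Ett] : exists t, t0 = Num.sqrt 3 *: t.
  by exists ((Num.sqrt 3)^-1 *: t0); rewrite scalerA mulfV ?scale1r ?gt_eqF.
do 6 right; left; exists x, y, t; split.
- split=> //; move: D3; rewrite Ett !dotE mulrA -expr2 s33 => e.
  by apply: (mulfI (x := 3)); rewrite ?pnatr_eq0 // e mulr1.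
- split=> //; rewrite dotC; move/eqP: tx ; move/eqP: ty; rewrite Ett !dotZl.
    by move=> _; rewrite mulf_eq0 gt_eqF //= => /eqP.
  by move=> + _; rewrite mulf_eq0 gt_eqF //= => /eqP.
apply/vspaceP => -[c d]; apply/idP/mem2P => [hcd|[l [n ->]]]; last first.
  by rewrite -Ett memvD ?memvZ.
have [l [n [k' [r' [Ec Ed h1 h2 [h3 h4 _]]]]]] := dec _ _ hcd.
have r'E : r' - k' *: t0 = 0.
  apply: k4; last 2 first.
  - by rewrite !dotE h3 tx; ring.
  - by rewrite !dotE h4 ty; ring.
  have := memvB h1 (memvZ k' hw); congr (_ \in U).
  by apply: pairP; rewrite /=; vring.
have r'E' : r' = k' *: t0 by apply/eqP; rewrite -subr_eq0 r'E.
have ln : l = 2 * n.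
  by apply: (mulIf (x := b)); rewrite ?gt_eqF // (line _ _ h2) ab; ring.
exists n, k'; apply: pairP; rewrite /= ?Ec ?Ed ?r'E' -?Ett ?ln; vring.
Qed.

End NormalForms.

(** * Complex bases *)

Section CBasis.
Context {R : rcfType} {vT : vectType R} (j : {linear vT -> vT}).
Implicit Types (U : {vspace vT}).

(** Complex combinations, with the coefficients split into real and imaginary parts. *)
Definition ccomb k (b : 'I_k -> vT) (a c : 'I_k -> R) : vT :=
  \sum_i (a i *: b i + c i *: j (b i)).

Definition cbasis U k (b : 'I_k -> vT) :=
  (forall u, u \in U <-> exists a c, u = ccomb b a c) /\
  (forall a c, ccomb b a c = 0 -> forall i, a i = 0 /\ c i = 0).

Lemma cbasis_dim U k (b : 'I_k -> vT) : cbasis U b -> \dim U = (2 * k)%N.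
Proof.
move=> [h1 h2].
pose f (u : 'rV[R]_k * 'rV[R]_k) : vT := ccomb b (u.1 0) (u.2 0).
have flin : linear f.
  move=> l u v; rewrite /f /ccomb scaler_sumr -big_split; apply: eq_bigr => i _ /=.
  by rewrite !mxE scalerDr !scalerA !scalerDl addrACA.
pose Lm := GRing.isLinear.Build R _ _ *:%R f flin.
pose L : {linear ('rV[R]_k * 'rV[R]_k)%type -> vT} := HB.pack f Lm.
have <- : (linfun L @: fullv)%VS = U.
  apply/vspaceP => u; apply/memv_imgP/idP => [[v _ ->]|/h1[a [c ->]]].
    by rewrite lfunE; apply/h1; exists (v.1 0), (v.2 0).
  exists (\row_i a i, \row_i c i); first exact: memvf.
  by rewrite lfunE; apply: eq_bigr => i _; rewrite !mxE.
rewrite limg_dim_eq ?dimV ?mul2n ?addnn //.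
apply/eqP; rewrite -subv0; apply/subvP => u.
rewrite memv_cap memv_ker lfunE memv0 => /andP[_ /eqP /h2 h].
by apply/eqP; apply: pairP; apply/rowP => i; have [e1 e2] := h i; rewrite /= mxE.
Qed.

Lemma rotate_out (l n : R) (v w s t : vT) :
  l *: (l *: v + n *: w + s) - n *: (l *: w - n *: v + t) =
  (l ^+ 2 + n ^+ 2) *: v + (l *: s - n *: t).
Proof.
rewrite !(scalerDr _ _ s) !(scalerDr _ _ t) opprD addrACA; congr (_ + _).
rewrite scalerDr scalerBr opprB !scalerA (mulrC n l) addrACA subrr addr0.
by rewrite -scalerDl !expr2.
Qed.

(** Extend an independent family one vector v at a time. If v is not in the
    j-invariant span U0, then neither is (l + n j) v for (l, n) <> 0, because
    l - n j takes it to (l^2 + n^2) v modulo U0. *)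
Lemma cbasis_exists U : (forall u, u \in U -> j u \in U /\ j (j u) = - u) ->
  exists k (b : 'I_k -> vT), cbasis U b.
Proof.
move=> hj.
suff gen n U0 k0 (b0 : 'I_k0 -> vT) : (U0 <= U)%VS ->
    (forall u, u \in U0 -> j u \in U0) -> cbasis U0 b0 ->
    (\dim U - \dim U0 <= n)%N -> exists k (b : 'I_k -> vT), cbasis U b.
  apply: (gen (\dim U) 0%VS 0%N (fun=> 0)) => //; last by rewrite leq_subr.
  - exact: sub0v.
  - by move=> u; rewrite !memv0 => /eqP ->; rewrite linear0.
  - split=> [u|a c _ []//]; rewrite memv0; split=> [/eqP ->|[a [c ->]]].
      by exists (fun=> 0), (fun=> 0); rewrite /ccomb big_ord0.
    by rewrite /ccomb big_ord0.
elim: n U0 k0 b0 => [|n IH] U0 k0 b0 sU jU0 cb.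
  rewrite leqn0 subn_eq0 => le; exists k0, b0.
  by have /eqP <- : U0 == U by rewrite eqEdim sU.
have [/eqP <- _|ne le] := boolP (U0 == U); first by exists k0, b0.
have /subvPn[v vU vU0] : ~~ (U <= U0)%VS.
  by apply: contra ne => h; rewrite eqEsubv sU.
have [Jimage jjv] := hj _ vU; case: (cb) => cb1 cb2.
pose b1 (i : 'I_k0.+1) := if unlift ord0 i is Some i' then b0 i' else v.
have combE a c : ccomb b1 a c =
    a ord0 *: v + c ord0 *: j v + ccomb b0 (a \o lift ord0) (c \o lift ord0).
  rewrite /ccomb big_ord_recl /b1 unlift_none; congr (_ + _).
  by apply: eq_bigr => i _; rewrite liftK.
pose ext l (a : 'I_k0 -> R) (i : 'I_k0.+1) := if unlift ord0 i is Some i' then a i' else l.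
have ext0 l a : ext l a ord0 = l by rewrite /ext unlift_none.
have extS l a i : ext l a (lift ord0 i) = a i by rewrite /ext liftK.
have U0j u : u \in U0 -> j (j u) = - u by move=> /(subvP sU)/hj[].
pose U1 := (U0 + (<[v]> + <[j v]>))%VS.
apply: (IH U1 k0.+1 b1).
- by rewrite !subv_add sU -!memvE vU Jimage.
- move=> _ /memv_addP[u hu [_ /mem2P[l [n' ->]] ->]].
  rewrite !linearD !linearZ /= jjv memv_add ?jU0 //.
  by rewrite addrC scalerN -scaleNr; apply/mem2P; exists (- n'), l.
- split.
    move=> u; split.
      move=> /memv_addP[_ /cb1[a [c ->]] [_ /mem2P[l [n' ->]] ->]].
      exists (ext l a), (ext n' c); rewrite combE !ext0 addrC; congr (_ + _).
      by apply: eq_bigr => i _; rewrite /= !extS.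
    move=> [a [c ->]]; rewrite combE addrC; apply: memv_add.
      by apply/cb1; eexists _, _.
    by apply/mem2P; exists (a ord0), (c ord0).
  move=> a c; rewrite combE.
  set l := a ord0; set n' := c ord0; set s := ccomb _ _ _ => e.
  have sU0 : s \in U0 by apply/cb1; eexists _, _.
  have N0 : l ^+ 2 + n' ^+ 2 = 0.
    apply/eqP; apply: contraNT vU0 => nz.
    rewrite -[v](scalerK nz) memvZ //.
    have := rotate_out l n' v (j v) s (j s).
    rewrite e scaler0 (_ : l *: j v - n' *: v + j s = 0) ?scaler0 ?subr0.
      by move=> /esym/eqP; rewrite addr_eq0 => /eqP ->; rewrite memvN memvB // memvZ ?jU0.
    have := congr1 j e; rewrite linear0 !(linearD, linearZ) /= jjv => <-.
    by rewrite scalerN.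
  have l0 : l = 0 by apply/eqP; rewrite -sqrf_eq0; move: (sqr_ge0 l) (sqr_ge0 n'); lra.
  have n0 : n' = 0 by apply/eqP; rewrite -sqrf_eq0; move: (sqr_ge0 l) (sqr_ge0 n'); lra.
  move=> i; case: (unliftP ord0 i) => [i' ->|->]; last by [].
  have := cb2 (a \o lift ord0) (c \o lift ord0); apply.
  by move: e; rewrite l0 n0 !scale0r !add0r.
have lt : (\dim U0 < \dim U1)%N.
  rewrite ltnNge; apply/negP => h; case/negP: vU0.
  have /eqP -> : U0 == U1 by rewrite eqEdim addvSl.
  by apply: (subvP (addvSr _ _)); apply: (subvP (addvSl _ _)); exact: memv_line.
have : (\dim U1 <= \dim U)%N by apply: dimvS; rewrite !subv_add sU -!memvE vU Jimage.
by lia.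
Qed.

End CBasis.

(** * The classification up to phases *)

Section Rotate.
Context {R : rcfType} {m : nat}.
Local Notation E := ('rV[R]_m).
Local Notation V := (E * E)%type.
Implicit Types (a b : R) (c d e f p q x y t : E) (u v w : V).
Implicit Types (U F : {vspace V}) (W : {vspace E}).

Lemma half_angle (X Y : R) : X ^+ 2 + Y ^+ 2 != 0 -> exists r s n : R,
  [/\ r ^+ 2 + s ^+ 2 = 1, 0 < n, (r ^+ 2 - s ^+ 2) * n = X & 2 * r * s * n = Y].
Proof.
move=> nz; pose n := Num.sqrt (X ^+ 2 + Y ^+ 2).
have N0 : 0 < X ^+ 2 + Y ^+ 2.
  by rewrite lt_def nz addr_ge0 ?sqr_ge0.
have n0 : 0 < n by rewrite sqrtr_gt0.
have nn : n ^+ 2 = X ^+ 2 + Y ^+ 2 by rewrite sqr_sqrtr // ltW.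
have := sqr_sqrtc ((X / n) +i* (Y / n))%C.
case: (sqrtc _) => r s; rewrite expr2 => -[e1 e2]; exists r, s, n.
have e3 : (r ^+ 2 - s ^+ 2) * n = X by rewrite !expr2 e1 divfK ?gt_eqF.
have e4 : 2 * r * s * n = Y.
  by rewrite -[RHS](divfK (lt0r_neq0 n0)) -e2; ring.
split=> //; apply/eqP; have p0 : 0 <= r ^+ 2 + s ^+ 2 by rewrite addr_ge0 ?sqr_ge0.
rewrite -(eqrXn2 (n := 2)) ?expr1n //.
apply/eqP; apply: (mulIf (x := n ^+ 2)); first by rewrite expf_neq0 ?gt_eqF.
by rewrite mul1r {2}nn -e3 -e4; ring.
Qed.

(** Divide a + i b by a square root of the phase of its bilinear square: the new
    square is a positive real number, that is, the parts are orthogonal and the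
    real one is longer. *)
Lemma rotate_axes v : ~ isotropic_pair v -> exists r s : R, r ^+ 2 + s ^+ 2 = 1 /\
  exists u, [/\ v = rot r s u, dot u.1 u.2 = 0 & dot u.2 u.2 < dot u.1 u.1].
Proof.
move=> hv; pose X := dot v.1 v.1 - dot v.2 v.2; pose Y := 2 * dot v.1 v.2.
have nz : X ^+ 2 + Y ^+ 2 != 0.
  apply: contra_not_neq hv => e.
  have X0 : X = 0 by apply/eqP; rewrite -sqrf_eq0; move: (sqr_ge0 X) (sqr_ge0 Y); lra.
  have Y0 : Y = 0 by apply/eqP; rewrite -sqrf_eq0; move: (sqr_ge0 X) (sqr_ge0 Y); lra.
  by split; [apply/eqP; rewrite -subr_eq0 -/X X0|move: Y0; rewrite /Y; lra].
have [r [s [n [h n0 hX hY]]]] := half_angle nz.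
exists r, s; split=> //; exists (rot r (- s) v); split.
- by rewrite rotK.
- have -> : dot (rot r (- s) v).1 (rot r (- s) v).2 =
    (- (2 * r * s) * X + (r ^+ 2 - s ^+ 2) * Y) / 2.
    by rewrite /= !dotE /X /Y (dotC v.2 v.1); field.
  by rewrite -hX -hY; field.
rewrite -subr_gt0.
have -> : dot (rot r (- s) v).1 (rot r (- s) v).1 - dot (rot r (- s) v).2 (rot r (- s) v).2
   = (r ^+ 2 - s ^+ 2) * X + (2 * r * s) * Y.
  by rewrite /= !dotE /X /Y (dotC v.2 v.1); ring.
have -> : (r ^+ 2 - s ^+ 2) * X + (2 * r * s) * Y = n * (r ^+ 2 + s ^+ 2) ^+ 2.
  by rewrite -hX -hY; ring.
by rewrite h expr1n mulr1.
Qed.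

Lemma isotropic_or_not U : model_isotropic U \/ exists2 v, v \in U & ~ isotropic_pair v.
Proof.
have [h|/existsNP[v /not_implyP[h1 h2]]] := pselect (model_isotropic U).
  by left.
by right; exists v.
Qed.

Lemma rot1 u : rot 1 0 u = u.
Proof. by apply: pairP => /=; vring. Qed.

Lemma rotate_space1 U : rotate_space 1 0 U = U.
Proof. by apply/vspaceP => u; rewrite mem_rotate_space rot1. Qed.

Lemma model_complex_even U : model_complex U -> exists k, \dim U = (2 * k)%N.
Proof.
move=> h; have [|k [b /(@cbasis_dim R (E * E)%type)]] := @cbasis_exists R (E * E)%type Jpair U; last by exists k.
by move=> u hu; split; [exact: h|exact: JpairK].
Qed.

Lemma normalize_axes U u : u \in U -> dot u.1 u.2 = 0 -> dot u.2 u.2 < dot u.1 u.1 ->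
  exists2 x, dot x x = 1 & (x, 0) \in U \/
    exists y a b, [/\ dot y y = 1, dot x y = 0, 0 < b, b < a & (a *: x, b *: y) \in U].
Proof.
case: u => p q /= hu pq lt.
have p0 : p != 0.
  by apply: contraTneq lt => ->; rewrite dot0l -leNgt dot_ge0.
have [a [x [a0 xx e1]]] := normalize_vector p0; exists x => //.
have [q0|q0] := eqVneq q 0.
  left; have := memvZ a^-1 hu; rewrite e1 q0; congr (_ \in U).
  by apply: pairP; rewrite /= ?scaler0 ?scalerK ?gt_eqF.
have [b [y [b0 yy e2]]] := normalize_vector q0; right; exists y, a, b; split=> //.
- move: pq; rewrite e1 e2 !dotE => /eqP.
  by rewrite !mulf_eq0 (gt_eqF a0) (gt_eqF b0) /= => /eqP.
- move: lt; rewrite e1 e2 !dotE xx yy !mulr1 -!expr2.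
  by rewrite ltr_pXn2r ?nnegrE ?ltW.
- by rewrite -e1 -e2.
Qed.

Lemma classify U : model_lts U -> U != 0%VS ->
  exists r s : R, r ^+ 2 + s ^+ 2 = 1 /\ normal_form (rotate_space r s U).
Proof.
move=> hU U0; have [hi|[v hv nv]] := isotropic_or_not U.
  exists 1, 0; split; first by rewrite expr1n expr0n addr0.
  rewrite rotate_space1; have d0 : (0 < \dim U)%N by rewrite lt0n dimv_eq0.
  have [h|h] := isotropic_lts_dichotomy hi hU.
    by do 8 right; exists (\dim U).
  do 7 right; left; have [k hk] := model_complex_even h.
  exists k => //; by lia.
have [r [s [h [u [ev e1 e2]]]]] := rotate_axes nv.
exists r, s; split=> //; have hU' := model_lts_rotate h hU.
have hu : u \in rotate_space r s U by rewrite mem_rotate_space -ev.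
have [x xx [hx|[y [a [b [yy xy b0 ba hxy]]]]]] := normalize_axes hu e1 e2.
  exact: classify_real_vector hx.
exact: classify_generic_vector hxy.
Qed.

(** The map x |-> (x.e)_e, where e runs through a basis of W, has a nonzero
    kernel on W' for dimension reasons. *)
Lemma exists_orth_in W W' : (\dim W < \dim W')%N ->
  exists x, [/\ dot x x = 1, x \in W' & forall y, y \in W -> dot x y = 0].
Proof.
move=> lt; pose f x : 'rV[R]_(\dim W) := \row_i dot x (vbasis W)`_i.
have flin : linear f.
  by move=> l c d; apply/rowP => i; rewrite !mxE !dotE.
pose Lm := GRing.isLinear.Build R _ _ *:%R f flin.
pose L : {linear E -> 'rV[R]_(\dim W)} := HB.pack f Lm.
pose K := (W' :&: lker (linfun L))%VS.
have K0 : K != 0%VS.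
  rewrite -dimv_eq0 -lt0n.
  have := limg_ker_dim (linfun L) W'; rewrite -/K.
  have : (\dim (linfun L @: W') <= \dim W)%N.
    by apply: leq_trans (dimvS (subvf _)) _; rewrite dimE.
  move=> h1 h2; rewrite -(ltn_add2r (\dim (linfun L @: W'))) add0n h2.
  exact: leq_ltn_trans h1 lt.
have vK : vpick K != 0 by rewrite vpick0.
have [k [x [k0 xx e]]] := normalize_vector vK.
have /memv_capP[xW' xK] : x \in K.
  by rewrite -[x](scalerK (lt0r_neq0 k0)) memvZ // -e memv_pick.
exists x; split=> // y yW; rewrite (coord_vbasis yW).
move: xK; rewrite memv_ker lfunE => /eqP/rowP xb.
have dsum (I : finType) (g : I -> R) (h : I -> E) :
    dot x (\sum_i g i *: h i) = \sum_i g i * dot x (h i).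
  apply: (big_rec2 (fun c l => dot x c = l)); first by rewrite dot0r.
  by move=> i c l _ e'; rewrite dotDr dotZr e'.
by rewrite dsum big1 // => i _; have := xb i; rewrite !mxE => ->; rewrite mulr0.
Qed.

Lemma exists_orth W : (\dim W < m)%N ->
  exists x, dot x x = 1 /\ forall y, y \in W -> dot x y = 0.
Proof.
move=> lt; have [|x [xx _ h]] := @exists_orth_in W fullv; first by rewrite dimE.
by exists x.
Qed.

Lemma isotropic_pair0 u : isotropic_pair u -> u.1 = 0 -> u = 0.
Proof.
move=> [e _] u1; apply: pairP => //=; apply/eqP.
by rewrite -dot_eq0 -e u1 dot0l.
Qed.

(** An isotropic vector is zero as soon as its real part is. *)
Lemma dim_iso_fst U : model_isotropic U -> \dim (linfun (@fst E E) @: U) = \dim U.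
Proof.
move=> hU; apply: limg_dim_eq; apply/eqP; rewrite -subv0; apply/subvP => u.
rewrite memv_cap memv_ker lfunE memv0 => /andP[/hU hu /eqP e].
by rewrite (isotropic_pair0 hu e).
Qed.

Lemma dim_iso U : model_isotropic U -> (\dim U <= m)%N.
Proof.
by move=> /dim_iso_fst <-; apply: leq_trans (dimvS (subvf _)) _; rewrite dimE.
Qed.

(** U is contained in the CQ-subspace that it generates. *)
Lemma model_complex_sub_prodv U (W := (linfun (@fst E E) @: U)%VS) :
  model_complex U -> (U <= prodv W W)%VS.
Proof.
move=> hU; apply/subvP => u hu; rewrite mem_prodv; apply/andP.
have h v : v \in U -> v.1 \in W by move=> /(memv_img (linfun (@fst E E))); rewrite lfunE.
by split; [exact: h|rewrite -memvN; exact: (h (Jpair u)) (hU _ hu)].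
Qed.

Definition Jimage U := (linfun Jpair @: U)%VS.

Lemma mem_Jimage U u : u \in U -> Jpair u \in Jimage U.
Proof. by move=> hu; apply/memv_imgP; exists u; rewrite ?lfunE. Qed.

Lemma JimageP U u : u \in Jimage U -> exists2 v, v \in U & u = Jpair v.
Proof. by move=> /memv_imgP[v hv ->]; rewrite lfunE; exists v. Qed.

Lemma dim_Jimage U : \dim (Jimage U) = \dim U.
Proof.
apply: limg_dim_eq; apply/eqP; rewrite -subv0; apply/subvP => u.
rewrite memv_cap memv_ker lfunE memv0 => /andP[_ /eqP e].
by rewrite -oppr_eq0 -JpairK e linear0.
Qed.

Lemma dim_treal_Jimage U : model_treal U -> \dim (U + Jimage U) = (2 * \dim U)%N.
Proof.
move=> h; rewrite dimv_disjoint_sum ?dim_Jimage ?mul2n ?addnn //.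
apply/eqP; rewrite -subv0; apply/subvP => w /memv_capP[hw /JimageP[v hv e]].
have := h _ _ hv hw; rewrite e /omega /= dotNr => e0; rewrite memv0.
have := dot_ge0 v.1; have := dot_ge0 v.2 => h2 h1.
have v1 : v.1 = 0 by apply/eqP; rewrite -dot_eq0; apply/eqP; lra.
have v2 : v.2 = 0 by apply/eqP; rewrite -dot_eq0; apply/eqP; lra.
by rewrite /Jpair v1 v2 oppr0.
Qed.

Lemma dim_treal U : model_treal U -> (\dim U <= m)%N.
Proof. by move=> /dim_treal_Jimage e; have := dimvS (subvf (U + Jimage U)%VS); rewrite e dimV; lia. Qed.

Lemma model_complex_Jimage U : model_complex (U + Jimage U)%VS.
Proof.
move=> _ /memv_addP[u hu [_ /JimageP[v hv ->] ->]].
by rewrite linearD /= JpairK addrC memv_add ?memvN ?mem_Jimage.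
Qed.

Lemma model_isotropic_Jimage U : model_isotropic U -> model_isotropic (U + Jimage U)%VS.
Proof.
move=> h _ /memv_addP[u hu [_ /JimageP[v hv ->] ->]].
have [e1 e2] := isotropic_polarization h hu hv; have [e3 e4] := h _ hu; have [e5 e6] := h _ hv.
by split; rewrite /= !dotE ?(dotC v.2 u.1) ?(dotC v.1 u.2) ?(dotC v.2 u.2) ?(dotC v.2 v.1) ?e4 ?e6; lra.
Qed.

(** U + J U is isotropic and a direct sum. *)
Lemma dim_iso_treal U : model_isotropic U -> model_treal U -> (2 * \dim U <= m)%N.
Proof. by move=> h1 h2; rewrite -(dim_treal_Jimage h2) dim_iso //; exact: model_isotropic_Jimage. Qed.

End Rotate.

(** * Commuting subspaces and ranks *)

Section Flats.
Context {R : rcfType} {m : nat}.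
Local Notation E := ('rV[R]_m).
Local Notation V := (E * E)%type.
Implicit Types (a b : R) (c d e f p q x y t : E) (u v w : V).
Implicit Types (U F : {vspace V}) (W : {vspace E}).

Lemma line_dep (v w : V) (a b c d : R) : a * d = b * c ->
  a *: v + b *: w != 0 -> c *: v + d *: w \in <[a *: v + b *: w]>%VS.
Proof.
move=> e nz; apply/vlineP; have [a0|a0] := eqVneq a 0.
  have b0 : b != 0 by apply: contraNneq nz => ->; rewrite a0 !scale0r addr0.
  have c0 : c = 0 by move/esym/eqP: e; rewrite a0 mul0r mulf_eq0 (negbTE b0) => /eqP.
  by exists (d / b); rewrite a0 c0 !scale0r !add0r scalerA divfK.
exists (c / a); rewrite scalerDr !scalerA divfK //; congr (_ + _ *: _).
by apply: (mulfI a0); rewrite e; field.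
Qed.

(** If u and v commute, then bracket u v u = 0 reads |u|^2 v = (v.u) u up to a
    positive factor. *)
Lemma flat_iso F : model_isotropic F -> model_flat F -> (\dim F <= 1)%N.
Proof.
move=> hi hF; apply: dim_le1 => u v hu hv u0.
have [hT hom] := hF _ _ hu hv; have := hT u; rewrite (bracket_isotropic hi hu hv hu).
have [e1 e2] := hi _ hu; have [e3 e4] := isotropic_polarization hi hu hv.
have -> : dot v.2 u.1 = 0 by move: hom; rewrite /omega e4 (dotC v.2); lra.
rewrite hom (dotC u.2) e2 !scale0r !addr0 subr0 => /eqP; rewrite subr_eq0 => /eqP e.
have nz : dot u.1 u.1 != 0.
  by apply: contraNneq u0 => h; apply/eqP; apply: isotropic_pair0 (hi _ hu) _; apply/eqP; rewrite -dot_eq0 h.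
apply/vlineP; exists (dot v.1 u.1 / dot u.1 u.1).
by apply: (can_inj (scalerK nz)); rewrite e scalerA mulrCA mulfV ?mulr1.
Qed.

Lemma flat_real F W : (F <= prodv W 0)%VS -> model_flat F -> (\dim F <= 1)%N.
Proof.
move=> /subvP sF hF; apply: dim_le1 => u v hu hv u0.
move: (sF _ hu) (sF _ hv) (hF _ _ hu hv).1 u0 => {hu hv}.
case: u v => a a' [c c']; rewrite !mem_prodv /= !memv0.
move=> /andP[_ /eqP->] /andP[_ /eqP->] /(_ (a, 0)) /(congr1 fst).
rewrite /bracket /omega /= !dotE => E1 u0.
have /eqP : dot a a *: c - dot c a *: a = 0 by rewrite -[RHS]E1; vring.
rewrite subr_eq0 => /eqP e.
have nz : dot a a != 0.
  by apply: contraNneq u0 => h; apply/eqP; apply: pairP => //=; apply/eqP; rewrite -dot_eq0 h.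
apply/vlineP; exists (dot c a / dot a a); apply: pairP => /=; rewrite ?scaler0 //.
by apply: (can_inj (scalerK nz)); rewrite e scalerA mulrCA mulfV ?mulr1.
Qed.

Lemma flat_P2 F x : dot x x = 1 -> (F <= prodv <[x]> <[x]>)%VS -> model_flat F ->
  (\dim F <= 1)%N.
Proof.
move=> xx /subvP sF hF; apply: dim_le1 => u v hu hv.
move: (sF _ hu) (sF _ hv) (hF _ _ hu hv).2 => {hu hv}.
case: u v => a a' [c c']; rewrite !mem_prodv /=.
move=> /andP[/vlineP[k ->] /vlineP[l ->]] /andP[/vlineP[k' ->] /vlineP[l' ->]].
rewrite /omega /= !dotE xx !mulr1 => /eqP; rewrite subr_eq0 => /eqP e.
have eq2 (p q : R) : (p *: x, q *: x) = p *: (x, 0) + q *: (0, x).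
  by apply: pairP => /=; vring.
by rewrite !eq2; exact: line_dep.
Qed.

Lemma flat_A F x y t : dot x x = 1 -> dot y y = 1 -> dot x y = 0 -> dot x t = 0 ->
  dot y t = 0 -> (F <= space_A x y t)%VS -> model_flat F -> (\dim F <= 1)%N.
Proof.
move=> xx yy xy xt yt /subvP sF hF; apply: dim_le1 => u v hu hv.
have yx : dot y x = 0 by rewrite dotC.
have ty : dot t y = 0 by rewrite dotC.
have tx : dot t x = 0 by rewrite dotC.
move: (sF _ hu) (sF _ hv) (hF _ _ hu hv).2 => {hu hv}.
move=> /mem2P[a [b ->]] /mem2P[c [d ->]].
rewrite /omega /= !dotE ?xx ?yy ?xy ?yx ?yt ?ty ?xt ?tx => h.
by apply: line_dep; apply/eqP; rewrite -subr_eq0; apply/eqP; rewrite -[RHS]h; ring.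
Qed.

(** A commuting subspace F that is not isotropic contains, up to a phase, some
    (x, 0) or some (a x, b y) with a > b > 0. In the second case the kernel of
    the Jacobi operator is the plane of (x, 0) and (0, y). In the first case it
    consists of the (k x, d) with d orthogonal to x, and such vectors commute
    only if their components d are proportional. *)
Lemma flat_le2 F : model_flat F -> (\dim F <= 2)%N.
Proof.
move=> hF; have [hi|[v hv nv]] := isotropic_or_not F.
  by apply: leq_trans (flat_iso hi hF) _.
have [r [s [h [u [ev e1 e2]]]]] := rotate_axes nv.
rewrite -(dim_rotate_space F h); have := model_flat_rotate h hF.
have : u \in rotate_space r s F by rewrite mem_rotate_space -ev.
move: (rotate_space r s F) => {h ev hv nv hF v}F hu hF.
have [x xx [hx|[y [a [b [yy xy b0 ba hxy]]]]]] := normalize_axes hu e1 e2.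
  have key c d : (c, d) \in F -> c = dot c x *: x /\ dot d x = 0.
    move=> hw; have [/(_ (x, 0)) + _] := hF _ _ hx hw.
    rewrite /bracket /omega /= !dotE xx => -[E1 E2]; split.
      apply/eqP; rewrite -subr_eq0 -[X in _ == X]E1; apply/eqP; vring.
    have /(congr1 (dot x)) := E2; rewrite !dotE xx !(dotC x) ?dot0l; lra.
  have [h|/existsNP[c0 /existsNP[d0 /not_implyP[hw /eqP hn']]]] :=
      pselect (forall c d, (c, d) \in F -> d = 0).
    apply: (@dim_le2 _ _ _ (x, 0) 0); apply/subvP => -[c d] hw; apply/mem2P.
    have [e _] := key _ _ hw; exists (dot c x), 0; rewrite (h _ _ hw) {1}e.
    by apply: pairP; rewrite /=; vring.
  apply: (@dim_le2 _ _ _ (x, 0) (0, d0)); apply/subvP => -[c d] hc; apply/mem2P.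
  have red c' d' : (c', d') \in F -> (0, d') \in F.
    move=> h; have [e _] := key _ _ h.
    have := memvB h (memvZ (dot c' x) hx); congr (_ \in F).
    by apply: pairP; rewrite /= -?e ?subrr // scaler0 subr0.
  have [/(_ (0, d0)) + _] := hF _ _ (red _ _ hw) (red _ _ hc).
  rewrite /bracket /omega /= !dotE => -[_ E2].
  have nz : dot d0 d0 != 0 by rewrite dot_eq0.
  have e : dot d0 d0 *: d - dot d d0 *: d0 = 0 by rewrite -[RHS]E2; vring.
  move/eqP: e; rewrite subr_eq0 => /eqP e.
  have [ec _] := key _ _ hc; exists (dot c x), (dot d d0 / dot d0 d0).
  apply: pairP => /=; rewrite ?scaler0 ?addr0 ?add0r //.
  by apply: (can_inj (scalerK nz)); rewrite e scalerA mulrCA mulfV ?mulr1.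
have yx : dot y x = 0 by rewrite dotC.
apply: (@dim_le2 _ _ _ (x, 0) (0, y)); apply/subvP => -[c d] hw; apply/mem2P.
have [/(_ (a *: x, b *: y)) + _] := hF _ _ hxy hw.
rewrite /bracket /omega /= !dotE xx yy xy yx => -[E1 E2].
have := congr1 (dot y) E1; rewrite !dotE yy yx !(dotC y) !(dotC x) ?dot0l => Ey.
have := congr1 (dot x) E2; rewrite !dotE xx xy !(dotC y) !(dotC x) ?dot0l => Ex.
have a0 : 0 < a by apply: lt_trans ba.
(* On the root vectors the Jacobi operator has determinant (a^2 - b^2)^2. *)
have [k0 l0] : dot c y = 0 /\ dot d x = 0.
  have D : (a ^+ 2 - b ^+ 2) ^+ 2 != 0.
    rewrite expf_neq0 // subr_sqr mulf_neq0 //.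
      by apply: lt0r_neq0; rewrite subr_gt0.
    by apply: lt0r_neq0; exact: addr_gt0.
  have Ey' : (a ^+ 2 + b ^+ 2) * dot c y - 2 * a * b * dot d x = 0.
    by rewrite -[RHS]Ey; ring.
  have Ex' : (a ^+ 2 + b ^+ 2) * dot d x - 2 * a * b * dot c y = 0.
    by rewrite -[RHS]Ex; ring.
  split; apply: (mulfI D); rewrite mulr0.
    transitivity ((a ^+ 2 + b ^+ 2) * ((a ^+ 2 + b ^+ 2) * dot c y - 2 * a * b * dot d x)
      + 2 * a * b * ((a ^+ 2 + b ^+ 2) * dot d x - 2 * a * b * dot c y)); first by ring.
    by rewrite Ex' Ey' !mulr0 addr0.
  transitivity ((a ^+ 2 + b ^+ 2) * ((a ^+ 2 + b ^+ 2) * dot d x - 2 * a * b * dot c y)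
    + 2 * a * b * ((a ^+ 2 + b ^+ 2) * dot c y - 2 * a * b * dot d x)); first by ring.
  by rewrite Ex' Ey' !mulr0 addr0.
exists (dot c x), (dot d y); apply: pairP => /=.
  apply: (can_inj (scalerK (lt0r_neq0 (mulr_gt0 a0 a0)))).
  apply/eqP; rewrite -subr_eq0 -[X in _ == X]E1 ?(dotC y) ?(dotC x) k0 l0; apply/eqP; vring.
apply: (can_inj (scalerK (lt0r_neq0 (mulr_gt0 b0 b0)))).
apply/eqP; rewrite -subr_eq0 -[X in _ == X]E2 ?(dotC y) ?(dotC x) k0 l0; apply/eqP; vring.
Qed.

Lemma flat_line u : model_flat <[u]>.
Proof.
move=> _ _ /vlineP[k ->] /vlineP[l ->]; have e : omega (k *: u) (l *: u) = 0.
  by rewrite /omega /= !dotE (dotC u.2); ring.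
by split=> // w; rewrite /bracket e /=; apply: pairP => /=; rewrite !dotE; vring.
Qed.

Lemma model_rank1 U : U != 0%VS ->
  (forall F, (F <= U)%VS -> model_flat F -> (\dim F <= 1)%N) -> model_rank U 1.
Proof.
move=> U0 h; split=> //; exists <[vpick U]>%VS; split; last by rewrite dim_vline vpick0 U0.
  by rewrite -memvE memv_pick.
exact: flat_line.
Qed.

Lemma model_rank2 U x y : dot x x = 1 -> dot y y = 1 -> dot x y = 0 ->
  (x, 0) \in U -> (0, y) \in U -> model_rank U 2.
Proof.
move=> xx yy xy hx hy; split; last by move=> F _; exact: flat_le2.
have yx : dot y x = 0 by rewrite dotC.
have nz (z : E) : dot z z = 1 -> z != 0.
  by move=> zz; rewrite -dot_eq0 zz oner_eq0.
exists (<[(x, 0%R)]> + <[(0%R, y)]>)%VS; split.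
- by rewrite subv_add -!memvE hx.
- move=> _ _ /mem2P[k [l ->]] /mem2P[k' [l' ->]]; split; last first.
    by rewrite /omega /= !dotE ?xx ?yy ?xy ?yx; ring.
  by move=> w; rewrite /bracket /omega /=; apply: pairP => /=; rewrite !dotE ?xx ?yy ?xy ?yx; vring.
- have x0 : ((x, 0) : V) != 0 by apply: contra_neq (nz _ xx) => /(congr1 fst).
  rewrite dim_add_line ?dim_vline ?x0 //; apply/vlineP => -[k e].
  have /eqP := congr1 fst e; rewrite eq_sym scaler_eq0 (negbTE (nz _ xx)) orbF => /eqP k0.
  have /eqP := congr1 snd e; rewrite k0 scale0r; exact/negP/nz.
Qed.

End Flats.

(** * Dimension, rank and maximality of the normal forms *)

Section Props.
Context {R : rcfType} {m : nat}.
Hypothesis hm : (2 <= m)%N.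
Local Notation E := ('rV[R]_m).
Local Notation V := (E * E)%type.
Implicit Types (a b : R) (c d e f p q x y t : E) (u v w : V).
Implicit Types (U F : {vspace V}) (W : {vspace E}).

Lemma unit_neq0 x : dot x x = 1 -> x != 0.
Proof. by move=> xx; rewrite -dot_eq0 xx oner_eq0. Qed.

Lemma dim_unit x : dot x x = 1 -> \dim <[x]> = 1%N.
Proof. by move=> /unit_neq0 x0; rewrite dim_vline x0. Qed.

Lemma notin_orth W x : dot x x = 1 -> (forall y, y \in W -> dot x y = 0) -> x \notin W.
Proof.
by move=> xx h; apply/negP => /h; rewrite xx => /eqP; rewrite oner_eq0.
Qed.

Lemma dim_unit2 x y : dot x x = 1 -> dot y y = 1 -> dot x y = 0 ->
  \dim (<[x]> + <[y]>) = 2%N.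
Proof.
move=> xx yy xy; rewrite dim_add_line ?dim_unit // notin_orth // => _ /vlineP[k ->].
by rewrite dotZr dotC xy mulr0.
Qed.

Lemma dim_unit3 x y t : dot x x = 1 -> dot y y = 1 -> dot t t = 1 ->
  dot x y = 0 -> dot x t = 0 -> dot y t = 0 -> \dim (<[x]> + <[y]> + <[t]>) = 3%N.
Proof.
move=> xx yy tt xy xt yt; rewrite dim_add_line ?dim_unit2 // notin_orth //.
by move=> _ /mem2P[k [l ->]]; rewrite !dotE !(dotC t) xt yt !mulr0 addr0.
Qed.

Lemma dim_W W : (\dim W <= m)%N.
Proof. by have := dimvS (subvf W); rewrite dimE. Qed.

Lemma dim_full W : (m <= \dim W)%N -> W = fullv.
Proof. by move=> h; apply/eqP; rewrite eqEdim subvf dimE. Qed.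

Lemma dim_fullV U : (m + m <= \dim U)%N -> U = fullv.
Proof. by move=> h; apply/eqP; rewrite eqEdim subvf dimV. Qed.

Lemma dim_lt_full U : (U != fullv) = (\dim U < m + m)%N.
Proof.
apply/idP/idP => [h|]; first by rewrite ltnNge; apply: contra h => /dim_fullV ->.
by apply: contraTneq => ->; rewrite dimV ltnn.
Qed.

(** For m = 2 this equation says that [space_G3] is the hyperplane orthogonal to (y, -x). *)
Lemma mem_space_G3 x y u : dot x x = 1 -> dot y y = 1 -> dot x y = 0 ->
  u \in space_G3 x y -> dot u.1 y = dot u.2 x.
Proof.
move=> xx yy xy /mem3P[k [l [n ->]]] /=.
by rewrite !dotE xx yy xy (dotC y x) xy; ring.
Qed.

Lemma dim_axes x y : dot x x = 1 -> dot y y = 1 ->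
  \dim (<[(x, 0) : V]> + <[(0, y) : V]>) = 2%N.
Proof.
move=> xx yy; have x0 : ((x, 0) : V) != 0.
  by apply: contra_neq (unit_neq0 xx) => /(congr1 fst).
rewrite dim_add_line ?dim_vline ?x0 //; apply/vlineP => -[k e].
have /eqP := congr1 fst e.
rewrite eq_sym scaler_eq0 (negbTE (unit_neq0 xx)) orbF => /eqP k0.
have /eqP := congr1 snd e; rewrite k0 scale0r; exact/negP/unit_neq0.
Qed.

Lemma dim_space_G3 x y : dot x x = 1 -> dot y y = 1 -> dot x y = 0 -> \dim (space_G3 x y) = 3%N.
Proof.
move=> xx yy xy; rewrite /space_G3 dim_add_line ?dim_axes //.
apply/mem2P => -[k [l e]]; have /= := congr1 fst e; rewrite scaler0 addr0 => ye.
by move: yy; rewrite {1}ye dotZl xy mulr0 => /eqP; rewrite eq_sym oner_eq0.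
Qed.

Lemma space_G3_sub x y : (space_G3 x y <= prodv (<[x]> + <[y]>) (<[x]> + <[y]>))%VS.
Proof.
apply/subvP => _ /mem3P[k [l [n ->]]]; rewrite mem_prodv /=; apply/andP; split; apply/mem2P.
  by exists k, n; vring.
by exists n, l; vring.
Qed.

Lemma dim_space_A x y t : dot x x = 1 -> dot y y = 1 -> dot x y = 0 -> \dim (space_A x y t) = 2%N.
Proof.
move=> xx yy xy; have v0 : ((2 *: x, y) : V) != 0.
  by apply: contra_neq (unit_neq0 yy) => /(congr1 snd).
rewrite /space_A dim_add_line ?dim_vline ?v0 //; apply/vlineP => -[k e].
have /= ye := congr1 fst e; move: yy; rewrite {1}ye !dotE xy !mulr0 => /eqP.
by rewrite eq_sym oner_eq0.
Qed.

Lemma space_A_sub x y t : (space_A x y t <= prodv (<[x]> + <[y]> + <[t]>) (<[x]> + <[y]> + <[t]>))%VS.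
Proof.
apply/subvP => _ /mem2P[k [l ->]]; rewrite mem_prodv /=; apply/andP; split; apply/mem3P.
  by exists (2 * k), l, 0; vring.
by exists l, k, (l * Num.sqrt 3); vring.
Qed.

Lemma treal_prodv W1 W2 : orthv W1 W2 -> model_treal (prodv W1 W2).
Proof.
move=> o [a b] [c d]; rewrite !mem_prodv /omega /= => /andP[ha hb] /andP[hc hd].
by rewrite (o a d) // dotC (o c b) // subrr.
Qed.

Lemma rotate_space_prodv (r s : R) U W : r ^+ 2 + s ^+ 2 = 1 ->
  (rotate_space r s U <= prodv W W)%VS -> (U <= prodv W W)%VS.
Proof.
move=> h /subvP sU; apply/subvP => u hu; rewrite -(rotK u h).
have : rot r (- s) u \in prodv W W by apply: sU; rewrite mem_rotate_space rotK.
by rewrite !mem_prodv /= => /andP[h1 h2]; rewrite rpredB ?rpredD ?rpredZ.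
Qed.

Lemma rotate_spaceS (r s : R) U U' : (U <= U')%VS -> (rotate_space r s U <= rotate_space r s U')%VS.
Proof. by move=> /subvP h; apply/subvP => u; rewrite !mem_rotate_space; exact: h. Qed.

(** The first alternative covers the type G1 and, for m > 2, the type G3, whose
    CQ-span has complex dimension 2. All alternatives except the last are
    invariant under phases. In the second alternative the dimension bound holds because U and J U
    are orthogonal, respectively because the real part is injective on U. *)
Lemma coarse_classification U : model_lts U -> U != fullv ->
  [\/ exists W, (\dim W < m)%N /\ (U <= prodv W W)%VS,
      (\dim U <= m)%N /\ (model_treal U \/ model_isotropic U), (\dim U <= 2)%N |
      m = 2%N /\ exists r s : R, r ^+ 2 + s ^+ 2 = 1 /\ model_G3 (rotate_space r s U)].
Proof.
move=> hU Uf; have [->|U0] := eqVneq U 0%VS; first by apply: Or43; rewrite dimv0.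
have [r [s [h hn]]] := classify hU U0.
have h' : r ^+ 2 + (- s) ^+ 2 = 1 by rewrite sqrrN.
have real : model_treal (rotate_space r s U) -> (\dim U <= m)%N /\ (model_treal U \/ model_isotropic U).
  move=> /(model_treal_rotate h'); rewrite rotate_spaceK // => ht.
  by split; [exact: dim_treal|left].
have isot : model_isotropic (rotate_space r s U) -> (\dim U <= m)%N /\ (model_treal U \/ model_isotropic U).
  move=> /(model_isotropic_rotate h'); rewrite rotate_spaceK // => ht.
  by split; [exact: dim_iso|right].
case: hn => [[v v0 e]|].
  by apply: Or43; rewrite -(dim_rotate_space U h) e dim_vline v0.
case=> [[k k2 [W dW e]]|].
  apply: Or41; exists W; split; last by apply: (rotate_space_prodv h); rewrite e.
  rewrite ltnNge; apply: contra Uf => /dim_full W1.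
  by rewrite -(rotate_spaceK U h) e W1 prodv_full rotate_space_full.
case=> [[k1 [k2 [_ _ [W1 [W2 [_ _ o e]]]]]]|].
  by apply: Or42; apply: real; rewrite e; exact: treal_prodv.
case=> [[x [y [xx yy xy e]]]|].
  have [m2|m3] : m = 2%N \/ (2 < m)%N by lia.
    by apply: Or44; split=> //; exists r, s; split=> //; exists x, y.
  apply: Or41; exists (<[x]> + <[y]>)%VS; rewrite dim_unit2 //; split=> //.
  by apply: (rotate_space_prodv h); rewrite e; exact: space_G3_sub.
case=> [[k _ [W _ e]]|].
  by apply: Or42; apply: real; rewrite e; exact/treal_prodv/orthv0.
case=> [[x xx e]|].
  by apply: Or43; rewrite -(dim_rotate_space U h) e dim_prodv !dim_unit.
case=> [[x [y [t [[xx yy tt] [xy xt yt] e]]]]|].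
  by apply: Or43; rewrite -(dim_rotate_space U h) e dim_space_A.
by case=> -[k _ []] _ h1 _; apply: Or42; exact: isot.
Qed.

Lemma model_maximalI U : model_lts U -> U != fullv ->
  (forall U', model_lts U' -> (U <= U')%VS -> (\dim U < \dim U')%N -> U' != fullv -> False) ->
  model_maximal U.
Proof.
move=> h1 h2 h3; split=> // U' h4 h5.
have [->|ne] := eqVneq U' fullv; first by right.
left; apply/eqP; rewrite eq_sym eqEdim h5 leqNgt; apply/negP => h6.
exact: h3 h4 h5 h6 ne.
Qed.

Lemma not_model_maximal U U' : model_lts U' -> (U <= U')%VS -> (\dim U < \dim U')%N ->
  (\dim U' < m + m)%N -> ~ model_maximal U.
Proof.
move=> h1 h2 h3 h4 [_ _ /(_ _ h1 h2)[e|e]].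
  by move: h3; rewrite e ltnn.
by move: h4; rewrite e dimV ltnn.
Qed.

Lemma treal_line v : model_treal <[v]>.
Proof.
move=> _ _ /vlineP[k ->] /vlineP[l ->].
by rewrite /omega /= !dotE (dotC v.2); ring.
Qed.

Lemma isotropic_pairZ k v : isotropic_pair v -> isotropic_pair (k *: v).
Proof. by move=> [e1 e2]; split; rewrite /= !dotE ?e1 ?e2 ?mulr0. Qed.

(** An isotropic v lies on the complex line C v; any other v lies in a flat. *)
Lemma not_model_maximal_line v : v != 0 -> ~ model_maximal <[v]>.
Proof.
move=> v0; have d1 : \dim <[v]> = 1%N by rewrite dim_vline v0.
have [hi|hn] := pselect (isotropic_pair v).
  have i1 : model_isotropic <[v]> by move=> _ /vlineP[k ->]; exact: isotropic_pairZ.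
  have d2 : \dim (<[v]> + Jimage <[v]>) = 2%N by rewrite (dim_treal_Jimage (@treal_line v)) d1.
  apply: (@not_model_maximal _ (<[v]> + Jimage <[v]>)%VS); rewrite ?addvSl ?d2 ?d1 //.
    by apply: isotropic_complex_lts; [exact: model_isotropic_Jimage|exact: model_complex_Jimage].
  by lia.
have [r [s [h [u [ev e1 e2]]]]] := rotate_axes hn.
have h' : r ^+ 2 + (- s) ^+ 2 = 1 by rewrite sqrrN.
have hu : u \in rotate_space r s <[v]> by rewrite mem_rotate_space -ev memv_line.
have fin x y : dot x x = 1 -> dot y y = 1 -> dot x y = 0 ->
    (exists2 w, w \in rotate_space r s <[v]> & (w != 0) && (w \in prodv <[x]> <[y]>)) ->
    ~ model_maximal <[v]>.
  move=> xx yy xy [w hw /andP[w0 wp]].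
  have e : rotate_space r s <[v]> = <[w]>%VS.
    by apply/esym/eqP; rewrite eqEdim -memvE hw dim_rotate_space // d1 dim_vline w0.
  apply: (@not_model_maximal _ (rotate_space r (- s) (prodv <[x]> <[y]>))).
  - apply: model_lts_rotate => //; apply: model_lts_prodv_orth => _ _ /vlineP[k ->] /vlineP[l ->].
    by rewrite !dotE xy !mulr0.
  - by rewrite -{1}(rotate_spaceK <[v]> h) rotate_spaceS // e -memvE.
  - by rewrite dim_rotate_space // dim_prodv !dim_unit // d1.
  - by rewrite dim_rotate_space // dim_prodv !dim_unit //; lia.
have [x xx [hx|[y [a [b [yy xy b0 ba hxy]]]]]] := normalize_axes hu e1 e2.
  have [|y [yy hy]] := @exists_orth _ _ (<[x]> : {vspace E}).
    by rewrite dim_unit //; lia.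
  apply: (fin x y) => //; first by rewrite dotC hy ?memv_line.
  exists (x, 0); rewrite // mem_prodv memv_line mem0v !andbT.
  by apply: contra_neq (unit_neq0 xx) => /(congr1 fst).
apply: (fin x y) => //; exists (a *: x, b *: y) => //.
rewrite mem_prodv /= !memvZ ?memv_line // !andbT.
apply: contra_neq (unit_neq0 yy) => /(congr1 snd) /= /eqP.
by rewrite scaler_eq0 gt_eqF //= => /eqP.
Qed.

Lemma prop_Geo U : model_Geo U ->
  [/\ model_lts U, \dim U = 1%N, model_treal U, model_rank U 1 & ~ model_maximal U].
Proof.
move=> [v v0 ->]; have d1 : \dim <[v]> = 1%N by rewrite dim_vline v0.
split=> //; [exact: model_lts_line|exact: treal_line| |exact: not_model_maximal_line].
apply: model_rank1; first by rewrite -dimv_eq0 d1.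
by move=> F /dimvS; rewrite d1.
Qed.

(** A subspace W of dimension less than m - 1 can be enlarged inside R^m. For
    dim W = m - 1, a larger proper subspace has dimension above 2 (m - 1) >= m,
    so would have to be contained in W' x W' with dim W' < m. *)
Lemma prop_G1 k U : (2 <= k <= m - 1)%N -> model_G1 k U ->
  [/\ model_lts U, \dim U = (2 * k)%N, model_complex U, model_rank U 2 &
      model_maximal U <-> k = (m - 1)%N /\ (2 <= m - 1)%N].
Proof.
move=> hk [W dW ->]; have dU : \dim (prodv W W) = (2 * k)%N.
  by rewrite dim_prodv dW mul2n addnn.
have hl : model_lts (prodv W W) by exact: model_lts_prodv.
split=> //.
- by move=> u; rewrite !mem_prodv /= memvN andbC.
- have [|x [xx hx _]] := @exists_orth_in _ _ 0%VS W; first by rewrite dimv0 dW; lia.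
  have [|y [yy hy xy]] := @exists_orth_in _ _ (<[x]>)%VS W.
    by rewrite dW dim_unit //; lia.
  apply: (model_rank2 xx yy); rewrite ?mem_prodv ?mem0v ?hx ?hy //.
  by rewrite dotC xy ?memv_line.
- split=> [hmax|[k1 m2]].
    have [//|lt] : (k = m - 1 /\ 2 <= m - 1)%N \/ (k < m - 1)%N by lia.
    have [|x [xx hx]] := @exists_orth _ _ W; first by rewrite dW; lia.
    have d1 : \dim (W + <[x]>) = k.+1 by rewrite dim_add_line ?dW // notin_orth.
    case: (@not_model_maximal _ (prodv (W + <[x]>) (W + <[x]>)) _ _ _ _ hmax).
    + exact: model_lts_prodv.
    + by rewrite prodvS ?addvSl.
    + by rewrite !dim_prodv dW d1; lia.
    + by rewrite !dim_prodv d1; lia.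
  apply: model_maximalI => //; first by rewrite dim_lt_full dU; lia.
  move=> U' h1 h2 h3 h4; move: h3; rewrite dU k1 => h3.
  have [[W' [h5 /dimvS]]|[h _]|h|[h _]] := coarse_classification h1 h4; rewrite ?dim_prodv; lia.
Qed.

(** For k1 + k2 < m one factor can be enlarged. For k1 = k2 = 1 and m = 2, U is
    contained in the type G3 for the same x and y. For k1 + k2 = m >= 3, a
    larger proper subspace would be contained in some W' x W', and W' would
    contain W1 + W2 = R^m. *)
Lemma prop_G2 k1 k2 U : (1 <= k1)%N -> (1 <= k2)%N -> (k1 + k2 <= m)%N -> model_G2 k1 k2 U ->
  [/\ model_lts U, \dim U = (k1 + k2)%N, model_treal U, model_rank U 2 &
      model_maximal U <-> (k1 + k2)%N = m /\ (3 <= m)%N].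
Proof.
move=> k1p k2p kk [W1 [W2 [d1 d2 o ->]]].
have dU : \dim (prodv W1 W2) = (k1 + k2)%N by rewrite dim_prodv d1 d2.
have hl := model_lts_prodv_orth o.
have [|x [xx hx _]] := @exists_orth_in _ _ 0%VS W1; first by rewrite dimv0 d1.
have [|y [yy hy _]] := @exists_orth_in _ _ 0%VS W2; first by rewrite dimv0 d2.
have xy : dot x y = 0 by exact: o.
split=> //; first exact: treal_prodv.
  by apply: (model_rank2 xx yy xy); rewrite mem_prodv ?mem0v ?hx ?hy.
have i0 : (W1 :&: W2 = 0)%VS.
  apply/eqP; rewrite -subv0; apply/subvP => w /memv_capP[h1 h2].
  by rewrite memv0 -dot_eq0 (o w w).
split=> [hmax|[km m3]].
  have [//|[lt|[e1 [e2 m2]]]] : ((k1 + k2)%N = m /\ (3 <= m)%N) \/ ((k1 + k2 < m)%N \/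
     (k1 = 1%N /\ (k2 = 1%N /\ m = 2%N))) by lia.
    have [|t [tt ht]] := @exists_orth _ _ (W1 + W2)%VS.
      by rewrite dimv_disjoint_sum // d1 d2.
    have d1' : \dim (W1 + <[t]>) = k1.+1.
      rewrite dim_add_line ?d1 // notin_orth // => w hw.
      by apply: ht; apply: (subvP (addvSl _ _)).
    case: (@not_model_maximal _ (prodv (W1 + <[t]>) W2) _ _ _ _ hmax).
    + apply: model_lts_prodv_orth => _ w /memv_addP[w1 h1 [_ /vlineP[k ->] ->]] hw.
      rewrite !dotE o // ht ?mulr0 ?addr0 //.
      by apply: (subvP (addvSr _ _)).
    + by rewrite prodvS ?addvSl.
    + by rewrite !dim_prodv d1 d2 d1'; lia.
    + by rewrite !dim_prodv d2 d1'; lia.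
  case: (@not_model_maximal _ (space_G3 x y) _ _ _ _ hmax).
  + exact: model_lts_space_G3.
  + have -> : W1 = <[x]>%VS by apply/esym/eqP; rewrite eqEdim -memvE hx d1 dim_unit ?e1.
    have -> : W2 = <[y]>%VS by apply/esym/eqP; rewrite eqEdim -memvE hy d2 dim_unit ?e2.
    apply/subvP => -[c d]; rewrite mem_prodv /= => /andP[/vlineP[k ->] /vlineP[l ->]].
    by apply/mem3P; exists k, l, 0; apply: pairP => /=; vring.
  + by rewrite dU dim_space_G3 // e1 e2.
  + by rewrite dim_space_G3 // m2.
apply: model_maximalI => //; first by rewrite dim_lt_full dU; lia.
move=> U' h1 h2 h3 h4; move: h3; rewrite dU km => h3.
have [[W' [h5 h6]]|[h _]|h|[h _]] := coarse_classification h1 h4; [|lia..].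
have s1 : (W1 + W2 <= W')%VS.
  have /subvP s := subv_trans h2 h6.
  rewrite subv_add; apply/andP; split; apply/subvP => w hw.
    by have := s (w, 0); rewrite !mem_prodv /= hw !mem0v => /(_ isT)/andP[].
  by have := s (0, w); rewrite !mem_prodv /= hw !mem0v => /(_ isT)/andP[].
by have := dimvS s1; rewrite dimv_disjoint_sum // d1 d2; lia.
Qed.

(** U lies in the CQ-subspace of x and y, which is proper for m > 2; for m = 2
    there is no room between dimension 3 and 4. *)
Lemma prop_G3 U : model_G3 U ->
  [/\ model_lts U, \dim U = 3%N, ~ model_complex U /\ ~ model_treal U, model_rank U 2 & model_maximal U <-> m = 2%N].
Proof.
move=> [x [y [xx yy xy ->]]]; have d3 := dim_space_G3 xx yy xy.
have hl := model_lts_space_G3 xx yy xy.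
have hx : (x, 0) \in space_G3 x y by apply/mem3P; exists 1, 0, 0; apply: pairP => /=; vring.
have hy : (0, y) \in space_G3 x y by apply/mem3P; exists 0, 1, 0; apply: pairP => /=; vring.
have hz : (y, x) \in space_G3 x y by apply/mem3P; exists 0, 0, 1; apply: pairP => /=; vring.
split=> //.
- split; first by move=> /model_complex_even[k]; rewrite d3; lia.
  move=> /(_ _ _ hx hz); rewrite /omega /= xx dot0l subr0 => /eqP.
  by rewrite oner_eq0.
- exact: model_rank2 hx hy.
split=> [hmax|m2].
  have [//|m3] : (m = 2 \/ 3 <= m)%N by lia.
  case: (@not_model_maximal _ (prodv (<[x]> + <[y]>) (<[x]> + <[y]>)) _ _ _ _ hmax).
  - exact: model_lts_prodv.
  - exact: space_G3_sub.
  - by rewrite d3 dim_prodv dim_unit2.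
  - by rewrite dim_prodv dim_unit2 //; lia.
apply: model_maximalI => //; first by rewrite dim_lt_full d3 m2.
by move=> U' h1 h2; rewrite d3 dim_lt_full; lia.
Qed.

(** Here the case m = 2 needs an argument: a rotated R^m is not contained in the
    hyperplane of type G3. *)
Lemma prop_P1 k U : (1 <= k <= m)%N -> model_P1 k U ->
  [/\ model_lts U, \dim U = k, model_treal U, model_rank U 1 & model_maximal U <-> k = m].
Proof.
move=> hk [W dW ->]; have dU : \dim (prodv W 0) = k.
  by rewrite dim_prodv dW dimv0 addn0.
have hl := model_lts_prodv_orth (@orthv0 _ _ W).
split=> //; first exact/treal_prodv/orthv0.
  apply: model_rank1; first by rewrite -dimv_eq0 dU; lia.
  by move=> F sF hF; exact: (flat_real sF hF).
split=> [hmax|km].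
  have [//|lt] : (k = m \/ k < m)%N by lia.
  case: (@not_model_maximal _ (prodv fullv 0) _ _ _ _ hmax).
  - exact/model_lts_prodv_orth/orthv0.
  - by rewrite prodvS ?subvf.
  - by rewrite dU dim_prodv dimE dimv0 addn0.
  - by rewrite dim_prodv dimE dimv0; lia.
have Wf : W = fullv by apply: dim_full; rewrite dW km.
apply: model_maximalI => //; first by rewrite dim_lt_full dU; lia.
move=> U' h1 h2 h3 h4; move: h3; rewrite dU km => h3.
have [[W' [h5 h6]]|[h _]|h|[m2 [r [s [h [x [y [xx yy xy e]]]]]]]] := coarse_classification h1 h4.
- have /subvP s := subv_trans h2 h6.
  have : (fullv <= W')%VS.
    apply/subvP => w _; have := s (w, 0).
    by rewrite !mem_prodv /= Wf memvf mem0v => /(_ isT)/andP[].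
  by move=> /dimvS; rewrite dimE; lia.
- lia.
- lia.
(* For p = y and p = x this gives r = s = 0. *)
have key p : r * dot p y = - s * dot p x.
  have : rot r (- s) (p, 0) \in rotate_space r s U'.
    by rewrite mem_rotate_space rotK // (subvP h2) // mem_prodv Wf memvf mem0v.
  by rewrite e => /(mem_space_G3 xx yy xy) /=; rewrite !dotE; lra.
have := key x; have := key y; rewrite xx yy xy (dotC y) xy !mulr0 !mulr1 => r0 s0.
by move: h; rewrite r0 (_ : s = 0); [rewrite expr0n addr0 => /eqP; rewrite eq_sym oner_eq0|lra].
Qed.

(** As for P1, for m = 2 the complex line C x is not contained in a rotated
    hyperplane of type G3. *)
Lemma prop_P2 U : model_P2 U ->
  [/\ model_lts U, \dim U = 2%N, model_complex U, model_rank U 1 & model_maximal U <-> m = 2%N].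
Proof.
move=> [x xx ->]; have d2 : \dim (prodv <[x]> <[x]>) = 2%N by rewrite dim_prodv dim_unit.
have hl := @model_lts_prodv _ _ <[x]>%VS.
split=> //.
- by move=> u; rewrite !mem_prodv /= memvN andbC.
- by apply: model_rank1; [rewrite -dimv_eq0 d2|move=> F; exact: flat_P2].
split=> [hmax|m2].
  have [//|m3] : (m = 2 \/ 3 <= m)%N by lia.
  have [|y [yy hy]] := @exists_orth _ _ (<[x]> : {vspace E}).
    by rewrite dim_unit //; lia.
  have xy : dot x y = 0 by rewrite dotC hy ?memv_line.
  case: (@not_model_maximal _ (prodv (<[x]> + <[y]>) (<[x]> + <[y]>)) _ _ _ _ hmax).
  - exact: model_lts_prodv.
  - by rewrite prodvS ?addvSl.
  - by rewrite d2 dim_prodv dim_unit2.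
  - by rewrite dim_prodv dim_unit2 //; lia.
apply: model_maximalI => //; first by rewrite dim_lt_full d2 m2.
move=> U' h1 h2; rewrite d2 => h3 h4.
have [[W' [h5 /dimvS]]|[h _]|h|[_ [r [s [h [x' [y' [xx' yy' xy' e]]]]]]]] := coarse_classification h1 h4.
- by rewrite dim_prodv; lia.
- lia.
- lia.
have key p q : p \in <[x]>%VS -> q \in <[x]>%VS -> dot p y' = dot q x'.
  move=> hp hq; apply: (@mem_space_G3 x' y' (p, q)) => //; rewrite -e mem_rotate_space (subvP h2) //.
  by rewrite mem_prodv /= memvB ?memvD ?memvZ.
have := key x 0; rewrite memv_line mem0v dot0l => /(_ isT isT) xy0.
have := key 0 x; rewrite memv_line mem0v dot0l => /(_ isT isT)/esym xx0.
have : x \in (<[x']> + <[y']>)%VS.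
  rewrite (_ : (<[x']> + <[y']>)%VS = fullv) ?memvf //.
  by apply: dim_full; rewrite dim_unit2 // m2.
move=> /mem2P[k [l xe]]; move: xx; rewrite {2}xe !dotE xy0 xx0 !mulr0 addr0.
by move/eqP; rewrite eq_sym oner_eq0.
Qed.

(** U generates the CQ-subspace of x, y, t, which is everything for m = 3. *)
Lemma prop_A U : model_A U -> (3 <= m)%N /\
  [/\ model_lts U, \dim U = 2%N, ~ model_complex U /\ ~ model_treal U, model_rank U 1 & model_maximal U <-> m = 3%N].
Proof.
move=> [x [y [t [[xx yy tt] [xy xt yt] ->]]]].
have d3 := dim_unit3 xx yy tt xy xt yt.
have m3 : (3 <= m)%N by rewrite -d3 dim_W.
have d2 := dim_space_A t xx yy xy; have hl := model_lts_space_A xx yy tt xy xt yt.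
have s3 : Num.sqrt 3 != 0 :> R by rewrite sqrtr_eq0 -ltNge ltr0n.
have h1 : (2 *: x, y) \in space_A x y t.
  by apply/mem2P; exists 1, 0; apply: pairP => /=; vring.
have h2 : (y, x + Num.sqrt 3 *: t) \in space_A x y t.
  by apply/mem2P; exists 0, 1; apply: pairP => /=; vring.
have ntr : ~ model_treal (space_A x y t).
  move=> /(_ _ _ h1 h2); rewrite /omega /= !dotE xx yy xt => h.
  by have /eqP : (1 : R) = 0 by [rewrite -[RHS]h; ring]; rewrite oner_eq0.
split=> //; split=> //.
- split=> //; move=> /(_ _ h1) /mem2P[k [l e]].
  have /= /(congr1 (dot y)) := congr1 fst e; have /= /(congr1 (dot t)) := congr1 snd e.
  rewrite !dotE yy tt (dotC y x) xy (dotC t x) xt (dotC t y) yt.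
  rewrite !mulr0 !add0r mulr1 => /esym/eqP; rewrite mulf_eq0 (negbTE s3) orbF => /eqP ->.
  by rewrite mul0r; lra.
- by apply: model_rank1; [rewrite -dimv_eq0 d2|move=> F; exact: flat_A].
split=> [hmax|me].
  have [//|m4] : (m = 3 \/ 4 <= m)%N by lia.
  pose W := (<[x]> + <[y]> + <[t]>)%VS.
  case: (@not_model_maximal _ (prodv W W) _ _ _ _ hmax).
  - exact: model_lts_prodv.
  - exact: space_A_sub.
  - by rewrite d2 dim_prodv d3.
  - by rewrite dim_prodv d3; lia.
apply: model_maximalI => //; first by rewrite dim_lt_full d2 me.
move=> U' h3 h4; rewrite d2 => h5 h6.
have [[W' [h7 h8]]|[_ h]|h|[h _]] := coarse_classification h3 h6; last 2 first.
- lia.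
- lia.
- have /subvP s := subv_trans h4 h8.
  have := s _ h1; rewrite mem_prodv /= => /andP[x2 yW].
  have := s _ h2; rewrite mem_prodv /= => /andP[_ xt'].
  have xW : x \in W' by rewrite -[x](@scalerK _ _ (2 : R)) ?pnatr_eq0 // memvZ.
  have tW : t \in W' by move: xt'; rewrite rpredDl // => /(memvZ (Num.sqrt 3)^-1); rewrite scalerK.
  have : (<[x]> + <[y]> + <[t]> <= W')%VS by rewrite !subv_add -!memvE xW yW tW.
  by move=> /dimvS; rewrite d3 -me leqNgt h7.
case: h => h; first by apply: ntr => u v hu hv; apply: h; apply: (subvP h4).
have [/= + _] := h _ (subvP h4 _ h1).
by rewrite !dotE xx yy; lra.
Qed.

(** U generates a CQ-subspace of complex dimension 2 k; for 2 k < m it is proper.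
    For m = 2 and k = 1 the line C v of v = l (x - J y) is contained in the type
    G3 of x and y. *)
Lemma prop_I1 k U : (1 <= k)%N -> model_I1 k U ->
  [/\ model_lts U, model_rank U 1 & model_maximal U <-> (2 * k)%N = m /\ (4 <= m)%N].
Proof.
move=> k1 [hc hi dU]; have hl := isotropic_complex_lts hi hc.
have km := dim_iso hi; rewrite dU in km.
have dW := dim_iso_fst hi; have sW := model_complex_sub_prodv hc; rewrite dU in dW.
split=> //.
  apply: model_rank1; first by rewrite -dimv_eq0 dU; lia.
  move=> F sF; apply: flat_iso => u hu; apply: hi; exact: (subvP sF).
split=> [hmax|[km' m4]].
  have [//|[lt|[e1 e2]]] : ((2 * k)%N = m /\ (4 <= m)%N) \/ ((2 * k < m)%N \/ (k = 1%N /\ m = 2%N)) by lia.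
    case: (not_model_maximal _ sW _ _ hmax).
    - exact: model_lts_prodv.
    - by rewrite dim_prodv dW dU; lia.
    - by rewrite dim_prodv dW; lia.
  pose v := vpick U; have v0 : v != 0 by rewrite vpick0 -dimv_eq0 dU; lia.
  have hv : v \in U by exact: memv_pick.
  have [i1 i2] := hi _ hv.
  have p0 : v.1 != 0 by apply: contraNneq v0 => /(isotropic_pair0 (hi _ hv)) ->.
  have [l [x [l0 xx ex]]] := normalize_vector p0.
  pose y := - (l^-1 *: v.2); have ey : v.2 = - l *: y.
    by rewrite /y scalerN scaleNr opprK scalerA mulfV ?scale1r ?gt_eqF.
  have yy : dot y y = 1.
    by rewrite /y !dotE -i1 ex !dotE xx; field; rewrite gt_eqF.
  have xy : dot x y = 0.
    move: i2; rewrite ex ey !dotE => /eqP; rewrite !mulf_eq0 oppr_eq0 gt_eqF //=.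
    by move/eqP.
  have eU : U = (<[v]> + <[Jpair v]>)%VS.
    apply/esym/eqP; rewrite eqEdim subv_add -!memvE hv hc //=.
    have dl : \dim <[v]> = 1%N by rewrite dim_vline v0.
    by have := dim_treal_Jimage (@treal_line v); rewrite /Jimage limg_line lfunE dl => ->; rewrite dU e1.
  case: (@not_model_maximal _ (space_G3 x y) _ _ _ _ hmax).
  - exact: model_lts_space_G3.
  - rewrite eU subv_add -!memvE; apply/andP; split; apply/mem3P.
      by exists l, (- l), 0; apply: pairP => /=; rewrite ?ex ?ey; vring.
    by exists 0, 0, l; apply: pairP => /=; rewrite ?ex ?ey; vring.
  - by rewrite dU dim_space_G3 // e1.
  - by rewrite dim_space_G3 // e2.
apply: model_maximalI => //; first by rewrite dim_lt_full dU; lia.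
move=> U' h1 h2 h3 h4; move: h3; rewrite dU km' => h3.
have [[W' [h5 h6]]|[h _]|h|[h _]] := coarse_classification h1 h4; [|lia..].
have : (linfun (@fst E E) @: U <= W')%VS.
  apply/subvP => _ /memv_imgP[u hu ->]; rewrite lfunE.
  by have := subvP (subv_trans h2 h6) _ hu; rewrite mem_prodv => /andP[].
by move=> /dimvS; rewrite dW km' leqNgt h5.
Qed.

(** U is contained in the isotropic complex subspace U + J U, of type I1. *)
Lemma prop_I2 k U : (1 <= k)%N -> model_I2 k U ->
  [/\ model_lts U, model_rank U 1 & ~ model_maximal U].
Proof.
move=> k1 [ht hi dU]; have hl := isotropic_treal_lts hi ht.
have km := dim_iso_treal hi ht; rewrite dU in km.
split=> //.
  apply: model_rank1; first by rewrite -dimv_eq0 dU; lia.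
  move=> F sF; apply: flat_iso => u hu; apply: hi; exact: (subvP sF).
apply: (@not_model_maximal _ (U + Jimage U)%VS); rewrite ?addvSl ?dim_treal_Jimage ?dU //; [|lia..].
by apply: isotropic_complex_lts; [exact: model_isotropic_Jimage|exact: model_complex_Jimage].
Qed.

End Props.

(** * Real coordinates on the horizontal space *)

Lemma mulmx_trE (R : rcfType) (k l n : nat) (A : 'M[R]_(k, n)) (B : 'M[R]_(l, n)) i j :
  (A *m B^T) i j = dot (row i A) (row j B).
Proof. by rewrite mxE; apply: eq_bigr => a _; rewrite !mxE. Qed.

(** Orthonormal rows are added one by one, each orthogonal to W and to the
    previous ones. *)
Lemma orthonormal_complement (R : rcfType) (n k : nat) (W : {vspace 'rV[R]_n}) :
  (\dim W + k <= n)%N -> exists B : 'M[R]_(k, n), B *m B^T = 1%:M /\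
    forall i y, y \in W -> dot (row i B) y = 0.
Proof.
elim: k W => [|k IH] W hk.
  by exists 0; split; [apply/matrixP => -[]|case].
have [|x [xx hx]] := @exists_orth _ _ W; first by lia.
have [|B [BB hB]] := IH (W + <[x]>)%VS.
  by rewrite dim_add_line ?notin_orth //; lia.
have Bx i : dot (row i B) x = 0 by apply: hB; apply: (subvP (addvSr _ _)); exact: memv_line.
exists (col_mx x B); split.
  rewrite (tr_col_mx x B) (mul_col_row x B x^T B^T) BB.
  have -> : x *m x^T = 1%:M.
    by apply/matrixP => i j; rewrite mulmx_trE !row_id xx !ord1 mxE.
  have -> : x *m B^T = 0.
    by apply/matrixP => i j; rewrite mulmx_trE row_id dotC Bx mxE.
  have -> : B *m x^T = 0.
    by apply/matrixP => i j; rewrite mulmx_trE (row_id _ x) Bx mxE.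
  exact/esym/(@scalar_mx_block _ 1 k).
move=> i y yW; rewrite -(@splitK 1 k i); case: (fintype.split _) => j.
  by rewrite /= (@rowKu _ 1 k) row_id hx.
by rewrite /= (@rowKd _ 1 k) hB //; apply: (subvP (addvSl _ _)).
Qed.

Section Frame.
Context {R : realType} {n : nat}.
Local Notation Cn := ('cV[R[i]]_n).

Lemma hdot_mul (v w : Cn) : hdot v w = ((conjv w)^T *m v) 0 0.
Proof. by rewrite mxE; apply: eq_bigr => k _; rewrite !mxE mulrC. Qed.

End Frame.

Section Basis.
Context {R : realType} {m : nat} (z : 'cV[R[i]]_m.+2) (hz : quadric_lift z).
Local Notation Cn := ('cV[R[i]]_m.+2).
Local Notation cx := (map_mx (real_complex R)).

(** Real and imaginary part of z are orthogonal and of the same length, since z is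
    a null vector of the bilinear form. The rows of B complete their multiples of
    length one to an orthonormal basis of R^(m+2), and a vector of Wperp z has no
    component along these two. *)
Lemma basis_exists : exists B : 'M[R]_(m, m.+2),
  [/\ B *m B^T = 1%:M, cx B *m z = 0, cx B *m conjv z = 0 &
      forall w, Wperp z w -> (cx B)^T *m (cx B *m w) = w].
Proof.
pose al : 'rV[R]_m.+2 := \row_k complex.Re (z k 0).
pose be : 'rV[R]_m.+2 := \row_k complex.Im (z k 0).
have [z1 z2] := hz.
have eal : dot al al + dot be be = 1.
  move/(congr1 (@complex.Re R)): z1; rewrite /hdot raddf_sum /= => <-.
  by rewrite -big_split; apply: eq_bigr => k _; rewrite !mxE; case: (z k 0) => a b /=; ring.
have ebe : dot al al - dot be be = 0.
  move/(congr1 (@complex.Re R)): z2; rewrite raddf_sum /= => <-.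
  by rewrite -sumrB; apply: eq_bigr => k _; rewrite !mxE; case: (z k 0) => a b /=; ring.
have eab : dot al be = 0.
  have : 2 * dot al be = 0.
    move/(congr1 (@complex.Im R)): z2; rewrite raddf_sum /= => <-.
    by rewrite mulr_sumr; apply: eq_bigr => k _; rewrite !mxE; case: (z k 0) => a b /=; ring.
  by lra.
have s2 : Num.sqrt 2 * Num.sqrt 2 = 2 :> R by rewrite -expr2 sqr_sqrtr.
pose C : 'M[R]_(2, m.+2) := col_mx (Num.sqrt 2 *: al) (Num.sqrt 2 *: be).
pose W := (<[al]> + <[be]>)%VS.
have [|B [BB hB]] := @orthonormal_complement R m.+2 m W.
  by apply: (@leq_add _ _ 2 m) => //; apply: (dim_le2 (subvv _)).
have Bal i : dot (row i B) al = 0 by apply: hB; apply: (subvP (addvSl _ _)); exact: memv_line.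
have Bbe i : dot (row i B) be = 0 by apply: hB; apply: (subvP (addvSr _ _)); exact: memv_line.
have zE : z = map_mx (real_complex R) al^T + 'i%C *: map_mx (real_complex R) be^T.
  by apply/colP => k; rewrite !mxE; case: (z k 0) => a b; apply/eqP; rewrite eq_complex /=; apply/andP; split; apply/eqP; ring.
have zcE : conjv z = map_mx (real_complex R) al^T - 'i%C *: map_mx (real_complex R) be^T.
  by apply/colP => k; rewrite !mxE; case: (z k 0) => a b; apply/eqP; rewrite eq_complex /=; apply/andP; split; apply/eqP; ring.
have Ba : B *m al^T = 0 by apply/matrixP => i j; rewrite mulmx_trE row_id Bal mxE.
have Bb : B *m be^T = 0 by apply/matrixP => i j; rewrite mulmx_trE row_id Bbe mxE.
exists B; split=> //.
- by rewrite zE mulmxDr -scalemxAr -!map_mxM Ba Bb !map_mx0 scaler0 addr0.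
- by rewrite zcE mulmxBr -scalemxAr -!map_mxM Ba Bb !map_mx0 scaler0 subr0.
pose O : 'M[R]_(2 + m) := col_mx C B.
have aB : al *m B^T = 0 by apply/matrixP => i j; rewrite mulmx_trE row_id dotC Bal mxE.
have bB : be *m B^T = 0 by apply/matrixP => i j; rewrite mulmx_trE row_id dotC Bbe mxE.
have CB : C *m B^T = 0.
  by rewrite /C (@mul_col_mx _ 1 1) -!scalemxAl aB bB !scaler0 (@col_mx0 _ 1 1).
have CC : C *m C^T = 1%:M.
  rewrite /C (@tr_col_mx _ 1 1) (mul_col_row (Num.sqrt 2 *: al) (Num.sqrt 2 *: be) (Num.sqrt 2 *: al)^T (Num.sqrt 2 *: be)^T).
  have h (x y : 'rV[R]_m.+2) : (Num.sqrt 2 *: x) *m (Num.sqrt 2 *: y)^T = (2 * dot x y)%:M.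
    apply/matrixP => i j; rewrite mulmx_trE !row_id !ord1 !dotE mulrA s2.
    by rewrite !mxE.
  rewrite !h (dotC be) eab mulr0 (_ : 2 * dot al al = 1); last by lra.
  rewrite (_ : 2 * dot be be = 1); last by lra.
  by rewrite (raddf0 (@scalar_mx R 1)); exact/esym/(@scalar_mx_block _ 1 1).
(* O is a square matrix, so that also O^T O = 1, which is the completeness of
   the basis. *)
have OO : O *m O^T = 1%:M.
  rewrite /O tr_col_mx mul_col_row BB CC CB -[B *m C^T]trmxK trmx_mul trmxK CB trmx0.
  by rewrite -scalar_mx_block.
have := mulmx1C OO; rewrite /O tr_col_mx mul_row_col => e w hw.
have -> : (cx B)^T *m (cx B *m w) = cx (B^T *m B) *m w.
  by rewrite map_mxM map_trmx mulmxA.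
have -> : B^T *m B = 1%:M - C^T *m C by rewrite -e [X in X - _]addrC addrK.
rewrite map_mxB mulmxBl map_mx1 mul1mx map_mxM -mulmxA.
suff -> : cx C *m w = 0 by rewrite mulmx0 subr0.
have [w1 w2] := (WperpP z w).1 hw.
have aw : cx al *m w = 0.
  apply/matrixP => i j; rewrite !ord1.
  have -> : (cx al *m w) 0 0 = (hdot w z + hdot w (conjv z)) / 2.
    rewrite /hdot -big_split mulr_suml mxE; apply: eq_bigr => k _.
    by rewrite /= !mxE conjcK -mulrDr [conjc _ + _]addrC addcJ; field.
  by rewrite w1 w2 addr0 mul0r mxE.
have bw : cx be *m w = 0.
  apply/matrixP => i j; rewrite !ord1.
  have -> : (cx be *m w) 0 0 = (hdot w (conjv z) - hdot w z) / 2 * - 'i%C.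
    rewrite /hdot -sumrB !mulr_suml mxE; apply: eq_bigr => k _.
    rewrite /= !mxE conjcK -mulrBr.
    have -> : z k 0 - conjc (z k 0) = 2 * 'i%C * (complex.Im (z k 0))%:C%C.
      case: (z k 0) => a b; apply/eqP; rewrite eq_complex /=; apply/andP; split; apply/eqP; ring.
    have i2 : 'i%C * 'i%C = -1 :> R[i] by rewrite -expr2 sqr_i.
    have -> : w k 0 * (2 * 'i%C * (complex.Im (z k 0))%:C%C) / 2 * - 'i%C =
      - ('i%C * 'i%C) * ((complex.Im (z k 0))%:C%C * w k 0) by field.
    by rewrite i2 opprK mul1r.
  by rewrite w1 w2 subr0 !mul0r mxE.
by rewrite /C (@map_col_mx _ _ _ 1 1) (@mul_col_mx _ 1 1) !map_mxZ -!scalemxAl aw bw !scaler0 (@col_mx0 _ 1 1).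
Qed.

End Basis.

(** * The bracket in terms of horizontal lifts *)

Section Bracket.
Context {R : realType} {n : nat} (z : 'cV[R[i]]_n) (hz : quadric_lift z).
Local Notation Cn := ('cV[R[i]]_n).
Local Notation M := ('M[R]_n).
Implicit Types (x y w : Cn) (X Y Z : M).

Lemma conjv0 : conjv (0 : Cn) = 0.
Proof. by apply/colP => k; rewrite !mxE rmorph0. Qed.

Lemma actDr X x y : act X (x + y) = act X x + act X y.
Proof. exact: mulmxDr. Qed.
Lemma actZr (a : R[i]) X x : act X (a *: x) = a *: act X x.
Proof. by rewrite /act scalemxAr. Qed.
Lemma actNr X x : act X (- x) = - act X x.
Proof. exact: mulmxN. Qed.
Lemma actM X Y x : act (X *m Y) x = act X (act Y x).
Proof. by rewrite /act map_mxM mulmxA. Qed.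
Lemma actlie X Y x : act (lie X Y) x = act X (act Y x) - act Y (act X x).
Proof. by rewrite /lie actDl actNl !actM. Qed.

Lemma hdot_conjvC x y : hdot x (conjv y) = hdot y (conjv x).
Proof. by apply: eq_bigr => k _; rewrite !mxE !conjcK mulrC. Qed.

Lemma act_of_z x : Wperp z x -> act (of_tangent z x) z = x.
Proof. exact: of_tangentK. Qed.

Lemma act_of_zc x : Wperp z x -> act (of_tangent z x) (conjv z) = conjv x.
Proof. by move=> hx; rewrite act_conjv act_of_z. Qed.

(** Elements of m exchange W and its complement; this is the component of the value in W. *)
Lemma act_of_perp x y : Wperp z x -> Wperp z y ->
  act (of_tangent z x) y = - hdot y x *: z - hdot y (conjv x) *: conjv z.
Proof.
move=> hx /WperpP[y1 y2].
by rewrite act_of_tangent y1 y2 !scale0r !sub0r scaleNr.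
Qed.

Lemma act_lie_z x y : Wperp z x -> Wperp z y ->
  act (lie (of_tangent z x) (of_tangent z y)) z = (hdot x y - hdot y x) *: z.
Proof.
move=> hx hy; rewrite actlie !act_of_z // !act_of_perp //.
by rewrite (hdot_conjvC y x) opprB addrA subrK -scalerBl opprK addrC.
Qed.

(** The value of [X, Y] on a horizontal vector w. *)
Definition triple x y w : Cn :=
  hdot w x *: y + hdot w (conjv x) *: conjv y - hdot w y *: x -
  hdot w (conjv y) *: conjv x.

Lemma act_lie_perp x y w : Wperp z x -> Wperp z y -> Wperp z w ->
  act (lie (of_tangent z x) (of_tangent z y)) w = triple x y w.
Proof.
move=> hx hy hw; rewrite actlie !(act_of_perp _ hw) //.
rewrite !actDr !actNr !actZr !act_of_z // !act_of_zc // /triple.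
by rewrite !scaleNr opprB opprK addrC [_ *: conjv y + _]addrC !addrA.
Qed.

Lemma lie_tr X Y : X^T = - X -> Y^T = - Y -> (lie X Y)^T = - lie X Y.
Proof.
by move=> hX hY; rewrite /lie linearB /= !trmx_mul hX hY !mulNmx !mulmxN !opprK opprB.
Qed.

Lemma act_ext X Y : (forall w, act X w = act Y w) -> X = Y.
Proof.
move=> h; apply/matrixP => i j; have /colP/(_ i) := h (delta_mx j 0).
rewrite !mxE (bigD1 j) //= [RHS](bigD1 j) //= !big1 ?addr0; last 2 first.
- by move=> k kj; rewrite !mxE (negbTE kj) mulr0.
- by move=> k kj; rewrite !mxE (negbTE kj) mulr0.
by rewrite !mxE !eqxx !mulr1 => /(congr1 (@complex.Re R)).
Qed.

(** [X, Y] is a real matrix, so it is zero if it kills z (then also conj(z)) and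
    the complement of W. *)
Lemma lie_eq0 x y : Wperp z x -> Wperp z y -> hdot x y = hdot y x ->
  (forall w, Wperp z w -> triple x y w = 0) ->
  lie (of_tangent z x) (of_tangent z y) = 0.
Proof.
move=> hx hy e h; apply: act_ext => w; rewrite /act map_mx0 mul0mx -/(act _ _).
have -> : w = (w - (hdot w z *: z + hdot w (conjv z) *: conjv z)) +
              (hdot w z *: z + hdot w (conjv z) *: conjv z) by rewrite subrK.
have hw := Wperp_proj w hz.
rewrite [LHS]actDr act_lie_perp // h // add0r actDr !actZr act_conjv.
by rewrite !act_lie_z // e subrr scale0r conjv0 !scaler0 addr0.
Qed.

Lemma WspaceB x y : Wspace z x -> Wspace z y -> Wspace z (x - y).
Proof.
move=> [a [b ->]] [a' [b' ->]]; exists (a - a'), (b - b').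
by rewrite !scalerBl opprD addrACA.
Qed.

(** [[X, Y], Z] is again in m, so it is determined by its value at z, which is
    [X, Y] w - Z ([X, Y] z) for the lift w of Z. *)
Lemma lie_triple x y w : Wperp z x -> Wperp z y -> Wperp z w ->
  lie (lie (of_tangent z x) (of_tangent z y)) (of_tangent z w) =
  of_tangent z (triple x y w - (hdot x y - hdot y x) *: w).
Proof.
move=> hx hy hw; set D := lie (of_tangent z x) (of_tangent z y).
have [[sX X1 X2] [sY Y1 Y2]] := (mspace_of_tangent hz hx, mspace_of_tangent hz hy).
have [sZ Z1 Z2] := mspace_of_tangent hz hw.
have D1 v : Wspace z v -> Wspace z (act D v).
  move=> hv; rewrite actlie.
  by apply: WspaceB; [exact/X2/Y1|exact/Y2/X1].
have D2 v : Wperp z v -> Wperp z (act D v).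
  by move=> hv; rewrite actlie; apply: WperpD; [|apply: WperpN]; auto.
rewrite -[LHS](to_tangentK hz); last first.
  split.
  - by rewrite lie_tr // lie_tr.
  - by move=> v hv; rewrite actlie; apply: WperpD; [|apply: WperpN]; auto.
  - move=> v hv; rewrite actlie.
    by apply: WspaceB; [exact/D1/Z2|exact/Z2/D2].
congr of_tangent; rewrite /to_tangent actlie act_of_z // act_lie_perp //.
by rewrite act_lie_z // actZr act_of_z.
Qed.

End Bracket.

(** * The identification of pairs with tangent vectors *)

Section Phi.
Context {R : realType} {m : nat} (z : 'cV[R[i]]_m.+2) (hz : quadric_lift z).
Local Notation Cn := ('cV[R[i]]_m.+2).
Local Notation M := ('M[R]_m.+2).
Local Notation E := ('rV[R]_m).
Local Notation V := (E * E)%type.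
Local Notation cx := (map_mx (real_complex R)).
Implicit Types (u v w : V).

Definition cvec u : 'cV[R[i]]_m := \col_k (u.1 0 k +i* u.2 0 k)%C.
Definition conj_pair u : V := (u.1, - u.2).

Lemma hdot_cvec u v : hdot (cvec u) (cvec v) = (ip u v +i* - omega u v)%C.
Proof.
have -> : hdot (cvec u) (cvec v) = (complex.Re (hdot (cvec u) (cvec v)) +i* complex.Im (hdot (cvec u) (cvec v)))%C by case: (hdot _ _).
rewrite /hdot !raddf_sum /ip /omega /dot -sumrB -sumrN -big_split; congr (_ +i* _)%C;
  by apply: eq_bigr => k _; rewrite !mxE /=; ring.
Qed.

Lemma ipC u v : ip u v = ip v u.
Proof. by rewrite /ip (dotC v.1) (dotC v.2). Qed.

Lemma omegaC u v : omega u v = - omega v u.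
Proof. by rewrite /omega (dotC v.1) (dotC v.2) opprB. Qed.

Lemma conjv_cvec u : conjv (cvec u) = cvec (conj_pair u).
Proof. by apply/colP => k; rewrite !mxE. Qed.

Lemma cvec_rot (r s : R) u : cvec (rot r s u) = (r +i* s)%C *: cvec u.
Proof. by apply/colP => k; rewrite !mxE; apply/eqP; rewrite eq_complex /=; apply/andP; split; apply/eqP; ring. Qed.

Lemma cvec_bracket u v w : cvec (2 *: bracket u v w) =
  triple (cvec u) (cvec v) (cvec w) -
  (hdot (cvec u) (cvec v) - hdot (cvec v) (cvec u)) *: cvec w.
Proof.
apply/colP => k.
have E (c1 c2 c3 c4 c5 : R[i]) :
    (c1 *: cvec v + c2 *: cvec (conj_pair v) - c3 *: cvec u - c4 *: cvec (conj_pair u) - c5 *: cvec w) k 0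
    = c1 * (v.1 0 k +i* v.2 0 k)%C + c2 * (v.1 0 k +i* - v.2 0 k)%C
    - c3 * (u.1 0 k +i* u.2 0 k)%C - c4 * (u.1 0 k +i* - u.2 0 k)%C - c5 * (w.1 0 k +i* w.2 0 k)%C.
  by rewrite !mxE.
rewrite /triple !conjv_cvec E !hdot_cvec [LHS]mxE.
have E1 : (2 *: bracket u v w).1 0 k = 2 * (dot u.1 w.1 * v.1 0 k + dot u.2 w.1 * v.2 0 k -
  dot v.1 w.1 * u.1 0 k - dot v.2 w.1 * u.2 0 k - omega u v * w.2 0 k) by rewrite /bracket /= !mxE.
have E2 : (2 *: bracket u v w).2 0 k = 2 * (dot u.1 w.2 * v.1 0 k + dot u.2 w.2 * v.2 0 k -
  dot v.1 w.2 * u.1 0 k - dot v.2 w.2 * u.2 0 k + omega u v * w.1 0 k) by rewrite /bracket /= !mxE.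
rewrite {}E1 {}E2 /ip /omega /conj_pair /= !dotNr.
rewrite !(dotC v.1 u.2) !(dotC v.2 u.1) !(dotC v.1 u.1) !(dotC v.2 u.2).
rewrite !(dotC w.1 v.1) !(dotC w.1 v.2) !(dotC w.2 v.1) !(dotC w.2 v.2).
rewrite !(dotC w.1 u.1) !(dotC w.1 u.2) !(dotC w.2 u.1) !(dotC w.2 u.2).
by apply/eqP; rewrite eq_complex /=; apply/andP; split; apply/eqP; ring.
Qed.

(** A acts as the standard conjugation in the coordinates with phase r + i s, so
    that V(A) is the set of the Phi r s (a, 0). *)
Definition adapted (Phi : R -> R -> 'Hom(V, M)) (A : M -> M) (r s : R) :=
  [/\ CQ_structure z A, r ^+ 2 + s ^+ 2 = 1 &
      forall u, A (Phi r s u) = Phi r s (conj_pair u)].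

Section WithB.
Variable B : 'M[R]_(m, m.+2).
Hypotheses (BB : B *m B^T = 1%:M) (Bz : cx B *m z = 0) (Bzc : cx B *m conjv z = 0).
Hypothesis BK : forall w : Cn, Wperp z w -> (cx B)^T *m (cx B *m w) = w.

Definition horizontal (x : 'cV[R[i]]_m) : Cn := (cx B)^T *m x.

Lemma conjv_lift x : conjv (horizontal x) = horizontal (conjv x).
Proof.
apply/colP => k; rewrite !mxE rmorph_sum; apply: eq_bigr => j _.
by rewrite !mxE rmorphM /= oppr0.
Qed.

Lemma hdot_lift x y : hdot (horizontal x) (horizontal y) = hdot x y.
Proof.
rewrite !hdot_mul conjv_lift /horizontal trmx_mul trmxK mulmxA -[_ *m _ *m _ *m x]mulmxA.
by rewrite -mulmxA [cx B *m _]mulmxA map_trmx -map_mxM BB map_mx1 mul1mx.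
Qed.

Lemma Wperp_lift x : Wperp z (horizontal x).
Proof.
apply/WperpP; rewrite !hdot_mul conjvK /horizontal; split.
  by rewrite mulmxA -trmx_mul Bzc trmx0 mul0mx mxE.
by rewrite mulmxA -trmx_mul Bz trmx0 mul0mx mxE.
Qed.

Lemma lift_surj (w : Cn) : Wperp z w -> exists u, w = horizontal (cvec u).
Proof.
move=> hw; exists (\row_k complex.Re ((cx B *m w) k 0), \row_k complex.Im ((cx B *m w) k 0)).
rewrite -{1}(BK hw) /horizontal; congr (_ *m _); apply/colP => k; rewrite [RHS]mxE !(mxE _ _ 0 k).
by case: ((cx B *m w) k 0).
Qed.

Definition Phi_fun (r s : R) u : M := of_tangent z (horizontal (cvec (rot r s u))).

Lemma of_tangent_is_linear (k : R) (x y : Cn) :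
  of_tangent z (k%:C%C *: x + y) = k *: of_tangent z x + of_tangent z y.
Proof.
apply/matrixP => i j; rewrite !mxE.
move: (x i 0) (x j 0) (y i 0) (y j 0) (z i 0) (z j 0).
by move=> [? ?] [? ?] [? ?] [? ?] [? ?] [? ?] /=; ring.
Qed.

Lemma Phi_fun_is_linear (r s : R) : linear (Phi_fun r s).
Proof.
move=> k u v; rewrite /Phi_fun -of_tangent_is_linear; congr of_tangent.
rewrite /horizontal scalemxAr -mulmxDr; congr (_ *m _).
by apply/colP => i; rewrite !mxE; apply/eqP; rewrite eq_complex /=; apply/andP; split; apply/eqP; ring.
Qed.
HB.instance Definition _ (r s : R) :=
  GRing.isLinear.Build R V M *:%R (Phi_fun r s) (Phi_fun_is_linear r s).

Definition Phi (r s : R) : 'Hom(V, M) := linfun (Phi_fun r s).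

Lemma PhiE (r s : R) u : Phi r s u = of_tangent z (horizontal (cvec (rot r s u))).
Proof. exact: lfunE. Qed.

Lemma Phi_rot (r s : R) u : Phi r s u = Phi 1 0 (rot r s u).
Proof. by rewrite !PhiE rot1. Qed.

Lemma to_Phi (r s : R) u : to_tangent z (Phi r s u) = horizontal (cvec (rot r s u)).
Proof. by rewrite PhiE of_tangentK //; exact: Wperp_lift. Qed.

Lemma Phi_mspace (r s : R) u : mspace z (Phi r s u).
Proof. by rewrite PhiE; apply: mspace_of_tangent hz _; exact: Wperp_lift. Qed.

Lemma mspace_Phi (r s : R) X : r ^+ 2 + s ^+ 2 = 1 -> mspace z X -> exists u, X = Phi r s u.
Proof.
move=> h hX; have [u hu] := lift_surj (Wperp_to_tangent hX).
by exists (rot r (- s) u); rewrite PhiE rotK // -hu to_tangentK.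
Qed.

Lemma inner_Phi (r s : R) u v : r ^+ 2 + s ^+ 2 = 1 ->
  inner z (Phi r s u) (Phi r s v) = ip u v.
Proof. by move=> h; rewrite /inner /rdot !to_Phi hdot_lift hdot_cvec /= ip_rot. Qed.

Lemma Phi_inj (r s : R) : r ^+ 2 + s ^+ 2 = 1 -> injective (Phi r s).
Proof.
move=> h u v e; apply/eqP; rewrite -subr_eq0; set w := u - v.
have : ip w w = 0 by rewrite -(inner_Phi _ _ h) /w linearB /= e subrr /inner /to_tangent /rdot
  /act map_mx0 mul0mx /hdot big1 // => k _; rewrite !mxE mul0r.
rewrite /ip => e0; have := dot_ge0 w.1; have := dot_ge0 w.2 => h1 h2.
apply/eqP; apply: pairP; apply/eqP; rewrite -dot_eq0; apply/eqP; lra.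
Qed.

Lemma lift_scale (a : R[i]) x : horizontal (a *: x) = a *: horizontal x.
Proof. by rewrite /horizontal scalemxAr. Qed.

Lemma J_Phi (r s : R) u : J z (Phi r s u) = Phi r s (Jpair u).
Proof.
rewrite JE to_Phi PhiE -lift_scale; congr (of_tangent z (horizontal _)).
by apply/colP => k; rewrite !mxE; apply/eqP; rewrite eq_complex /=; apply/andP; split; apply/eqP; ring.
Qed.

Lemma triple_lift (x y w : 'cV[R[i]]_m) : triple (horizontal x) (horizontal y) (horizontal w) = horizontal (triple x y w).
Proof.
by rewrite /triple !conjv_lift !hdot_lift -!lift_scale /horizontal -!mulmxDr -!mulmxBr.
Qed.

Lemma lie_triple_Phi (r s : R) u v w : r ^+ 2 + s ^+ 2 = 1 ->
  lie (lie (Phi r s u) (Phi r s v)) (Phi r s w) = 2 *: Phi r s (bracket u v w).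
Proof.
move=> h; rewrite -linearZ /= !PhiE lie_triple //; try exact: Wperp_lift.
rewrite triple_lift !hdot_lift -lift_scale /horizontal -mulmxBr -/(horizontal _); congr (of_tangent z (horizontal _)).
rewrite -cvec_bracket bracket_rot //; congr cvec.
by apply: pairP => /=; vring.
Qed.

Lemma lie_Phi (r s : R) u v : r ^+ 2 + s ^+ 2 = 1 ->
  lie (Phi r s u) (Phi r s v) = 0 <-> (forall w, bracket u v w = 0) /\ omega u v = 0.
Proof.
move=> h; split=> [e|[hT ho]].
  split=> [w|].
    apply: (Phi_inj h); rewrite linear0; apply: (@scalerI _ _ (2 : R)); first by rewrite pnatr_eq0.
    by rewrite -lie_triple_Phi // e /lie mul0mx mulmx0 subrr scaler0.
  have [zz _ _ _] := quadric_lift_perp hz.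
  have := act_lie_z hz (Wperp_lift (cvec (rot r s u))) (Wperp_lift (cvec (rot r s v))).
  rewrite -!PhiE e !hdot_lift => E.
  have : hdot (cvec (rot r s u)) (cvec (rot r s v)) -
         hdot (cvec (rot r s v)) (cvec (rot r s u)) = 0.
    by rewrite -[LHS]mulr1 -zz -hdotZl -E /act map_mx0 mul0mx -(scale0r z) hdotZl mul0r.
  rewrite !hdot_cvec => /(congr1 (@complex.Im R)) /=.
  by rewrite (omegaC (rot r s v)) omega_rot //; lra.
have eh : hdot (cvec (rot r s u)) (cvec (rot r s v)) =
          hdot (cvec (rot r s v)) (cvec (rot r s u)).
  by rewrite !hdot_cvec (omegaC (rot r s v)) (ipC (rot r s v)) omega_rot // ho !oppr0.
rewrite !PhiE; apply: lie_eq0 => //; try exact: Wperp_lift.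
  by rewrite !hdot_lift.
move=> x /lift_surj[w ->]; rewrite triple_lift -(rotK w h).
have := cvec_bracket (rot r s u) (rot r s v) (rot r s (rot r (- s) w)).
rewrite eh subrr scale0r subr0 => <-; rewrite bracket_rot // hT linear0 scaler0.
by apply/colP => k; rewrite !mxE big1 // => j _; rewrite !mxE mulr0.
Qed.

Lemma conjvZ k (a : R[i]) (x : 'cV[R[i]]_k) : conjv (a *: x) = conjc a *: conjv x.
Proof. by apply/colP => i; rewrite !mxE rmorphM. Qed.

(** The conjugation (r + i s)^2 conj fixes the real multiples of r + i s. *)
Lemma conj_Phi (r s : R) u : r ^+ 2 + s ^+ 2 = 1 ->
  of_tangent z ((r +i* s)%C ^+ 2 *: conjv (to_tangent z (Phi r s u))) = Phi r s (conj_pair u).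
Proof.
move=> h; rewrite to_Phi PhiE conjv_lift -lift_scale !cvec_rot conjvZ scalerA conjv_cvec.
congr (of_tangent z (horizontal (_ *: _))).
apply/eqP; rewrite expr2 eq_complex /=; apply/andP; split; apply/eqP.
  by rewrite -[RHS]mul1r -h; ring.
by rewrite -[RHS]mul1r -h; ring.
Qed.

Lemma norm_circle (r s : R) : `|(r +i* s)%C ^+ 2| = 1 <-> r ^+ 2 + s ^+ 2 = 1.
Proof.
have -> : `|(r +i* s)%C ^+ 2| = ((r ^+ 2 + s ^+ 2)%:C)%C.
  rewrite normrX sqr_normc; apply/eqP; rewrite eq_complex /=.
  by apply/andP; split; apply/eqP; ring.
by split=> [[]|->].
Qed.

Lemma conjugation_of_phase (r s : R) : r ^+ 2 + s ^+ 2 = 1 -> exists A, adapted Phi A r s.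
Proof.
move=> h; exists (fun X => of_tangent z ((r +i* s)%C ^+ 2 *: conjv (to_tangent z X))).
split=> //; last by move=> u; exact: conj_Phi.
apply/CQ_structureP => //; exists ((r +i* s)%C ^+ 2) => //.
exact/norm_circle.
Qed.

Lemma phase_of_conjugation A : CQ_structure z A -> exists r s, adapted Phi A r s.
Proof.
move=> hA; have [l l1 hl] := (CQ_structureP A hz).1 hA.
have := sqr_sqrtc l; case: (sqrtc l) => r s e.
have h : r ^+ 2 + s ^+ 2 = 1 by apply/norm_circle; rewrite e.
exists r, s; split=> // u; rewrite hl; last exact: Phi_mspace.
by rewrite -e conj_Phi.
Qed.

End WithB.
End Phi.

(** * Transfer to the tangent space *)

Local Open Scope classical_set_scope.

Section Frames.
Context {R : realType} {m : nat} (z : 'cV[R[i]]_m.+2).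
Local Notation M := ('M[R]_m.+2).
Local Notation E := ('rV[R]_m).
Local Notation V := (E * E)%type.
Implicit Types (u v w : V) (a b c d e f p q x y t : E) (X Y : M) (U : {vspace M}).

(** All that is used of the identification below. The phase of the coordinates
    is what the choice of a conjugation determines. *)
Record frames (Phi : R -> R -> 'Hom(V, M)) : Prop := Frames {
  fr_rot : forall r s u, Phi r s u = Phi 1 0 (rot r s u);
  fr_in : forall r s u, mspace z (Phi r s u);
  fr_surj : forall r s X, r ^+ 2 + s ^+ 2 = 1 -> mspace z X -> exists u, X = Phi r s u;
  fr_inj : forall r s, r ^+ 2 + s ^+ 2 = 1 -> injective (Phi r s);
  fr_inner : forall r s u v, r ^+ 2 + s ^+ 2 = 1 ->
    inner z (Phi r s u) (Phi r s v) = ip u v;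
  fr_J : forall r s u, J z (Phi r s u) = Phi r s (Jpair u);
  fr_lie_triple : forall r s u v w, r ^+ 2 + s ^+ 2 = 1 ->
    lie (lie (Phi r s u) (Phi r s v)) (Phi r s w) = 2 *: Phi r s (bracket u v w);
  fr_lie : forall r s u v, r ^+ 2 + s ^+ 2 = 1 ->
    lie (Phi r s u) (Phi r s v) = 0 <-> (forall w, bracket u v w = 0) /\ omega u v = 0;
  fr_ex1 : forall r s, r ^+ 2 + s ^+ 2 = 1 -> exists A, adapted z Phi A r s;
  fr_ex2 : forall A, CQ_structure z A -> exists r s, adapted z Phi A r s }.

Lemma frames_exist : quadric_lift z -> exists Phi, frames Phi.
Proof.
move=> hz; have [B [BB Bz Bzc BK]] := basis_exists hz.
exists (Phi z B); split.
- move=> r s u; exact: Phi_rot.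
- move=> r s u; exact: Phi_mspace.
- move=> r s X; exact: mspace_Phi.
- move=> r s; exact: Phi_inj.
- move=> r s u v; exact: inner_Phi.
- move=> r s u; exact: J_Phi.
- move=> r s u v w; exact: lie_triple_Phi.
- move=> r s u v; exact: lie_Phi.
- move=> r s; exact: conjugation_of_phase.
- move=> A; exact: phase_of_conjugation.
Qed.

Section WithPhi.
Variables (Phi : R -> R -> 'Hom(V, M)) (F : frames Phi).

Definition pull (r s : R) U : {vspace V} := (Phi r s @^-1: U)%VS.

Lemma mem_pull (r s : R) U u : (u \in pull r s U) = (Phi r s u \in U).
Proof. by rewrite -memv_preim. Qed.

Lemma pull_rot (r s : R) U : pull r s U = rotate_space r s (pull 1 0 U).
Proof. by apply/vspaceP => u; rewrite mem_rotate_space !mem_pull (fr_rot F). Qed.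

Lemma unit10 : (1 : R) ^+ 2 + 0 ^+ 2 = 1.
Proof. by rewrite expr1n expr0n addr0. Qed.

Section At.
Variables (r s : R) (h : r ^+ 2 + s ^+ 2 = 1).
Local Notation phi := (Phi r s).
Local Notation pl := (pull r s).

Lemma ker_phi : lker phi == 0%VS.
Proof. by apply/lker0P; exact: (fr_inj F). Qed.

Lemma img_pull U : [set` U] `<=` mspace z -> (phi @: pl U)%VS = U.
Proof.
move=> hU; apply: lpreimK; apply/subvP => X hX.
by have [u ->] := fr_surj F h (hU _ hX); rewrite memv_img ?memvf.
Qed.

Lemma pull_img (N : {vspace V}) : pl (phi @: N) = N.
Proof.
apply/vspaceP => u; rewrite mem_pull; apply/memv_imgP/idP => [[v hv]|hu]; last by exists u.
by move/(fr_inj F h) => ->.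
Qed.

Lemma dim_img (N : {vspace V}) : \dim (phi @: N) = \dim N.
Proof. by apply: limg_dim_eq; rewrite (eqP ker_phi) capv0. Qed.

Lemma dim_pull U : [set` U] `<=` mspace z -> \dim (pl U) = \dim U.
Proof. by move=> hU; rewrite -dim_img img_pull. Qed.

Lemma img_mspace (N : {vspace V}) : [set` (phi @: N)%VS] `<=` mspace z.
Proof. by move=> _ /memv_imgP[u _ ->]; exact: (fr_in F). Qed.

Lemma pullP U X : [set` U] `<=` mspace z -> X \in U -> exists2 u, u \in pl U & X = phi u.
Proof.
move=> hU hX; have [u e] := fr_surj F h (hU _ hX).
by exists u; rewrite // mem_pull -e.
Qed.

Lemma LTS_pull U : [set` U] `<=` mspace z -> Lie_triple_system z U <-> model_lts (pl U).
Proof.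
move=> hU; split=> [[_ hl] u v w|hl].
  rewrite !mem_pull => hu hv hw; have := hl _ _ _ hu hv hw.
  rewrite (fr_lie_triple F) // => /(memvZ 2^-1); rewrite scalerK ?pnatr_eq0 //.
split=> // X Y Z /(pullP hU)[u hu ->] /(pullP hU)[v hv ->] /(pullP hU)[w hw ->].
by rewrite (fr_lie_triple F) // memvZ // -mem_pull; exact: hl.
Qed.

Lemma treal_pull U : [set` U] `<=` mspace z -> totally_real z U <-> model_treal (pl U).
Proof.
have e u v : inner z (J z (phi u)) (phi v) = omega u v.
  by rewrite (fr_J F) (fr_inner F) // /ip /omega /Jpair /= dotNl addrC.
move=> hU; split=> [ht u v|ht X Y /(pullP hU)[u hu ->] /(pullP hU)[v hv ->]].
  by rewrite !mem_pull -e; exact: ht.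
by rewrite e; exact: ht.
Qed.

Lemma complex_pull U : [set` U] `<=` mspace z -> complex_subspace z U <-> model_complex (pl U).
Proof.
move=> hU; split=> [hc u|hc].
  rewrite !mem_pull => hu; rewrite -(fr_J F) -hc; exact: memv_img.
apply/vspaceP => X; apply/memv_imgP/idP => [[Y /(pullP hU)[u hu ->] ->]|/(pullP hU)[u hu ->]].
  by rewrite (fr_J F) -mem_pull; exact: hc.
exists (phi (- Jpair u)); first by rewrite -mem_pull memvN; exact: hc.
by rewrite (fr_J F); congr (phi _); apply: pairP; rewrite /= ?opprK.
Qed.

Lemma rank_pull U k : [set` U] `<=` mspace z -> model_rank (pl U) k -> has_rank U k.
Proof.
move=> hU [[N [sN hN dN]] hmax]; split.
  exists (phi @: N)%VS; last by rewrite dim_img.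
  split; first by rewrite -(img_pull hU) limgS.
  move=> _ _ /memv_imgP[u hu ->] /memv_imgP[v hv ->].
  by apply/(fr_lie F) => //; exact: hN.
move=> a [sa ha]; have ham : [set` a] `<=` mspace z.
  by move=> X hX; apply: hU; exact: (subvP sa).
rewrite -(dim_pull ham); apply: hmax; first exact: lpreimS.
by move=> u v hu hv; apply/(fr_lie F u v h)/ha; rewrite -mem_pull.
Qed.

Lemma pull_full U : [set` U] `<=` mspace z -> ([set` U] `<` mspace z <-> pl U != fullv).
Proof.
move=> hU; split=> [[_ hn]|hn].
  apply/eqP => e; apply: hn => X hX; have [u ->] := fr_surj F h hX.
  by rewrite /= -mem_pull e memvf.
split=> // hs; move/eqP: hn; apply; apply/vspaceP => u.
by rewrite memvf mem_pull; apply: hs; exact: (fr_in F).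
Qed.

(** Every bracket-closed subspace of pairs is the preimage of its image, so the
    two notions quantify over the same subspaces. *)
Lemma maximal_pull U : [set` U] `<=` mspace z -> maximal_LTS z U <-> model_maximal (pl U).
Proof.
move=> hU; split=> [[h1 h2 h3]|[h1 h2 h3]].
  split; [exact/LTS_pull|exact/pull_full|] => N hN sN.
  apply: contrapT => /not_orP[n1 n2]; apply: h3; exists (phi @: N)%VS; split.
  - by apply/(LTS_pull (@img_mspace N)); rewrite pull_img.
  - split=> [X hX|hs]; first by rewrite /= -(img_pull hU) in hX *; exact: (subvP (limgS _ sN)).
    apply: n1; apply/eqP; rewrite eqEsubv sN andbT; apply/subvP => u hu.
    by rewrite mem_pull; apply: hs; exact: memv_img.
  - by apply/(pull_full (@img_mspace N)); rewrite pull_img; apply/eqP.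
split; [exact/LTS_pull|exact/pull_full|] => -[W [w1 w2 w3]].
have hW : [set` W] `<=` mspace z by case: w1.
have [| |e|e] := h3 (pl W); first exact/LTS_pull.
- by apply/subvP => u; rewrite !mem_pull; exact: w2.1.
- by case: w2 => _; apply=> X; rewrite /= -(img_pull hU) -e img_pull.
- by move/(pull_full hW): w3; rewrite e eqxx.
Qed.

Lemma J_involutive X : mspace z X -> J z (J z X) = - X.
Proof.
by move=> hX; have [u ->] := fr_surj F h hX; rewrite !(fr_J F) JpairK linearN.
Qed.

Lemma cbasisP U k (b : 'I_k -> M) : cbasis (J z) U b <-> complex_basis z U b.
Proof.
have e (a c : 'I_k -> R) : ccomb (J z) b a c = \sum_j Defs.cscale z (a j +i* c j)%C (b j) by [].
have e' (a : 'I_k -> R[i]) : \sum_j Defs.cscale z (a j) (b j) =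
    ccomb (J z) b (fun j => complex.Re (a j)) (fun j => complex.Im (a j)) by [].
split=> -[h1 h2]; split.
- move=> X; rewrite h1; split=> [[a [c ->]]|[a ->]].
    by exists (fun j => a j +i* c j)%C.
  by eexists _, _; exact: e'.
- by move=> a; rewrite e' => /h2 h3 j; have [] := h3 j; case: (a j) => ? ? /= -> ->.
- move=> X; rewrite h1; split=> [[a ->]|[a [c ->]]].
    by eexists _, _; exact: e'.
  by exists (fun j => a j +i* c j)%C.
by move=> a c; rewrite e => /h2 h3 j; have [] := h3 j.
Qed.

Lemma cdim_dim U k : has_cdim z U k -> \dim U = (2 * k)%N.
Proof. by move=> [b /cbasisP]; exact: cbasis_dim. Qed.

Lemma cdim_exists U k : [set` U] `<=` mspace z -> complex_subspace z U ->
  \dim U = (2 * k)%N -> has_cdim z U k.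
Proof.
move=> hU hc dU; have [|k' [b hb]] := @cbasis_exists R M (J z) U.
  move=> X hX; split; last exact: J_involutive (hU _ hX).
  by rewrite -hc; exact: memv_img.
have := cbasis_dim hb; rewrite dU => /eqP; rewrite eqn_pmul2l // => /eqP e.
by subst k'; exists b; apply/cbasisP.
Qed.

End At.
End WithPhi.
End Frames.

Section Types.
Context {R : realType} {m : nat} (z : 'cV[R[i]]_m.+2).
Local Notation M := ('M[R]_m.+2).
Local Notation E := ('rV[R]_m).
Local Notation V := (E * E)%type.
Implicit Types (u v w : V) (a b c d e f p q x y t : E) (X Y : M) (U : {vspace M}).
Implicit Types (W : {vspace E}).
Variables (Phi : R -> R -> 'Hom(V, M)) (F : frames z Phi).

Section Iso.
Variables (r s : R) (h : r ^+ 2 + s ^+ 2 = 1).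
Local Notation phi := (Phi r s).
Local Notation pl := (pull Phi r s).

(** Isotropy of a vector can be tested with any conjugation of the circle:
    another one is adapted to coordinates that differ by a phase. *)
Lemma isotropic_phi u : isotropic_vector z (phi u) <-> isotropic_pair u.
Proof.
have key A r' s' v : adapted z Phi A r' s' ->
    cinner z (Phi r' s' v) (A (Phi r' s' v)) = 0 <-> isotropic_pair v.
  move=> [_ h' hA]; rewrite hA /cinner (fr_J F) !(fr_inner F) // /ip /isotropic_pair /= opprK.
  rewrite dotNr (dotC v.2 v.1); split=> [[e1 e2]|[-> ->]].
    by split; lra.
  by rewrite subrr addr0.
split=> [[A hA hc]|hu]; last first.
  by have [A hA] := fr_ex1 F h; exists A; [case: hA|apply/(key A)].
have [r' [s' ha]] := fr_ex2 F hA; have [_ h' _] := ha.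
have [v e] := fr_surj F h' (fr_in F r s u).
move: hc; rewrite e => /(key _ _ _ _ ha) hv.
have e' : rot r s u = rot r' s' v.
  by apply: (fr_inj F unit10); rewrite -!(fr_rot F).
rewrite -(rotNK u h) e'; apply: isotropic_pair_rot; first by rewrite sqrrN.
exact: isotropic_pair_rot.
Qed.

Lemma isotropic_pull U : [set` U] `<=` mspace z -> isotropic z U <-> model_isotropic (pl U).
Proof.
move=> hU; split=> [hi u|hi X /(pullP F h hU)[u hu ->]].
  by rewrite mem_pull => /hi /isotropic_phi.
by apply/isotropic_phi/hi.
Qed.

Lemma I1_pull U k : type_I1 z k U -> (1 <= k)%N /\ model_I1 k (pl U).
Proof.
move=> [k1 _ hU [hc hi hd]]; split=> //; split.
- exact/(complex_pull F).
- exact/isotropic_pull.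
- by rewrite (dim_pull F) // (cdim_dim hd).
Qed.

Lemma pull_I1 U k : [set` U] `<=` mspace z -> (1 <= k)%N -> model_I1 k (pl U) -> type_I1 z k U.
Proof.
move=> hU k1 [hc hi dU]; have c := (complex_pull F h hU).2 hc.
rewrite (dim_pull F) // in dU.
have : (\dim (pl U) <= m)%N by exact: dim_iso.
rewrite (dim_pull F) // dU => km; split=> //; split=> //.
  exact/isotropic_pull.
exact: (cdim_exists F h).
Qed.

Lemma I2_pull U k : type_I2 z k U -> (1 <= k)%N /\ model_I2 k (pl U).
Proof.
move=> [k1 _ hU [ht hi hd]]; split=> //; split.
- exact/(treal_pull F).
- exact/isotropic_pull.
- by rewrite (dim_pull F).
Qed.

Lemma pull_I2 U k : [set` U] `<=` mspace z -> (1 <= k)%N -> model_I2 k (pl U) -> type_I2 z k U.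
Proof.
move=> hU k1 [ht hi dU]; have := dim_iso_treal hi ht; rewrite dU => km.
rewrite (dim_pull F) // in dU.
by split=> //; split=> //; [exact/(treal_pull F h hU)|exact/isotropic_pull].
Qed.

Lemma Geo_pull U : type_Geo z U -> model_Geo (pl U).
Proof.
move=> [X [hX h1 ->]]; have [u e] := fr_surj F h hX.
exists u; last by rewrite e -limg_line (pull_img F).
apply: contra_eq_neq h1 => u0; rewrite e u0 (fr_inner F) // /ip /= !dot0l addr0.
by rewrite eq_sym oner_neq0.
Qed.

Lemma pull_Geo U : [set` U] `<=` mspace z -> model_Geo (pl U) -> type_Geo z U.
Proof.
move=> hU [u u0 e]; have eU : U = <[phi u]>%VS by rewrite -(img_pull F h hU) e limg_line.
have i0 : 0 < ip u u.
  rewrite lt_def /ip addr_ge0 ?dot_ge0 // andbT; apply: contraNneq u0 => e0.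
  have := dot_ge0 u.1; have := dot_ge0 u.2 => h1 h2.
  by apply/eqP; apply: pairP; apply/eqP; rewrite -dot_eq0; apply/eqP; lra.
pose n := Num.sqrt (ip u u); have n0 : 0 < n by rewrite sqrtr_gt0.
have nn : n * n = ip u u by rewrite -expr2 sqr_sqrtr // ltW.
exists (phi (n^-1 *: u)); split; first exact: (fr_in F).
  rewrite (fr_inner F) // /ip /= !dotE.
  have -> : n^-1 * (n^-1 * dot u.1 u.1) + n^-1 * (n^-1 * dot u.2 u.2) = n^-1 * n^-1 * ip u u.
    by rewrite /ip; ring.
  by rewrite -nn; field; rewrite gt_eqF.
rewrite eU linearZ; apply/eqP; rewrite eqEsubv -!memvE; apply/andP; split.
  apply/vlineP; exists n; rewrite scalerA mulfV ?scale1r // gt_eqF //.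
by rewrite memvZ // memv_line.
Qed.

End Iso.

Section Adapted.
Variables (A : M -> M) (r s : R) (hA : adapted z Phi A r s).
Local Notation phi := (Phi r s).
Local Notation pl := (pull Phi r s).
Let h : r ^+ 2 + s ^+ 2 = 1. Proof. by case: hA. Qed.
Let CQ : CQ_structure z A. Proof. by case: hA. Qed.
Let Aphi u : A (phi u) = phi (conj_pair u). Proof. by case: hA. Qed.

Lemma VspaceP X : Vspace z A X <-> exists a, X = phi (a, 0).
Proof.
split=> [[hX e]|[a ->]]; last first.
  by split; [exact: (fr_in F)|rewrite Aphi /conj_pair /= oppr0].
have [[a b] eX] := fr_surj F h hX; exists a.
move: e; rewrite eX Aphi => /(fr_inj F h)[/esym/eqP].
rewrite -subr_eq0 opprK -mulr2n -scaler_nat scaler_eq0 pnatr_eq0 /= => /eqP ->.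
by [].
Qed.

Lemma Jphi1 a : J z (phi (a, 0)) = phi (0, a).
Proof. by rewrite (fr_J F) /Jpair /= oppr0. Qed.

Lemma phi12 a b : phi (a, b) = phi (a, 0) + phi (0, b).
Proof. by rewrite -linearD; congr (phi _); apply: pairP; rewrite /= ?addr0 ?add0r. Qed.

Lemma inner11 a b : inner z (phi (a, 0)) (phi (b, 0)) = dot a b.
Proof. by rewrite (fr_inner F) // /ip /= dot0l addr0. Qed.

(** U is invariant under J and the conjugation, so it contains the real and the
    imaginary part of each of its elements. *)
Lemma G1_pull k U : [set` U] `<=` mspace z -> complex_subspace z U -> has_cdim z U k ->
  (forall X, X \in U -> A X \in U) -> model_G1 k (pl U).
Proof.
move=> hU hc hd hAU.
have e : pl U = prodv (real_slice (pl U)) (real_slice (pl U)).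
  have hc' := (complex_pull F h hU).1 hc.
  apply/vspaceP => -[a b]; rewrite mem_prodv !mem_real_slice /=.
  have j c : (c, 0) \in pl U -> (0, c) \in pl U by move=> /hc'; rewrite /Jpair /= oppr0.
  have j' c : (0, c) \in pl U -> (c, 0) \in pl U by move=> /hc'; rewrite -memvN; congr (_ \in pl U); apply: pairP; rewrite /= ?opprK ?oppr0.
  apply/idP/andP => [hab|[ha /j hb]]; last exact: (mem_slices ha hb).
  have hab' : conj_pair (a, b) \in pl U by rewrite mem_pull -Aphi hAU // -mem_pull.
  split.
    have := memvZ 2^-1 (memvD hab hab'); congr (_ \in pl U).
    by apply: pairP => /=; apply/rowP => i; rewrite !mxE; field.
  apply: j'; have := memvZ 2^-1 (memvB hab hab'); congr (_ \in pl U).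
  by apply: pairP => /=; apply/rowP => i; rewrite !mxE; field.
exists (real_slice (pl U)) => //.
have := dim_pull F h hU; rewrite {1}e dim_prodv (cdim_dim hd) addnn -mul2n.
by move/eqP; rewrite eqn_pmul2l // => /eqP.
Qed.

Lemma pull_G1 k U : [set` U] `<=` mspace z -> (2 <= k <= m - 1)%N -> model_G1 k (pl U) -> type_G1 z k U.
Proof.
move=> hU hk [W dW e].
have dU : \dim U = (2 * k)%N by rewrite -(dim_pull F h hU) e dim_prodv dW mul2n addnn.
have hc : complex_subspace z U.
  by apply/(complex_pull F h hU) => u; rewrite e !mem_prodv /= memvN andbC.
split=> //; last exact: (cdim_exists F h).
split=> //; exists A => // X /(pullP F h hU)[u hu ->].
by move: hu; rewrite Aphi -mem_pull e !mem_prodv /= memvN.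
Qed.

(** The subspace of V(A) with coordinates in W. *)
Definition real_img (W : {vspace E}) : {vspace M} := (phi @: (linfun (@real_part_inj R m) @: W))%VS.

Lemma real_imgP W X : reflect (exists2 a, a \in W & X = phi (a, 0)) (X \in real_img W).
Proof.
apply: (iffP memv_imgP) => [[u /memv_imgP[a ha ->] ->]|[a ha ->]].
  by exists a => //; rewrite lfunE.
by exists (a, 0) => //; apply/memv_imgP; exists a => //; rewrite lfunE.
Qed.

Lemma dim_real_img W : \dim (real_img W) = \dim W.
Proof.
rewrite (dim_img F h); apply: limg_dim_eq; apply/eqP; rewrite -subv0; apply/subvP => a.
by rewrite memv_cap memv_ker lfunE memv0 => /andP[_ /eqP[->]].
Qed.

Lemma real_img_sl1 (W : {vspace M}) : [set` W] `<=` Vspace z A -> real_img (real_slice (pl W)) = W.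
Proof.
move=> hW; apply/vspaceP => X; apply/real_imgP/idP => [[a + ->]|hX].
  by rewrite mem_real_slice mem_pull.
by have /VspaceP[a e] := hW _ hX; exists a; rewrite // mem_real_slice mem_pull -e.
Qed.

Lemma real_img_Vspace W : [set` real_img W] `<=` Vspace z A.
Proof. by move=> X /real_imgP[a _ ->]; apply/VspaceP; exists a. Qed.

Lemma prodv_img W1 W2 : (phi @: prodv W1 W2)%VS = (real_img W1 + J z @: real_img W2)%VS.
Proof.
apply/vspaceP => X; apply/memv_imgP/memv_addP => [[[a b]]|].
  rewrite mem_prodv /= => /andP[ha hb] ->; rewrite phi12.
  exists (phi (a, 0)); first by apply/real_imgP; exists a.
  exists (phi (0, b)) => //; rewrite -Jphi1; apply: memv_img.
  by apply/real_imgP; exists b.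
move=> [_ /real_imgP[a ha ->] [_ /memv_imgP[_ /real_imgP[b hb ->] ->] ->]].
by exists (a, b); rewrite ?mem_prodv /= ?ha // Jphi1 -phi12.
Qed.

Lemma cap_img W1 W2 : (real_img W1 :&: J z @: real_img W2 = 0)%VS.
Proof.
apply/eqP; rewrite -subv0; apply/subvP => X /memv_capP[/real_imgP[a ha ->]].
move=> /memv_imgP[_ /real_imgP[b hb ->]]; rewrite Jphi1 => /(fr_inj F h)[-> _].
by rewrite memv0 linear0.
Qed.

Lemma G2_pull k1 k2 (U W1 W2 : {vspace M}) :
  [set` W1] `<=` Vspace z A -> [set` W2] `<=` Vspace z A ->
  \dim W1 = k1 -> \dim W2 = k2 ->
  (forall X Y, X \in W1 -> Y \in W2 -> inner z X Y = 0) ->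
  direct_sum U W1 (J z @: W2)%VS -> model_G2 k1 k2 (pl U).
Proof.
move=> s1 s2 d1 d2 o [eU _]; exists (real_slice (pl W1)), (real_slice (pl W2)); split.
- by rewrite -dim_real_img real_img_sl1.
- by rewrite -dim_real_img real_img_sl1.
- by move=> a b; rewrite !mem_real_slice !mem_pull -inner11; exact: o.
- have := real_img_sl1 s1; have := real_img_sl1 s2.
  move: (real_slice (pl W1)) (real_slice (pl W2)) => N1 N2 e2 e1.
  by rewrite eU -e1 -e2 -prodv_img (pull_img F).
Qed.

Lemma pull_G2 k1 k2 U : [set` U] `<=` mspace z -> (1 <= k1)%N -> (1 <= k2)%N ->
  model_G2 k1 k2 (pl U) -> type_G2 z k1 k2 U.
Proof.
move=> hU k1p k2p [W1 [W2 [d1 d2 o e]]]; split=> //.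
  rewrite -d1 -d2 -dimv_disjoint_sum; first exact: dim_W.
  apply/eqP; rewrite -subv0; apply/subvP => w /memv_capP[h1 h2].
  by rewrite memv0 -dot_eq0 (o w w).
exists A, (real_img W1), (real_img W2); split=> //.
- by split; exact: real_img_Vspace.
- by rewrite !dim_real_img.
- by move=> _ _ /real_imgP[a ha ->] /real_imgP[b hb ->]; rewrite inner11; exact: o.
- by split; [rewrite -prodv_img -e (img_pull F)|exact: cap_img].
Qed.

Lemma P1_pull k U : [set` U] `<=` Vspace z A -> \dim U = k -> model_P1 k (pl U).
Proof.
move=> hU dU; exists (real_slice (pl U)).
  by rewrite -dim_real_img real_img_sl1.
apply/vspaceP => -[a b]; rewrite mem_prodv mem_real_slice memv0 !mem_pull /=.
apply/idP/andP => [hab|[h1 /eqP ->//]].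
have /VspaceP[c /(fr_inj F h)[_ b0]] := hU _ hab.
by rewrite -b0 eqxx hab.
Qed.

Lemma pull_P1 k U : [set` U] `<=` mspace z -> (1 <= k)%N -> model_P1 k (pl U) -> type_P1 z k U.
Proof.
move=> hU k1 [W dW e]; split; first by rewrite k1 -dW dim_W.
exists A; split=> //; last by rewrite -(dim_pull F h hU) e dim_prodv dimv0 addn0.
move=> X /(pullP F h hU)[[a b]]; rewrite e mem_prodv memv0 /= => /andP[_ /eqP->] ->.
by apply/VspaceP; exists a.
Qed.

Lemma orthonormal2 a b : Defs.orthonormal z [:: phi (a, 0); phi (b, 0)] <->
  [/\ dot a a = 1, dot b b = 1 & dot a b = 0].
Proof.
split=> [ho|[h1 h2 h3]].
  split; [have := ho 0%N 0%N isT isT|have := ho 1%N 1%N isT isT|have := ho 0%N 1%N isT isT];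
    by rewrite /= inner11.
by move=> [|[|//]] [|[|//]] _ _; rewrite /= inner11 // dotC.
Qed.

Lemma orthonormal3 a b c : Defs.orthonormal z [:: phi (a, 0); phi (b, 0); phi (c, 0)] <->
  [/\ dot a a = 1, dot b b = 1 & dot c c = 1] /\
  [/\ dot a b = 0, dot a c = 0 & dot b c = 0].
Proof.
split=> [ho|[[h1 h2 h3] [h4 h5 h6]]].
  split; split; [have := ho 0%N 0%N isT isT|have := ho 1%N 1%N isT isT|have := ho 2%N 2%N isT isT
    |have := ho 0%N 1%N isT isT|have := ho 0%N 2%N isT isT|have := ho 1%N 2%N isT isT];
    by rewrite /= inner11.
by move=> [|[|[|//]]] [|[|[|//]]] _ _; rewrite /= inner11 // dotC.
Qed.

Lemma P2_img a : (phi @: prodv <[a]> <[a]>)%VS = cline z (phi (a, 0)).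
Proof.
rewrite /cline Jphi1 -!limg_line -limgD; congr (phi @: _)%VS.
apply/vspaceP => -[c d]; rewrite mem_prodv /=; apply/andP/mem2P.
  move=> [/vlineP[k ->] /vlineP[l ->]]; exists k, l.
  by apply: pairP => /=; vring.
move=> [k [l [-> ->]]]; split; apply/vlineP; [exists k|exists l]; vring.
Qed.

Lemma P2_pull U X : Vspace z A X -> inner z X X = 1 -> U = cline z X -> model_P2 (pl U).
Proof.
move=> /VspaceP[a ->]; rewrite inner11 => aa ->; exists a => //.
by rewrite -P2_img (pull_img F).
Qed.

Lemma pull_P2 U : [set` U] `<=` mspace z -> model_P2 (pl U) -> type_P2 z U.
Proof.
move=> hU [a aa e]; exists A, (phi (a, 0)); split=> //; first by apply/VspaceP; exists a.
  by rewrite inner11.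
by rewrite -P2_img -e (img_pull F).
Qed.

Lemma phiD u v : phi u + phi v = phi (u + v).
Proof. by rewrite linearD. Qed.
Lemma phiB u v : phi u - phi v = phi (u - v).
Proof. by rewrite linearB. Qed.
Lemma phiZ (k : R) u : k *: phi u = phi (k *: u).
Proof. by rewrite linearZ. Qed.

Lemma G3_vec1 a b : phi (a, 0) - J z (phi (b, 0)) = phi (a, - b).
Proof. by rewrite Jphi1 phiB; congr (phi _); apply: pairP => /=; vring. Qed.

Lemma G3_vec2 a b : phi (a, 0) + J z (phi (b, 0)) = phi (a, b).
Proof. by rewrite Jphi1 phiD; congr (phi _); apply: pairP => /=; vring. Qed.

(** The generators x - J y, y + J x, x + J y are (x, -y), (y, x), (x, y) in
    coordinates. *)
Lemma G3_img a b : (phi @: space_G3 a b)%VS =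
  (cline z (phi (a, 0) - J z (phi (b, 0)))%R + <[(phi (a, 0) + J z (phi (b, 0)))%R]>)%VS.
Proof.
rewrite /cline G3_vec1 G3_vec2 (fr_J F) /Jpair /= opprK -!limg_line -!limgD; congr (phi @: _)%VS.
apply/vspaceP => u; apply/mem3P/mem3P => -[k [l [n ->]]].
  exists ((k - l) / 2), n, ((k + l) / 2).
  by apply: pairP => /=; apply/rowP => i; rewrite !mxE; field.
exists (k + n), (n - k), l.
by apply: pairP => /=; apply/rowP => i; rewrite !mxE; ring.
Qed.

Lemma G3_cap a b : dot a a = 1 -> dot b b = 1 -> dot a b = 0 ->
  (cline z (phi (a, 0) - J z (phi (b, 0)))%R :&: <[(phi (a, 0) + J z (phi (b, 0)))%R]> = 0)%VS.
Proof.
move=> aa bb ab; have ba : dot b a = 0 by rewrite dotC.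
apply/eqP; rewrite -subv0; apply/subvP => X /memv_capP[].
rewrite /cline G3_vec1 G3_vec2 (fr_J F) /Jpair /= opprK => /mem2P[k [l ->]] /vlineP[n].
rewrite !phiZ phiD => /(fr_inj F h) e.
have /= /(congr1 (dot a)) := congr1 fst e; have /= /(congr1 (dot b)) := congr1 snd e.
have /= /(congr1 (dot b)) := congr1 fst e.
rewrite !dotE aa bb ab ba => e1 e2 e3.
have -> : k = 0 by lra.
have -> : l = 0 by lra.
by rewrite !scale0r addr0 linear0 memv0.
Qed.

Lemma G3_pull U X Y : Vspace z A X -> Vspace z A Y -> Defs.orthonormal z [:: X; Y] ->
  direct_sum U (cline z (X - J z Y)) <[X + J z Y]>%VS -> model_G3 (pl U).
Proof.
move=> /VspaceP[a ->] /VspaceP[b ->] /orthonormal2[aa bb ab] [eU _].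
by exists a, b; split=> //; rewrite eU -G3_img (pull_img F).
Qed.

Lemma pull_G3 U : [set` U] `<=` mspace z -> model_G3 (pl U) -> type_G3 z U.
Proof.
move=> hU [a [b [aa bb ab e]]]; exists A, (phi (a, 0)), (phi (b, 0)); split=> //.
- by apply/VspaceP; exists a.
- by apply/VspaceP; exists b.
- exact/orthonormal2.
- by split; [rewrite -G3_img -e (img_pull F)|exact: G3_cap].
Qed.

Lemma A_vec1 a b : 2 *: phi (a, 0) + J z (phi (b, 0)) = phi (2 *: a, b).
Proof. by rewrite Jphi1 phiZ phiD; congr (phi _); apply: pairP => /=; vring. Qed.

Lemma A_vec2 a b c : phi (b, 0) + J z (phi (a, 0)) + Num.sqrt 3 *: J z (phi (c, 0)) =
  phi (b, a + Num.sqrt 3 *: c).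
Proof. by rewrite !Jphi1 phiZ !phiD; congr (phi _); apply: pairP => /=; vring. Qed.

Lemma A_pull U X Y Z : Vspace z A X -> Vspace z A Y -> Vspace z A Z ->
  Defs.orthonormal z [:: X; Y; Z] ->
  direct_sum U <[2 *: X + J z Y]>%VS <[Y + J z X + Num.sqrt 3 *: J z Z]>%VS -> model_A (pl U).
Proof.
move=> /VspaceP[a ->] /VspaceP[b ->] /VspaceP[c ->] /orthonormal3[n1 n2] [eU _].
exists a, b, c; split=> //.
by rewrite eU A_vec1 A_vec2 -!limg_line -limgD (pull_img F).
Qed.

Lemma pull_A U : [set` U] `<=` mspace z -> model_A (pl U) -> type_A z U.
Proof.
move=> hU [a [b [c [n1 n2 e]]]]; exists A, (phi (a, 0)), (phi (b, 0)), (phi (c, 0)); split=> //.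
- by split; apply/VspaceP; [exists a|exists b|exists c].
- exact/orthonormal3.
rewrite A_vec1 A_vec2; split.
  by rewrite -!limg_line -limgD -/(space_A a b c) -e (img_pull F).
have [[aa bb _] [ab _ _]] := (n1, n2).
apply/eqP; rewrite -subv0; apply/subvP => X /memv_capP[/vlineP[k ->] /vlineP[l]].
rewrite !phiZ => /(fr_inj F h) /(congr1 fst) /= /(congr1 (dot a)).
rewrite !dotE aa ab => k0; have -> : k = 0 by lra.
by rewrite scale0r linear0 memv0.
Qed.

End Adapted.
End Types.

(** * The theorem *)

Section Main.
Context (R : realType) (m : nat) (hm : (2 <= m)%N) (z : 'cV[R[i]]_m.+2).
Context (Phi : R -> R -> 'Hom(('rV[R]_m * 'rV[R]_m)%type, 'M[R]_m.+2)) (F : frames z Phi).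
Context (U : {vspace 'M[R]_m.+2}) (hU0 : U != 0%VS) (hU : [set` U] `<` mspace z).

Let hUm : [set` U] `<=` mspace z. Proof. by case: hU. Qed.

Lemma transfer (r s : R) (h : r ^+ 2 + s ^+ 2 = 1) k j :
  model_lts (pull Phi r s U) -> \dim (pull Phi r s U) = k -> model_rank (pull Phi r s U) j ->
  [/\ Lie_triple_system z U, \dim U = k & has_rank U j].
Proof.
move=> h1 h2 h3; split; first exact/(LTS_pull F h hUm).
  by rewrite -(dim_pull F h hUm).
exact: (rank_pull F h hUm).
Qed.

(** The phase found by [classify] determines the conjugation A that appears in
    the type. *)
Lemma types_of_LTS : Lie_triple_system z U ->
     type_Geo z U \/ (exists k, type_G1 z k U) \/ (exists k1 k2, type_G2 z k1 k2 U) \/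
     type_G3 z U \/ (exists k, type_P1 z k U) \/ type_P2 z U \/ type_A z U \/
     (exists k, type_I1 z k U) \/ (exists k, type_I2 z k U).
Proof.
move=> /(LTS_pull F (unit10) hUm) hl.
have N0 : pull Phi 1 0 U != 0%VS by rewrite -dimv_eq0 (dim_pull F unit10 hUm) dimv_eq0.
have [r [s [h]]] := classify hl N0; rewrite -(pull_rot F).
have [A ad] := fr_ex1 F h.
have Nf := (pull_full F h hUm).1 hU.
case=> [hG|]; first by left; exact: (pull_Geo F h).
case=> [[k k2 hG]|].
  right; left; exists k; apply: (pull_G1 F ad) => //.
  rewrite k2 /=; have [W dW e] := hG.
  suff : (k < m)%N by lia.
  rewrite -dW ltnNge; apply: contra Nf => /dim_full W1.
  by rewrite e W1 prodv_full.
case=> [[k1 [k2 [h1 h2 hG]]]|].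
  by do 2 right; left; exists k1, k2; exact: (pull_G2 F ad).
case=> [hG|]; first by do 3 right; left; exact: (pull_G3 F ad).
case=> [[k k1 hG]|]; first by do 4 right; left; exists k; exact: (pull_P1 F ad).
case=> [hG|]; first by do 5 right; left; exact: (pull_P2 F ad).
case=> [hG|]; first by do 6 right; left; exact: (pull_A F ad).
case=> -[k k1 hG]; first by do 7 right; left; exists k; exact: (pull_I1 F h).
by do 8 right; exists k; exact: (pull_I2 F h).
Qed.

Lemma Geo_props : type_Geo z U -> Lie_triple_system z U /\
  (\dim U = 1%N /\ totally_real z U /\ has_rank U 1 /\ ~ maximal_LTS z U).
Proof.
move=> /(Geo_pull F unit10)/(prop_Geo hm)[h1 h2 h3 h4 h5].
have [t1 t2 t3] := transfer unit10 h1 h2 h4.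
have t4 := (treal_pull F unit10 hUm).2 h3.
have t5 : ~ maximal_LTS z U by move/(maximal_pull F unit10 hUm).
by [].
Qed.

Lemma G1_props k : type_G1 z k U -> Lie_triple_system z U /\
  (\dim U = (2 * k)%N /\ complex_subspace z U /\ has_rank U 2 /\
     (maximal_LTS z U <-> k = (m - 1)%N /\ (2 <= m - 1)%N)).
Proof.
move=> [hk [_ hc [A CQ hA]] hd]; have [r [s ad]] := fr_ex2 F CQ; have [_ h _] := ad.
have [h1 h2 h3 h4 h5] := prop_G1 hm hk (G1_pull F ad hUm hc hd hA).
have [t1 t2 t3] := transfer h h1 h2 h4.
have t4 := (complex_pull F h hUm).2 h3.
have t5 := iff_trans (maximal_pull F h hUm) h5.
by [].
Qed.

Lemma G2_props k1 k2 : type_G2 z k1 k2 U -> Lie_triple_system z U /\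
  (\dim U = (k1 + k2)%N /\ totally_real z U /\ has_rank U 2 /\
     (maximal_LTS z U <-> (k1 + k2)%N = m /\ (3 <= m)%N)).
Proof.
move=> [k1p k2p kk [A [W1 [W2 [CQ [s1 s2] [d1 d2] ho ds]]]]].
have [r [s ad]] := fr_ex2 F CQ; have [_ h _] := ad.
have [h1 h2 h3 h4 h5] := prop_G2 hm k1p k2p kk (G2_pull F ad s1 s2 d1 d2 ho ds).
have [t1 t2 t3] := transfer h h1 h2 h4.
have t4 := (treal_pull F h hUm).2 h3.
have t5 := iff_trans (maximal_pull F h hUm) h5.
by [].
Qed.

Lemma G3_props : type_G3 z U -> Lie_triple_system z U /\
  (\dim U = 3%N /\ (~ complex_subspace z U /\ ~ totally_real z U) /\
     has_rank U 2 /\ (maximal_LTS z U <-> m = 2%N)).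
Proof.
move=> [A [x [y [CQ hx hy ho ds]]]].
have [r [s ad]] := fr_ex2 F CQ; have [_ h _] := ad.
have [h1 h2 [h3 h3'] h4 h5] := prop_G3 hm (G3_pull F ad hx hy ho ds).
have [t1 t2 t3] := transfer h h1 h2 h4.
have t4 : ~ complex_subspace z U by move/(complex_pull F h hUm).
have t6 : ~ totally_real z U by move/(treal_pull F h hUm).
have t5 := iff_trans (maximal_pull F h hUm) h5.
by [].
Qed.

Lemma P1_props k : type_P1 z k U -> Lie_triple_system z U /\
  (\dim U = k /\ totally_real z U /\ has_rank U 1 /\ (maximal_LTS z U <-> k = m)).
Proof.
move=> [hk [A [CQ hV dU]]]; have [r [s ad]] := fr_ex2 F CQ; have [_ h _] := ad.
have [h1 h2 h3 h4 h5] := prop_P1 hm hk (P1_pull F ad hV dU).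
have [t1 t2 t3] := transfer h h1 h2 h4.
have t4 := (treal_pull F h hUm).2 h3.
have t5 := iff_trans (maximal_pull F h hUm) h5.
by [].
Qed.

Lemma P2_props : type_P2 z U -> Lie_triple_system z U /\
  (\dim U = 2%N /\ complex_subspace z U /\ has_rank U 1 /\ (maximal_LTS z U <-> m = 2%N)).
Proof.
move=> [A [x [CQ hV xx eU]]]; have [r [s ad]] := fr_ex2 F CQ; have [_ h _] := ad.
have [h1 h2 h3 h4 h5] := prop_P2 hm (P2_pull F ad hV xx eU).
have [t1 t2 t3] := transfer h h1 h2 h4.
have t4 := (complex_pull F h hUm).2 h3.
have t5 := iff_trans (maximal_pull F h hUm) h5.
by [].
Qed.

Lemma A_props : type_A z U -> Lie_triple_system z U /\
  ((3 <= m)%N /\ \dim U = 2%N /\ (~ complex_subspace z U /\ ~ totally_real z U) /\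
     has_rank U 1 /\ (maximal_LTS z U <-> m = 3%N)).
Proof.
move=> [A [x [y [t [CQ [hx hy ht] ho ds]]]]].
have [r [s ad]] := fr_ex2 F CQ; have [_ h _] := ad.
have [m3 [h1 h2 [h3 h3'] h4 h5]] := prop_A hm (A_pull F ad hx hy ht ho ds).
have [t1 t2 t3] := transfer h h1 h2 h4.
have t4 : ~ complex_subspace z U by move/(complex_pull F h hUm).
have t6 : ~ totally_real z U by move/(treal_pull F h hUm).
have t5 := iff_trans (maximal_pull F h hUm) h5.
by [].
Qed.

Lemma I1_props k : type_I1 z k U -> Lie_triple_system z U /\
  (\dim U = (2 * k)%N /\ complex_subspace z U /\ has_rank U 1 /\
     (maximal_LTS z U <-> (2 * k)%N = m /\ (4 <= m)%N)).
Proof.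
move=> hI; have [k1 hn] := I1_pull F unit10 hI; have [hc _ h2] := hn.
have [h1 h4 h5] := prop_I1 hm k1 hn.
have [t1 t2 t3] := transfer unit10 h1 h2 h4.
have t4 := (complex_pull F unit10 hUm).2 hc.
have t5 := iff_trans (maximal_pull F unit10 hUm) h5.
by [].
Qed.

Lemma I2_props k : type_I2 z k U -> Lie_triple_system z U /\
  (\dim U = k /\ totally_real z U /\ has_rank U 1 /\ ~ maximal_LTS z U).
Proof.
move=> hI; have [k1 hn] := I2_pull F unit10 hI; have [ht _ h2] := hn.
have [h1 h4 h5] := prop_I2 hm k1 hn.
have [t1 t2 t3] := transfer unit10 h1 h2 h4.
have t4 := (treal_pull F unit10 hUm).2 ht.
have t5 : ~ maximal_LTS z U by move/(maximal_pull F unit10 hUm).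
by [].
Qed.

End Main.
Theorem theorem4p1 (R : realType) (m : nat) (hm : (2 <= m)%N)
    (z : 'cV[R[i]]_m.+2) (hz : quadric_lift z)
    (U : {vspace 'M[R]_m.+2}) (hU0 : U != 0%VS) (hU : [set` U] `<` mspace z) :
  (Lie_triple_system z U <->
     type_Geo z U \/
     (exists k, type_G1 z k U) \/
     (exists k1 k2, type_G2 z k1 k2 U) \/
     type_G3 z U \/
     (exists k, type_P1 z k U) \/
     type_P2 z U \/
     type_A z U \/
     (exists k, type_I1 z k U) \/
     (exists k, type_I2 z k U)) /\
  (type_Geo z U ->
     \dim U = 1%N /\ totally_real z U /\ has_rank U 1 /\ ~ maximal_LTS z U) /\
  (forall k, type_G1 z k U ->
     \dim U = (2 * k)%N /\ complex_subspace z U /\ has_rank U 2 /\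
     (maximal_LTS z U <-> k = (m - 1)%N /\ (2 <= m - 1)%N)) /\
  (forall k1 k2, type_G2 z k1 k2 U ->
     \dim U = (k1 + k2)%N /\ totally_real z U /\ has_rank U 2 /\
     (maximal_LTS z U <-> (k1 + k2)%N = m /\ (3 <= m)%N)) /\
  (type_G3 z U ->
     \dim U = 3%N /\ (~ complex_subspace z U /\ ~ totally_real z U) /\
     has_rank U 2 /\ (maximal_LTS z U <-> m = 2%N)) /\
  (forall k, type_P1 z k U ->
     \dim U = k /\ totally_real z U /\ has_rank U 1 /\
     (maximal_LTS z U <-> k = m)) /\
  (type_P2 z U ->
     \dim U = 2%N /\ complex_subspace z U /\ has_rank U 1 /\
     (maximal_LTS z U <-> m = 2%N)) /\
  (type_A z U ->
     (3 <= m)%N /\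
     \dim U = 2%N /\ (~ complex_subspace z U /\ ~ totally_real z U) /\
     has_rank U 1 /\ (maximal_LTS z U <-> m = 3%N)) /\
  (forall k, type_I1 z k U ->
     \dim U = (2 * k)%N /\ complex_subspace z U /\ has_rank U 1 /\
     (maximal_LTS z U <-> (2 * k)%N = m /\ (4 <= m)%N)) /\
  (forall k, type_I2 z k U ->
     \dim U = k /\ totally_real z U /\ has_rank U 1 /\ ~ maximal_LTS z U).
Proof.
have [Phi F] := frames_exist hz.
split.
  split; first exact: (types_of_LTS hm F hU0 hU).
  case=> [/(Geo_props hm F hU)[]//|].
  case=> [[k /(G1_props hm F hU)[]//]|].
  case=> [[k1 [k2 /(G2_props hm F hU)[]//]]|].
  case=> [/(G3_props hm F hU)[]//|].
  case=> [[k /(P1_props hm F hU)[]//]|].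
  case=> [/(P2_props hm F hU)[]//|].
  case=> [/(A_props hm F hU)[]//|].
  by case=> -[k]; [case/(I1_props hm F hU)|case/(I2_props hm F hU)].
split; first by case/(Geo_props hm F hU).
split; first by move=> k /(G1_props hm F hU)[].
split; first by move=> k1 k2 /(G2_props hm F hU)[].
split; first by case/(G3_props hm F hU).
split; first by move=> k /(P1_props hm F hU)[].
split; first by case/(P2_props hm F hU).
split; first by case/(A_props hm F hU).
by split=> k; [case/(I1_props hm F hU)|case/(I2_props hm F hU)].
Qed.
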